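(* Let $k$ be a field, $q\in k^\times$, and $\Lambda=\Lambda_q=k\langle x,y\rangle/(x^2,y^2,xy+qyx)$. In $\mathrm{HH}^*(\Lambda)$, in each of the following cases, the Gerstenhaber brackets of pairs of elements of the indicated set are as listed, and all brackets of pairs of elements of that set not listed (and not obtained from a listed one by graded antisymmetry) are zero. (1) $q$ is not a root of unity; set $\{xy,\ x\epsilon_{1,0}^*,\ y\epsilon_{0,1}^*\}$: $[x\epsilon_{1,0}^*,xy]=xy$, $[y\epsilon_{0,1}^*,xy]=xy$. (2) $\mathrm{char}(k)\ne2$ and $q=-1$; set $\{x,y,x\epsilon_{1,0}^*,y\epsilon_{0,1}^*,\epsilon_{2,0}^*,\epsilon_{0,2}^*\}$: $[x\epsilon_{1,0}^*,x]=x$, $[y\epsilon_{0,1}^*,y]=y$, $[x\epsilon_{1,0}^*,\epsilon_{2,0}^*]=-2\epsilon_{2,0}^*$, $[y\epsilon_{0,1}^*,\epsilon_{0,2}^*]=-2\epsilon_{0,2}^*$. (3) $\mathrm{char}(k)\ne2$ and $q\neq 1$ is a primitive $r$th root of unity with $r$ odd; set $\{xy,x\epsilon_{1,0}^*,y\epsilon_{0,1}^*,\epsilon_{2r,0}^*,\epsilon_{r,r}^*,\epsilon_{0,2r}^*\}$: $[x\epsilon_{1,0}^*,xy]=xy$, $[y\epsilon_{0,1}^*,xy]=xy$, $[\epsilon_{2r,0}^*,x\epsilon_{1,0}^*]=2r\epsilon_{2r,0}^*$, $[\epsilon_{r,r}^*,x\epsilon_{1,0}^*]=r\epsilon_{r,r}^*$,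 $[\epsilon_{r,r}^*,y\epsilon_{0,1}^*]=r\epsilon_{r,r}^*$, $[\epsilon_{0,2r}^*,y\epsilon_{0,1}^*]=2r\epsilon_{0,2r}^*$. (4) $q\ne1$ is a primitive $r$th root of unity, and either $\mathrm{char}(k)\ne2$ and $r$ is even, or $\mathrm{char}(k)=2$; set $\{xy,x\epsilon_{1,0}^*,y\epsilon_{0,1}^*,\epsilon_{r,0}^*,\epsilon_{0,r}^*\}$: $[x\epsilon_{1,0}^*,xy]=xy$, $[y\epsilon_{0,1}^*,xy]=xy$, $[\epsilon_{r,0}^*,x\epsilon_{1,0}^*]=r\epsilon_{r,0}^*$, $[\epsilon_{0,r}^*,y\epsilon_{0,1}^*]=r\epsilon_{0,r}^*$. (5) $\mathrm{char}(k)=2$ and $q=1$; set $\{x,y,\epsilon_{1,0}^*,\epsilon_{0,1}^*\}$: $[x,\epsilon_{1,0}^*]=1$, $[y,\epsilon_{0,1}^*]=1$. (6) $\mathrm{char}(k)\ne2$ and $q=1$; set $\{xy,x\epsilon_{1,0}^*,y\epsilon_{1,0}^*,x\epsilon_{0,1}^*,y\epsilon_{0,1}^*,\epsilon_{2,0}^*,\epsilon_{1,1}^*,\epsilon_{0,2}^*\}$: $[xy,x\epsilon_{1,0}^*]=-xy$, $[xy,y\epsilon_{0,1}^*]=-xy$, $[xy,\epsilon_{2,0}^*]=-2y\epsilon_{1,0}^*$, $[xy,\epsilon_{1,1}^*]=-y\epsilon_{0,1}^*+x\epsilon_{1,0}^*$, $[xy,\epsilon_{0,2}^*]=2x\epsilon_{0,1}^*$,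 $[x\epsilon_{1,0}^*,y\epsilon_{1,0}^*]=-y\epsilon_{1,0}^*$, $[x\epsilon_{1,0}^*,x\epsilon_{0,1}^*]=x\epsilon_{0,1}^*$, $[y\epsilon_{1,0}^*,x\epsilon_{0,1}^*]=y\epsilon_{0,1}^*-x\epsilon_{1,0}^*$, $[y\epsilon_{1,0}^*,y\epsilon_{0,1}^*]=-y\epsilon_{1,0}^*$, $[x\epsilon_{0,1}^*,y\epsilon_{0,1}^*]=x\epsilon_{0,1}^*$, $[x\epsilon_{1,0}^*,\epsilon_{2,0}^*]=-2\epsilon_{2,0}^*$, $[x\epsilon_{1,0}^*,\epsilon_{1,1}^*]=-\epsilon_{1,1}^*$, $[y\epsilon_{1,0}^*,\epsilon_{1,1}^*]=-\epsilon_{2,0}^*$, $[y\epsilon_{1,0}^*,\epsilon_{0,2}^*]=-2\epsilon_{1,1}^*$, $[x\epsilon_{0,1}^*,\epsilon_{2,0}^*]=-2\epsilon_{1,1}^*$, $[x\epsilon_{0,1}^*,\epsilon_{1,1}^*]=-\epsilon_{0,2}^*$, $[y\epsilon_{0,1}^*,\epsilon_{1,1}^*]=-\epsilon_{1,1}^*$, $[y\epsilon_{0,1}^*,\epsilon_{0,2}^*]=-2\epsilon_{0,2}^*$.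
   Context: $\mathrm{HH}^*(\Lambda)=\mathrm{Ext}^*_{\Lambda^e}(\Lambda,\Lambda)$, $\Lambda^e=\Lambda\otimes\Lambda^{op}$. The free $\Lambda^e$-resolution $\mathbb K$ of $\Lambda$ used to represent classes has $\mathbb K_n$ free as a $\Lambda$-bimodule on generators $\epsilon_{i,j}$ with $i,j\ge0$, $i+j=n$, with differential $$d(\epsilon_{i,j})=x\epsilon_{i-1,j}+(-1)^{i+j}q^j\epsilon_{i-1,j}x+q^iy\epsilon_{i,j-1}+(-1)^{i+j}\epsilon_{i,j-1}y$$ (terms with a negative index are zero), and augmentation $\epsilon_{0,0}\mapsto1$. It is compared with the bar resolution $\mathbb{B}$ (with $\mathbb{B}_n=\Lambda^{\otimes(n+2)}$) by a chain embedding $\iota:\mathbb K\to\mathbb B$ lifting the identity of $\Lambda$, with e.g. $\iota(\epsilon_{0,0})=1\otimes1$, $\iota(\epsilon_{1,0})=1\otimes x\otimes1$, $\iota(\epsilon_{0,1})=1\otimes y\otimes1$, $\iota(\epsilon_{2,0})=1\otimes x\otimes x\otimes1$, $\iota(\epsilon_{1,1})=1\otimes x\otimes y\otimes1+q\otimes y\otimes x\otimes1$, $\iota(\epsilon_{0,2})=1\otimes y\otimes y\otimes1$. For $\lambda\in\Lambda$, $\lambda\epsilon_{i,j}^*\in\mathrm{Hom}_{\Lambda^e}(\mathbb K_{i+j},\Lambda)$ is the bimodule map sending $\epsilon_{i,j}\mapsto\lambda$ and the other generators $\epsilon_{a,b}$, $a+b=i+j$, to $0$; $\epsilon_{i,j}^*=1\epsilon_{i,j}^*$.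 Elements $x,y,xy,1$ standing alone denote classes in $\mathrm{HH}^0(\Lambda)=Z(\Lambda)$. The listed elements are cocycles and denote their cohomology classes. The Gerstenhaber bracket is the standard one: for multilinear cochains $f:\Lambda^{\otimes m}\to\Lambda$, $g:\Lambda^{\otimes n}\to\Lambda$, $[f,g]=f\circ g-(-1)^{(m-1)(n-1)}g\circ f$ with $f\circ g=\sum_{i=1}^m(-1)^{(n-1)(i-1)}f(\mathbf 1^{\otimes(i-1)}\otimes g\otimes\mathbf 1^{\otimes(m-i)})$; it satisfies $[f,g]=-(-1)^{(m-1)(n-1)}[g,f]$. *)

(* Defs.v *)
From HB Require Import structures.
From mathcomp Require Import all_boot all_algebra.
From mathcomp.multinomials Require Import monalg.

Set Implicit Arguments.
Unset Strict Implicit.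
Unset Printing Implicit Defensive.

Import GRing.Theory.
Local Open Scope ring_scope.

(* The free algebra k<x,y>: the monoid algebra of the free monoid on two
   letters, with false standing for x and true for y. *)
Definition free_xy (k : fieldType) := {malg k[{fmonom bool}]}.

Definition gen_x (k : fieldType) : free_xy k := << fmu false >>.
Definition gen_y (k : fieldType) : free_xy k := << fmu true >>.

Definition relators (k : fieldType) (q : k) : seq (free_xy k) :=
  [:: gen_x k ^+ 2; gen_y k ^+ 2; gen_x k * gen_y k + q *: (gen_y k * gen_x k)].

(* p lies in the two-sided ideal of A generated by the elements of rels;
   a member t of s is a triple (left factor, generator, right factor). *)
Definition in_ideal_gen (A : nzRingType) (rels : seq A) (p : A) : Prop :=
  exists s : seq (A * A * A),
    all (fun t => t.1.2 \in rels) s /\ p = \sum_(t <- s) t.1.1 * t.1.2 * t.2.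

(* pi identifies L with k<x,y>/(x^2, y^2, xy + q yx). *)
Definition presents_Lambda (k : fieldType) (q : k) (L : algType k)
    (pi : {lrmorphism free_xy k -> L}) : Prop :=
  (forall a : L, exists p, pi p = a) /\
  (forall p, pi p = 0 <-> in_ideal_gen (relators q) p).

Section Hochschild.
Variables (k : fieldType) (L : algType k).

(* A cochain of degree n is a function on sequences, of which only the values
   on sequences of size n matter. *)
Definition multilinear (n : nat) (f : seq L -> L) : Prop :=
  forall (s t : seq L) (c : k) (u v : L), (size s + size t).+1 = n ->
    f (s ++ (c *: u + v) :: t) = c *: f (s ++ u :: t) + f (s ++ v :: t).

(* The differential of Hom_{L^e}(B_n, L) = {n-linear maps}. *)
Definition hoch_d (n : nat) (f : seq L -> L) (s : seq L) : L :=
  s`_0 * f (behead s)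
  + \sum_(i < n) (-1) ^+ i.+1 * f (take i s ++ s`_i * s`_i.+1 :: drop i.+2 s)
  + (-1) ^+ n.+1 * (f (take n s) * s`_n).

Definition hoch_cocycle (n : nat) (f : seq L -> L) : Prop :=
  multilinear n f /\ (forall s, size s = n.+1 -> hoch_d n f s = 0).

(* The index i starts at 0, and n.+1 has the parity of n - 1 (also for n = 0,
   where g is an element of L inserted between the arguments of f). *)
Definition circ (m n : nat) (f g : seq L -> L) (s : seq L) : L :=
  \sum_(i < m)
    (-1) ^+ (n.+1 * i) * f (take i s ++ g (take n (drop i s)) :: drop (i + n) s).

(* The bracket of cochains of degrees m and n has degree m + n - 1; for
   m = n = 0 it is 0, in accordance with HH^{-1} = 0. *)
Definition gbracket (m n : nat) (f g : seq L -> L) (s : seq L) : L :=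
  circ m n f g s - (-1) ^+ (m.+1 * n.+1) * circ n m g f s.

End Hochschild.

Section Koszul.
Variables (k : fieldType) (q : k) (L : algType k) (x y : L).

(* A bimodule map K_n -> L is given by the images phi i j of the generators
   epsilon_{i,j}, i + j = n; for phi : nat -> nat -> L only the values with
   i + j = n matter.  This is phi |-> phi o d. *)
Definition kos_d (phi : nat -> nat -> L) (i j : nat) : L :=
  (if i is i'.+1 then
     x * phi i' j + (-1) ^+ (i + j) * (q ^+ j *: (phi i' j * x))
   else 0)
  + (if j is j'.+1 then
       q ^+ i *: (y * phi i j') + (-1) ^+ (i + j) * (phi i j' * y)
     else 0).

Definition kos_cocycle (n : nat) (phi : nat -> nat -> L) : Prop :=
  forall i j, (i + j = n.+1)%N -> kos_d phi i j = 0.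

(* phi and psi differ by a coboundary (for n = 0: are equal). *)
Definition kos_cohomologous (n : nat) (phi psi : nat -> nat -> L) : Prop :=
  exists theta : nat -> nat -> L,
    forall i j, (i + j = n)%N -> phi i j - psi i j = kos_d theta i j.

Fixpoint words (n : nat) : seq (seq bool) :=
  if n is m.+1 then [seq b :: w | b <- [:: false; true], w <- words m]
  else [:: [::]].

(* The number of pairs of positions at which a y (true) precedes an x. *)
Fixpoint inv (w : seq bool) : nat :=
  if w is b :: w' then ((if b then count_mem false w' else 0) + inv w')%N else 0.

Definition letter (b : bool) : L := if b then y else x.

(* f |-> f o iota, where iota : K -> B sends epsilon_{i,j} to the sum of
   q ^ inv(w) (1 (x) w_1 (x) ... (x) w_{i+j} (x) 1)
   over all words w with i letters x and j letters y.
   Lemma iota_chain below shows that iota commutes with the differentials. *)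
Definition iota_pull (f : seq L -> L) (i j : nat) : L :=
  \sum_(w <- words (i + j) | count_mem true w == j)
    q ^+ inv w *: f (map letter w).

Lemma words_size n w : w \in words n -> size w = n.
Proof.
elim: n w => [|n IHn] w; first by rewrite inE => /eqP ->.
by case/allpairsP=> -[b v] /= [_ /IHn sv ->] /=; rewrite sv.
Qed.

(* The sum defining iota, over words of length n with j letters y. *)
Definition word_sum (n j : nat) (F : seq bool -> L) : L :=
  \sum_(w <- words n | count_mem true w == j) q ^+ inv w *: F w.

Lemma eq_word_sum n j F G : (forall w, size w = n -> F w = G w) ->
  word_sum n j F = word_sum n j G.
Proof.
move=> eFG; rewrite /word_sum big_seq_cond [RHS]big_seq_cond.
by apply: eq_bigr => w /andP[/words_size/eFG -> _].
Qed.

Lemma word_sum0 n j F : (forall w, size w = n -> F w = 0) -> word_sum n j F = 0.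
Proof.
move=> F0; rewrite /word_sum big_seq_cond big1 // => w /andP[/words_size/F0 -> _].
exact: scaler0.
Qed.

Lemma word_sum_gt n j F : (n < j)%N -> word_sum n j F = 0.
Proof.
move=> ltnj; rewrite /word_sum big_seq_cond big1 // => w /andP[/words_size sw].
by move=> /eqP cw; move: ltnj; rewrite -cw -sw ltnNge count_size.
Qed.

Lemma word_sumD n j F G :
  word_sum n j (fun w => F w + G w) = word_sum n j F + word_sum n j G.
Proof. by rewrite -big_split; apply: eq_bigr => w _; rewrite scalerDr. Qed.

Lemma word_sumZ n j c F :
  word_sum n j (fun w => c *: F w) = c *: word_sum n j F.
Proof. by rewrite scaler_sumr; apply: eq_bigr => w _; rewrite !scalerA mulrC. Qed.

Lemma word_sum_sum n j (m : nat) (F : 'I_m -> seq bool -> L) :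
  word_sum n j (fun w => \sum_(p < m) F p w) = \sum_(p < m) word_sum n j (F p).
Proof.
by rewrite exchange_big; apply: eq_bigr => w _; rewrite scaler_sumr.
Qed.

Lemma word_sumMl n j a F :
  word_sum n j (fun w => a * F w) = a * word_sum n j F.
Proof. by rewrite mulr_sumr; apply: eq_bigr => w _; rewrite scalerAr. Qed.

Lemma word_sumMr n j a F :
  word_sum n j (fun w => F w * a) = word_sum n j F * a.
Proof. by rewrite mulr_suml; apply: eq_bigr => w _; rewrite scalerAl. Qed.

Lemma word_sum_cons n j F :
  word_sum n.+1 j F = word_sum n j (fun w => F (false :: w)) +
    (if j is j'.+1 then
       q ^+ (n - j') *: word_sum n j' (fun w => F (true :: w)) else 0).
Proof.
rewrite /word_sum /= cats0 big_cat !big_map; congr (_ + _).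
case: j => [|j]; first by rewrite big_pred0.
rewrite scaler_sumr big_seq_cond [RHS]big_seq_cond.
apply: eq_big => [w|w /andP[/words_size sw]] //=.
rewrite add1n eqSS => /eqP cw; rewrite scalerA -exprD.
suff -> : count_mem false w = (n - j)%N by [].
rewrite -sw -cw -(count_predC (pred1 true)) addKn.
by apply: eq_count => -[].
Qed.

Lemma word_sum_nil j F : word_sum 0 j F = if j == 0%N then F [::] else 0.
Proof. by rewrite /word_sum big_mkcond big_seq1 scale1r eq_sym. Qed.

Lemma word_sum_rcons n j F :
  word_sum n.+1 j F = q ^+ j *: word_sum n j (fun w => F (rcons w false)) +
    (if j is j'.+1 then word_sum n j' (fun w => F (rcons w true)) else 0).
Proof.
elim: n j F => [|n IHn] j F.
  rewrite word_sum_cons; case: j => [|[|j]]; rewrite !word_sum_nil /=;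
    by rewrite ?expr0 ?scale1r ?scaler0.
rewrite word_sum_cons IHn [in RHS]word_sum_cons.
case: j => [|j]; first by rewrite !addr0.
rewrite IHn [in RHS]word_sum_cons !scalerDr !scalerA -!addrA; congr (_ + _).
rewrite addrCA; case: (ltnP n j) => [ltnj|lejn].
  rewrite !(word_sum_gt _ ltnj) !scaler0 !add0r; case: j ltnj => [|j] ltnj.
    by rewrite scaler0.
  by rewrite subSS.
rewrite subSn // -!exprD addSnnS addnC; congr (_ + (_ + _)).
by case: j lejn => [|j] ltjn; rewrite ?scaler0 // -subSn.
Qed.

(* The terms of the bar differential that multiply two adjacent letters cancel. *)
Lemma word_sum_adjacent p n j F :
  (forall u v, size u = p -> F (u ++ [:: false, false & v]) = 0) ->
  (forall u v, size u = p -> F (u ++ [:: true, true & v]) = 0) ->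
  (forall u v, size u = p ->
     F (u ++ [:: false, true & v]) + q *: F (u ++ [:: true, false & v]) = 0) ->
  (p.+1 < n)%N -> word_sum n j F = 0.
Proof.
elim: p n j F => [|p IHp] [|[|n]] //= j F Fxx Fyy Fxy ltpn; last first.
  rewrite word_sum_cons IHp // => [|u v su|u v su|u v su]; last first.
  - exact: (Fxy (false :: u) v (congr1 S su)).
  - exact: (Fyy (false :: u) v (congr1 S su)).
  - exact: (Fxx (false :: u) v (congr1 S su)).
  rewrite add0r; case: j => // j; rewrite IHp ?scaler0 // => u v su.
  - exact: (Fxx (true :: u) v (congr1 S su)).
  - exact: (Fyy (true :: u) v (congr1 S su)).
  - exact: (Fxy (true :: u) v (congr1 S su)).
rewrite !word_sum_cons.
rewrite (word_sum0 _ (F := fun w => F [:: false, false & w])) => [|w _]; last first.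
  exact: (Fxx [::]).
rewrite add0r; case: j => [|j]; first by rewrite addr0.
rewrite !word_sum_cons.
have -> : (if j is j'.+1 then
   q ^+ (n - j') *: word_sum n j' (fun w => F [:: true, true & w]) else 0) = 0.
  case: j => // j; rewrite word_sum0 ?scaler0 // => w _; exact: (Fyy [::]).
rewrite addr0; case: (ltnP n j) => [ltnj|lejn].
  by rewrite !(word_sum_gt _ ltnj) !scaler0 addr0.
rewrite subSn // exprSr -scalerA -scalerDr -word_sumZ -word_sumD.
by rewrite word_sum0 ?scaler0 // => w _; exact: (Fxy [::]).
Qed.

Lemma multilinear0 n (f : seq L -> L) (s t : seq L) :
  multilinear n f -> (size s + size t).+1 = n -> f (s ++ 0 :: t) = 0.
Proof.
move=> fL sz; have := fL s t (-1) 0 0 sz.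
by rewrite scaler0 addr0 scaleN1r addNr.
Qed.

Lemma iota_chain (n : nat) (f : seq L -> L) (i j : nat) :
    x * x = 0 -> y * y = 0 -> x * y + q *: (y * x) = 0 ->
    multilinear n f -> (i + j = n.+1)%N ->
  iota_pull (hoch_d n f) i j = kos_d (iota_pull f) i j.
Proof.
move=> xx yy xy fL eij.
have pullE g a b : iota_pull g a b = word_sum (a + b) b (g \o map letter) by [].
rewrite pullE eij /kos_d.
have -> : word_sum n.+1 j (hoch_d n f \o map letter) =
    word_sum n.+1 j (fun w => (map letter w)`_0 * f (behead (map letter w))) +
    word_sum n.+1 j (fun w =>
      (-1) ^+ n.+1 * (f (take n (map letter w)) * (map letter w)`_n)).
  rewrite !word_sumD word_sum_sum big1 ?addr0 // => p _.
  have ltp : (p.+1 < n.+1)%N by rewrite ltnS ltn_ord.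
  have prodE u a b v : size u = p -> take p (map letter (u ++ [:: a, b & v])) ++
      (map letter (u ++ [:: a, b & v]))`_p * (map letter (u ++ [:: a, b & v]))`_p.+1
      :: drop p.+2 (map letter (u ++ [:: a, b & v])) =
      map letter u ++ letter a * letter b :: map letter v.
    by move=> <-; elim: u => [|c u IHu] /=; rewrite ?drop0 ?IHu.
  pose G w := if size w == n.+1 then (-1) ^+ p.+1 *
    f (take p (map letter w) ++ (map letter w)`_p * (map letter w)`_p.+1
       :: drop p.+2 (map letter w)) else 0.
  rewrite (eq_word_sum _ (G := G)) => [|w sw]; last by rewrite /G sw eqxx.
  have sz u (v : seq bool) (a b : bool) : size u = p ->
      size (u ++ [:: a, b & v]) = n.+1 ->
      (size (map letter u) + size (map letter v)).+1 = n.
    by rewrite size_cat /= !addnS !size_map => _ [].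
  apply: (word_sum_adjacent (p := p)) => // u v su; rewrite /G.
  - case: eqP => // /sz suv; rewrite prodE // /letter xx (multilinear0 fL) ?mulr0 //.
    exact: suv.
  - case: eqP => // /sz suv; rewrite prodE // /letter yy (multilinear0 fL) ?mulr0 //.
    exact: suv.
  rewrite !size_cat /=; case: eqP => [e|]; last by rewrite scaler0 addr0.
  have suv : (size (map letter u) + size (map letter v)).+1 = n.
    by apply: (sz u v true true su); rewrite size_cat.
  rewrite !prodE // /letter scalerAr -mulrDr.
  rewrite addrC -(fL _ _ q (y * x) (x * y) suv) addrC xy.
  by rewrite (multilinear0 fL) ?mulr0.
rewrite word_sum_cons word_sumMl word_sum_rcons.
have takeE w b : size w = n ->
    take n (map letter (rcons w b)) = map letter w /\
    (map letter (rcons w b))`_n = letter b.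
  move=> sw; rewrite map_rcons -cats1 take_size_cat ?size_map //.
  by rewrite nth_cat size_map sw ltnn subnn.
have lastE b m : word_sum n m (fun w => (-1) ^+ n.+1 *
     (f (take n (map letter (rcons w b))) * (map letter (rcons w b))`_n)) =
    (-1) ^+ n.+1 * (word_sum n m (f \o map letter) * letter b).
  rewrite -word_sumMr -word_sumMl; apply: eq_word_sum => w sw.
  by have [-> ->] := takeE w b sw.
rewrite lastE.
have -> : (if i is i'.+1 then x * iota_pull f i' j +
     (-1) ^+ (i + j) * (q ^+ j *: (iota_pull f i' j * x)) else 0) =
   x * word_sum n j (f \o map letter) +
     (-1) ^+ n.+1 * (q ^+ j *: (word_sum n j (f \o map letter) * x)).
  case: i eij => [|i] eij; last by rewrite eij pullE; case: eij => ->.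
  by rewrite word_sum_gt -?eij // mulr0 mul0r scaler0 mulr0 addr0.
rewrite -scalerAr /=.
case: j eij => [|j] eij; first by rewrite !addr0.
rewrite lastE eij word_sumMl pullE /=.
have [-> ->] : (i + j = n /\ n - j = i)%N.
  by move: eij; rewrite addnS => -[<-]; rewrite addnK.
by rewrite addrACA.
Qed.

(* iota lifts the identity of L, and iota(epsilon_{1,1}) is
   1 (x) x (x) y (x) 1 + q (x) y (x) x (x) 1. *)
Lemma iota_pull00 f : iota_pull f 0 0 = f [::].
Proof. by rewrite /iota_pull big_mkcond big_seq1 scale1r. Qed.

Lemma iota_pull11 f : iota_pull f 1 1 = f [:: x; y] + q *: f [:: y; x].
Proof.
by rewrite /iota_pull big_mkcond /= !big_cons big_nil /= !add0r addr0 scale1r.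
Qed.

(* The class of phi in HH^n is represented by the Hochschild cocycle f. *)
Definition represents (n : nat) (f : seq L -> L) (phi : nat -> nat -> L) : Prop :=
  [/\ hoch_cocycle n f, kos_cocycle n phi &
      kos_cohomologous n (iota_pull f) phi].

(* [phi, psi] = chi in HH^{m + n - 1}, for classes phi, psi in HH^m, HH^n. *)
Definition HHbracket (m n : nat) (phi psi chi : nat -> nat -> L) : Prop :=
  [/\ exists f, represents m f phi,
      exists g, represents n g psi &
      forall f g, represents m f phi -> represents n g psi ->
        represents (m + n).-1 (gbracket m n f g) chi].

End Koszul.

(* ((a, b), (i, j)) names x^a y^b epsilon_{i,j}^*; an element z of HH^0 is
   z epsilon_{0,0}^*. *)
Definition elt : Type := ((nat * nat) * (nat * nat))%type.

Definition eps (i j : nat) : elt := ((0, 0), (i, j))%N.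
Definition xeps (i j : nat) : elt := ((1, 0), (i, j))%N.
Definition yeps (i j : nat) : elt := ((0, 1), (i, j))%N.
Definition x0 : elt := xeps 0 0.
Definition y0 : elt := yeps 0 0.
Definition xy0 : elt := ((1, 1), (0, 0))%N.
Definition one0 : elt := eps 0 0.

Definition deg (e : elt) : nat := (e.2.1 + e.2.2)%N.

Section Tables.
Variables (k : fieldType) (q : k) (L : algType k) (x y : L).

Definition cochain_of (e : elt) (i j : nat) : L :=
  if (i, j) == e.2 then x ^+ e.1.1 * y ^+ e.1.2 else 0.

Definition comb_of (c : seq (k * elt)) (i j : nat) : L :=
  \sum_(t <- c) t.1 *: cochain_of t.2 i j.

Definition bracket_is (a b : elt) (c : seq (k * elt)) : Prop :=
  HHbracket q x y (deg a) (deg b) (cochain_of a) (cochain_of b) (comb_of c).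

(* The brackets of pairs of elements of S are those listed in T; those of pairs
   that do not occur in T in either order vanish. *)
Definition bracket_table (S : seq elt) (T : seq (elt * elt * seq (k * elt))) :
    Prop :=
  (forall a b c, (a, b, c) \in T -> bracket_is a b c) /\
  (forall a b, a \in S -> b \in S ->
     (a, b) \notin unzip1 T -> (b, a) \notin unzip1 T -> bracket_is a b [::]).

End Tables.

(* Main.v *)
Require Import Defs.
From HB Require Import structures.
From mathcomp Require Import all_boot all_algebra.
From mathcomp.multinomials Require Import monalg.
From mathcomp Require Import ring zify.

Set Implicit Arguments.
Unset Strict Implicit.
Unset Printing Implicit Defensive.

Import GRing.Theory.
Local Open Scope ring_scope.

(** [K] is embedded in the bar complex by [iota], so a bracket can be computed on
    words in [x], [y] once cocycles on the bar complex are known and the bracket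
    is known to be independent of their choice.

    Cocycles.  Prepending a slot to a cochain that is central up to a diagonal
    automorphism gives again such a cochain, with a shifted automorphism.
    Iterating, every [x^a y^b eps_{i,j}^*] of the theorem is the restriction of an
    explicit normalized cocycle, which on words takes the value [x^a y^b] at
    [x^i y^j] and vanishes elsewhere.

    Independence.  Insertion of a cochain into multilinear functions is a
    coderivation of the tensor coalgebra, and commutators of coderivations are
    brackets.  Hence brackets of cocycles are cocycles and bracketing with a
    coboundary gives a coboundary.  That a cocycle with trivial restriction to [K]
    is a coboundary follows by dimension shift: a normalized [n]-cocycle is a
    central element of an iterated bimodule [Hom(L/k, Hom(L/k, ...))], and one step
    of the shift is injective on Koszul cohomology, by an explicit primitive.

    Brackets.  [x eps_{1,0}^*] and [y eps_{0,1}^*] act by counting letters.  Other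
    brackets vanish because the cocycles are normalized, or, for [xy] with
    [eps_{i,j}^*] and [q <> 1], because the Koszul cocycle condition leaves only
    coboundaries; the rest involve words of length at most two. *)

(** * Linear identities in a module *)

(** No comparison map from the bar complex back to K is constructed; it would need a formula on all
    tensors. Only injectivity of restriction on cohomology is required, and for this one tensor
    factor can be traded at a time against one Koszul degree. Normalization makes the trade finite:
    Hom(L/k, M) is three copies of M, the values at x, y and xy, so exactness of one step is a
    computation with three coordinates. The step is injective on cohomology only from degree 1 on;
    out of degree 0 it shows instead that a central element is inner, and the element inducing it is
    the Hochschild primitive. The twists by automorphisms reflect the factors q^i, q^j and the signs
    in the differential of K: a multiple of a dual generator is a cocycle exactly when its
    coefficient commutes with x and y up to these factors. Degrees are natural numbers with a
    truncated predecessor, so two cochains of degree 0 form a separate case throughout, where the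
    bracket is zero. *)

Section ModuleExpressions.
Variables (k : fieldType) (M : lmodType k).

(** Reified linear expressions. Equality of the coefficients of every atom suffices for equality of
    the values, which reduces a module identity to equations in [k] for [ring] and [field]. Atoms
    may be dependent, so the test is sufficient only. *)
Inductive mexp :=
  | MVar of nat
  | MZero
  | MAdd of mexp & mexp
  | MOpp of mexp
  | MScale of k & mexp.

Fixpoint minterp (vs : seq M) (e : mexp) : M :=
  match e with
  | MVar i => vs`_i
  | MZero => 0
  | MAdd e1 e2 => minterp vs e1 + minterp vs e2
  | MOpp e1 => - minterp vs e1
  | MScale c e1 => c *: minterp vs e1
  end.

Fixpoint mcoef (e : mexp) (i : nat) : k :=
  match e with
  | MVar j => if Nat.eqb j i then 1 else 0
  | MZero => 0
  | MAdd e1 e2 => mcoef e1 i + mcoef e2 i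
  | MOpp e1 => - mcoef e1 i
  | MScale c e1 => c * mcoef e1 i
  end.

Fixpoint magree (n : nat) (e1 e2 : mexp) : Prop :=
  if n is n'.+1 then mcoef e1 n' = mcoef e2 n' /\ magree n' e1 e2 else True.

Lemma minterpE vs e :
  minterp vs e = \sum_(i < size vs) mcoef e i *: vs`_i.
Proof.
elim: e => [j||e1 IH1 e2 IH2|e1 IH1|c e1 IH1] /=.
- have [ltj|lej] := ltnP j (size vs); last first.
    rewrite nth_default // big1 // => i _.
    have -> : Nat.eqb j i = false.
      apply/negbTE/negP => /PeanoNat.Nat.eqb_spec ji.
      by move: (ltn_ord i); rewrite -ji ltnNge lej.
    by rewrite scale0r.
  rewrite (bigD1 (Ordinal ltj)) //= PeanoNat.Nat.eqb_refl scale1r big1 ?addr0 //.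
  move=> i /eqP ij; have -> : Nat.eqb j i = false; last by rewrite scale0r.
  by apply/negbTE/negP => /PeanoNat.Nat.eqb_spec ji; apply: ij; apply: val_inj.
- by rewrite big1 // => i _; rewrite scale0r.
- by rewrite IH1 IH2 -big_split; apply: eq_bigr => i _; rewrite scalerDl.
- by rewrite IH1 -sumrN; apply: eq_bigr => i _; rewrite scaleNr.
- by rewrite IH1 scaler_sumr; apply: eq_bigr => i _; rewrite scalerA.
Qed.

Lemma magreeP vs e1 e2 : magree (size vs) e1 e2 -> minterp vs e1 = minterp vs e2.
Proof.
rewrite !minterpE => eq12; apply: eq_bigr => i _; congr (_ *: _).
elim: (size vs) i eq12 => [|n IHn] [i lti] //= [eqn eq12].
by move: lti; rewrite ltnS leq_eqVlt => /orP[/eqP -> //|lti]; apply: (IHn (Ordinal lti)).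
Qed.

End ModuleExpressions.

(** The inner [match] runs [unify] while a term is being computed, so atoms are identified by
    unification and not by syntax. *)
Ltac atom_index t vs :=
  match vs with
  | ?u :: _ => let _ := match constr:(tt) with _ => unify t u end in constr:(0%N)
  | _ :: ?vs' => let i := atom_index t vs' in constr:(S i)
  end.

Ltac atom_add t vs :=
  match vs with
  | _ => let i := atom_index t vs in constr:(vs)
  | _ => constr:(t :: vs)
  end.

Ltac atoms t vs :=
  lazymatch t with
  | (?a + ?b)%R => let vs1 := atoms a vs in atoms b vs1
  | (- ?a)%R => atoms a vs
  | (_ *: ?a)%R => atoms a vs
  | 0%R => constr:(vs)
  | _ => atom_add t vs
  end.

Ltac reify k t vs :=
  lazymatch t with
  | (?a + ?b)%R => let ea := reify k a vs in let eb := reify k b vs in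
                   constr:(@MAdd k ea eb)
  | (- ?a)%R => let ea := reify k a vs in constr:(@MOpp k ea)
  | (?c *: ?a)%R => let ea := reify k a vs in constr:(@MScale k c ea)
  | 0%R => constr:(@MZero k)
  | _ => let i := atom_index t vs in constr:(@MVar k i)
  end.

Ltac lmodule_eq k M :=
  match goal with
  | |- ?a = ?b =>
    let vs0 := atoms a (@nil M) in
    let vs := atoms b vs0 in
    let ea := reify k a vs in
    let eb := reify k b vs in
    change (@minterp k M vs ea = @minterp k M vs eb);
    apply: magreeP;
    cbv beta iota zeta delta [magree mcoef size Nat.eqb];
    repeat split
  end.

Ltac lmodule k M := lmodule_eq k M; try (by ring); try (by field).

(** * Coordinates of the quantum exterior algebra *)

Definition basis_comb (k : fieldType) (L : lalgType k) (x y : L) (c : k * k * k * k) : L :=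
  c.1.1.1 *: 1 + c.1.1.2 *: x + c.1.2 *: y + c.2 *: (x * y).

(** The only interface to the algebra once the presentation has been treated: the relations and a
    coordinate bijection with k^4. *)
Record quantum_exterior (k : fieldType) (q : k) (L : algType k) (x y : L) :=
  QuantumExterior {
    qe_neq0 : q != 0;
    qe_xx : x * x = 0;
    qe_yy : y * y = 0;
    qe_xy : x * y + q *: (y * x) = 0;
    qe_coords : L -> k * k * k * k;
    qe_coordsK : cancel qe_coords (basis_comb x y);
    qe_combK : cancel (basis_comb x y) qe_coords }.

(** * Independence of 1, x, y, xy through the regular representation *)

Section RegularRepresentation.
Variables (k : fieldType) (q : k).

(** Left multiplications acting on columns, in the basis 1, x, y, xy numbered from 0 to 3; the entry
    [- q^-1] of [reg_y] is the relation yx = -q^-1 xy. *)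
Definition reg_x : 'M[k]_4 := delta_mx 1 0 + delta_mx 3 2.
Definition reg_y : 'M[k]_4 := delta_mx 2 0 - q^-1 *: delta_mx 3 1.

Lemma reg_mulE :
  [/\ reg_x *m reg_x = 0, reg_y *m reg_y = 0, reg_x *m reg_y = delta_mx 3 0 &
      reg_y *m reg_x = - q^-1 *: delta_mx 3 0].
Proof.
by rewrite /reg_x /reg_y; split;
  rewrite ?(mulmxDl, mulmxDr, mulmxBl, mulmxBr, mulNmx, mulmxN) -?scalemxAl
    -?scalemxAr !mul_delta_mx_cond /= ?(mulr0n, mulr1n, scaler0, oppr0, addr0, add0r)
    -?scaleNr.
Qed.

Section AbstractRepresentation.
Variables (A : lalgType k) (gx gy : A) (rep : A -> 'M[k]_4).
Hypotheses (repM : forall p1 p2, rep (p1 * p2) = rep p1 *m rep p2).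
Hypotheses (repD : forall p1 p2, rep (p1 + p2) = rep p1 + rep p2).
Hypotheses (repZ : forall c p, rep (c *: p) = c *: rep p) (rep1 : rep 1 = 1).
Hypotheses (repx : rep gx = reg_x) (repy : rep gy = reg_y).

Lemma rep_relator p : q != 0 ->
  p \in [:: gx ^+ 2; gy ^+ 2; gx * gy + q *: (gy * gx)] -> rep p = 0.
Proof.
have [xx yy xy yx] := reg_mulE; rewrite !inE => q0 /or3P[] /eqP ->.
- by rewrite expr2 repM repx.
- by rewrite expr2 repM repy.
rewrite repD repZ !repM repx repy xy yx scalerA mulrN divff //.
by rewrite scaleN1r addrN.
Qed.

(** Column 0 is the image of the basis vector 1, so it lists the four coefficients. *)
Lemma rep_comb_eq0 c : rep (basis_comb gx gy c) = 0 -> c = (0, 0, 0, 0).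
Proof.
have [_ _ xy _] := reg_mulE; case: c => [[[a b] c] d].
rewrite /basis_comb 3!repD 4!repZ repM /= rep1 repx repy xy.
move=> /matrixP M0; have := M0 0 0; have := M0 1 0; have := M0 2 0; have := M0 3 0.
rewrite !mxE /=.
rewrite !(mulr0, mulr1, addr0, add0r, subr0, mulr0n, mulr1n, oppr0).
by move=> -> -> -> ->.
Qed.

End AbstractRepresentation.

Definition reg_monom (m : {fmonom bool}) : 'M[k]_4 :=
  \prod_(b <- fmonom_val m) (if b then reg_y else reg_x).

Lemma reg_monom_mmorphism : mmorphism reg_monom.
Proof.
by split=> [m1 m2|]; rewrite /reg_monom ?fmM ?fm1 ?big_cat ?big_nil.
Qed.

HB.instance Definition _ :=
  isMultiplicative.Build {fmonom bool} 'M[k]_4 reg_monom reg_monom_mmorphism.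

Definition reg_rep (p : free_xy k) : 'M[k]_4 := mmap (@scalar_mx k 4) reg_monom p.

HB.instance Definition _ := GRing.Additive.copy reg_rep (mmap (@scalar_mx k 4) reg_monom).

(** Coefficients act by scalar matrices, which commute with the images of all words. *)
Lemma reg_rep_mult : multiplicative reg_rep.
Proof.
apply: (@commr_mmap_is_multiplicative _ _ _ (@scalar_mx k 4) reg_monom) => g m m'.
exact/comm_mx_sym/comm_mx_scalar.
Qed.

Lemma reg_repM p1 p2 : reg_rep (p1 * p2) = reg_rep p1 *m reg_rep p2.
Proof. exact: reg_rep_mult.1. Qed.

Lemma reg_repZ c p : reg_rep (c *: p) = c *: reg_rep p.
Proof. by rewrite /reg_rep mmapZ; exact: mul_scalar_mx. Qed.

Lemma reg_rep_gen_x : reg_rep (gen_x k) = reg_x.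
Proof. by rewrite /reg_rep mmapU; apply: etrans (mul1mx _) _; rewrite /reg_monom fmU big_seq1. Qed.

Lemma reg_rep_gen_y : reg_rep (gen_y k) = reg_y.
Proof. by rewrite /reg_rep mmapU; apply: etrans (mul1mx _) _; rewrite /reg_monom fmU big_seq1. Qed.

Lemma reg_repD p1 p2 : reg_rep (p1 + p2) = reg_rep p1 + reg_rep p2.
Proof. exact: raddfD. Qed.

Lemma reg_rep_relator p : q != 0 -> p \in relators q -> reg_rep p = 0.
Proof. exact: rep_relator reg_repM reg_repD reg_repZ reg_rep_gen_x reg_rep_gen_y p. Qed.

Lemma reg_rep_comb c : reg_rep (basis_comb (gen_x k) (gen_y k) c) = 0 -> c = (0, 0, 0, 0).
Proof.
exact: rep_comb_eq0 reg_repM reg_repD reg_repZ reg_rep_mult.2 reg_rep_gen_x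
  reg_rep_gen_y c.
Qed.

Lemma reg_rep_ideal p : q != 0 -> in_ideal_gen (relators q) p -> reg_rep p = 0.
Proof.
move=> q0 [s [/allP rels ->]]; rewrite raddf_sum big_seq big1 // => t /rels.
move=> /(reg_rep_relator q0) t0.
by rewrite [LHS]reg_repM reg_repM t0 mulmx0 mul0mx.
Qed.

End RegularRepresentation.

(** * Generation by 1, x, y, xy *)

Section Span.
Variables (k : fieldType) (q : k) (L : algType k) (x y : L).
Hypotheses (q_neq0 : q != 0) (xx : x * x = 0) (yy : y * y = 0).
Hypothesis (xy : x * y + q *: (y * x) = 0).

Lemma quantum_yx : y * x = - q^-1 *: (x * y).
Proof.
apply/eqP; rewrite -subr_eq0 scaleNr opprK addrC -[y * x]scale1r -(mulVf q_neq0).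
by rewrite -scalerA -scalerDr xy scaler0.
Qed.

Definition spanned (a : L) := exists c, a = basis_comb x y c.

Lemma spannedD a b : spanned a -> spanned b -> spanned (a + b).
Proof.
move=> [[[[a1 a2] a3] a4] ->] [[[[b1 b2] b3] b4] ->].
by exists (a1 + b1, a2 + b2, a3 + b3, a4 + b4); rewrite /basis_comb /=; lmodule k L.
Qed.

Lemma spannedZ c a : spanned a -> spanned (c *: a).
Proof.
move=> [[[[a1 a2] a3] a4] ->].
by exists (c * a1, c * a2, c * a3, c * a4); rewrite /basis_comb /=; lmodule k L.
Qed.

(** Closure under left multiplication by a letter is all that an induction on words needs. *)
Lemma spannedMl (b : bool) a : spanned a -> spanned ((if b then y else x) * a).
Proof.
move=> [[[[a1 a2] a3] a4] ->]; rewrite /basis_comb /=.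
have yxy : y * (x * y) = 0 by rewrite mulrA quantum_yx -scalerAl -mulrA yy mulr0 scaler0.
have xxy : x * (x * y) = 0 by rewrite mulrA xx mul0r.
rewrite !mulrDr -!scalerAr mulr1; case: b => /=.
  exists (0, 0, a1, - q^-1 * a2); rewrite yxy quantum_yx yy /basis_comb /=; by lmodule k L.
by exists (0, a1, 0, a3); rewrite xxy xx /basis_comb /=; lmodule k L.
Qed.

End Span.

Lemma morph_basis_comb (k : fieldType) (A L : lalgType k) (f : {lrmorphism A -> L})
    (x y : A) c :
  f (basis_comb x y c) = basis_comb (f x) (f y) c.
Proof. by rewrite /basis_comb !raddfD /= !linearZ /= rmorphM rmorph1. Qed.

Lemma basis_combB (k : fieldType) (L : lalgType k) (x y : L) a b c d a' b' c' d' :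
  basis_comb x y (a, b, c, d) - basis_comb x y (a', b', c', d') =
  basis_comb x y (a - a', b - b', c - c', d - d').
Proof. by rewrite /basis_comb /=; lmodule k L. Qed.

Lemma morph_relators (k : fieldType) (q : k) (A : lalgType k) (L : algType k)
    (f : {lrmorphism A -> L}) (gx gy : A) :
    (forall p, p \in [:: gx ^+ 2; gy ^+ 2; gx * gy + q *: (gy * gx)] -> f p = 0) ->
  [/\ f gx * f gx = 0, f gy * f gy = 0 & f gx * f gy + q *: (f gy * f gx) = 0].
Proof.
move=> f0; rewrite -!rmorphM -linearZ -raddfD -!expr2.
by split; apply: f0; rewrite !inE eqxx ?orbT.
Qed.

Section Presentation.
Variables (k : fieldType) (q : k) (L : algType k) (pi : {lrmorphism free_xy k -> L}).
Hypotheses (q_neq0 : q != 0) (pi_pres : presents_Lambda q pi).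
Let x := pi (gen_x k).
Let y := pi (gen_y k).

Lemma pi_relator p : p \in relators q -> pi p = 0.
Proof.
move=> rel; apply/(pi_pres.2 p); exists [:: (1, p, 1)].
by rewrite /= rel big_seq1 mul1r mulr1.
Qed.

Lemma pi_relations : [/\ x * x = 0, y * y = 0 & x * y + q *: (y * x) = 0].
Proof. exact: morph_relators pi_relator. Qed.

Let pi_xx : x * x = 0. Proof. by case: pi_relations. Qed.
Let pi_yy : y * y = 0. Proof. by case: pi_relations. Qed.
Let pi_xy : x * y + q *: (y * x) = 0. Proof. by case: pi_relations. Qed.

Lemma monom_genM (b : bool) (w : seq bool) :
  << FMonom (b :: w) >> = << fmu b >> * << FMonom w >> :> free_xy k.
Proof.
rewrite malgM_def fgmulUU mulr1; congr << _ *g _ >>.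
by apply/eqP; rewrite fmP fmM fmU.
Qed.

Lemma spanned_all a : spanned x y a.
Proof.
have [p <-] := pi_pres.1 a; rewrite [p]monalgE raddf_sum /=.
elim/big_ind: _ => [|? ? |m _]; [|exact: spannedD|].
  by exists (0, 0, 0, 0); rewrite /basis_comb /= !scale0r !addr0.
have -> : << p@_m *g m >> = p@_m *: << m >> :> free_xy k.
  by apply/malgP => m'; rewrite mcoeffZ !mcoeffU mulrnAr mulr1.
rewrite linearZ; apply: spannedZ; case: m => w; elim: w => [|b w IHw].
  exists (1, 0, 0, 0).
  have -> : << FMonom [::] >> = 1 :> free_xy k by rewrite -fmoneE.
  rewrite rmorph1 /basis_comb /=.
  by lmodule k L.
by rewrite monom_genM rmorphM; case: b; [apply: (spannedMl q_neq0 pi_xx pi_yy pi_xy true)|apply: (spannedMl q_neq0 pi_xx pi_yy pi_xy false)].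
Qed.

(** A difference killed by [pi] comes from the ideal of relators, hence acts by zero in the regular
    representation. *)
Lemma basis_comb_inj : injective (basis_comb x y).
Proof.
move=> [[[a1 a2] a3] a4] [[[b1 b2] b3] b4] /eqP.
rewrite -subr_eq0 basis_combB -morph_basis_comb => /eqP /pi_pres.2.
move=> /(reg_rep_ideal q_neq0) /reg_rep_comb [] /subr0_eq -> /subr0_eq ->.
by move=> /subr0_eq -> /subr0_eq ->.
Qed.

Lemma presented_quantum_exterior : quantum_exterior q x y.
Proof.
(* Coordinates are obtained by choice; the second cancellation then follows from the first by
   injectivity of [basis_comb]. *)
pose coords a := xchoose (let: ex_intro c ac := spanned_all a in
  ex_intro (fun c => a == basis_comb x y c) c (introT eqP ac)).
have coordsK : cancel coords (basis_comb x y).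
  by move=> a; apply/esym/eqP; exact: (xchooseP (let: ex_intro c ac := spanned_all a in
    ex_intro (fun c => a == basis_comb x y c) c (introT eqP ac))).
by exists coords => // c; apply: basis_comb_inj; rewrite coordsK.
Qed.

End Presentation.

(** * Insertion operators and the Gerstenhaber bracket *)

Lemma sign_if (R : pzRingType) n : (-1) ^+ n = (if odd n then -1 else 1) :> R.
Proof. by rewrite -signr_odd; case: odd. Qed.

Lemma sign_scale (k : fieldType) (L : algType k) n (u : L) :
  (-1) ^+ n * u = (-1) ^+ n *: u.
Proof. by rewrite !sign_if; case: odd; rewrite ?mulN1r ?scaleN1r ?mul1r ?scale1r. Qed.

Section Insertion.
Variables (k : fieldType) (L : algType k).
Implicit Types (f g h F G : seq L -> L) (s t u : seq L).

(** Linearity at all lengths at once: insertions change the number of arguments, and no lengths have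
    to be tracked this way. A cochain of fixed degree acquires this form through [cut]. *)
Definition mlin F := forall s t (c : k) (u v : L),
  F (s ++ (c *: u + v) :: t) = c *: F (s ++ u :: t) + F (s ++ v :: t).

Lemma mlin_cons F a : mlin F -> mlin (F \o cons a).
Proof. by move=> FL s t c u v; apply: (FL (a :: s)). Qed.

Lemma mlin0 F s t : mlin F -> F (s ++ 0 :: t) = 0.
Proof.
by move=> FL; have := FL s t (-1) 0 0; rewrite scaler0 addr0 scaleN1r addNr.
Qed.

Definition front n g F s : L :=
  if (n <= size s)%N then F (g (take n s) :: drop n s) else 0.

(* The value at F of the coderivation of the tensor coalgebra given by g,
   so that commutators of such operators are brackets. *)
Fixpoint ins n g F s : L :=
  front n g F s +
  (if s is c :: t then (-1) ^+ n.+1 *: ins n g (F \o cons c) t else 0).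

Lemma ins_small n g F s : (size s < n)%N -> ins n g F s = 0.
Proof.
elim: s F => [|c t IHt] F lts /=; rewrite /front leqNgt lts /= ?addr0 //.
by rewrite IHt ?scaler0 ?addr0 //; apply: ltnW.
Qed.

Lemma ins_lincomb n g F G H c s : (forall t, F t = c *: G t + H t) ->
  ins n g F s = c *: ins n g G s + ins n g H s.
Proof.
elim: s F G H => [|a t IHt] F G H FGH /=.
  by rewrite /front; case: ifP => _; rewrite ?FGH; lmodule k L.
rewrite (IHt _ (G \o cons a) (H \o cons a)) => [|w]; last exact: FGH.
by rewrite /front; case: ifP => _; rewrite ?FGH; lmodule k L.
Qed.

Lemma ins_zero n g s : ins n g (fun=> 0) s = 0.
Proof.
elim: s => [|c t IHt] /=; rewrite /front if_same ?addr0 // add0r.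
by rewrite [ins _ _ _ _]IHt scaler0.
Qed.

Lemma ins_scale n g F G c s : (forall t, F t = c *: G t) ->
  ins n g F s = c *: ins n g G s.
Proof.
move=> FG; rewrite (@ins_lincomb n g F G (fun=> 0) c) ?ins_zero ?addr0 // => t.
by rewrite addr0.
Qed.

Lemma eq_ins n g F G s : F =1 G -> ins n g F s = ins n g G s.
Proof.
elim: s F G => [|a t IHt] F G FG /=; rewrite /front FG //.
by congr (_ + _ *: _); apply: IHt => w; exact: FG.
Qed.

Lemma eq_insl n g h F s : (forall u, size u = n -> g u = h u) ->
  ins n g F s = ins n h F s.
Proof.
move=> gh; elim: s F => [|a t IHt] F /=; rewrite /front ?IHt;
  by case: ifP => // len; rewrite gh // size_takel.
Qed.

Lemma front_mlin n g F : mlin g -> mlin F -> mlin (front n g F).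
Proof.
move=> gL FL s t c u v; rewrite /front !size_cat /=; case: ifP => [len|_]; last first.
  by rewrite scaler0 addr0.
rewrite !take_cat !drop_cat; case: ltnP => [ltn|les].
  exact: (FL (g (take n s) :: drop n s)).
case: (n - size s)%N => [|m] /=; last by rewrite gL; exact: (FL [::]).
rewrite cats0; exact: (FL [:: g s]).
Qed.

Lemma ins_mlin n g F : mlin g -> mlin F -> mlin (ins n g F).
Proof.
move=> gL FL s; elim: s F FL => [|a s IHs] F FL t c u v /=.
  rewrite (front_mlin n gL FL [::]) (@ins_lincomb _ _ _ (F \o cons u) (F \o cons v) c).
    by lmodule k L.
  by move=> w; exact: (FL [::]).
rewrite (front_mlin n gL FL (a :: s)) IHs; last exact: mlin_cons.
by lmodule k L.
Qed.

(** The part of a composite of insertions in which [h] consumes the leading arguments and [g] acts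
    strictly to the right of them. *)
Definition shifted p h n g F s : L :=
  if (p <= size s)%N then ins n g (F \o cons (h (take p s))) (drop p s) else 0.

(** Sorted by what happens at the left end: [g] is inserted leftmost, or [h] fills the leading slot
    and [g] acts behind it, or the first argument is passed over by both. *)
Lemma ins_ins n p g h F s :
  ins p h (ins n g F) s = ins p h (front n g F) s
    + (-1) ^+ n.+1 *: shifted p h n g F s
    + (if s is c :: t then
         ((-1) ^+ p.+1 * (-1) ^+ n.+1) *: ins p h (ins n g (F \o cons c)) t
       else 0).
Proof.
pose tail F s := if s is c :: t then (-1) ^+ n.+1 *: ins n g (F \o cons c) t else 0.
rewrite (@ins_lincomb p h _ (front n g F) (tail F) 1) => [|t]; last first.
  by rewrite scale1r; case: t => [|c t].
rewrite scale1r -addrA; congr (_ + _); rewrite /shifted.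
have -> : ins p h (tail F) s = front p h (tail F) s + (if s is c :: t then
    (-1) ^+ p.+1 *: ins p h (tail F \o cons c) t else 0) by case: s.
congr (_ + _); first by rewrite /front; case: ifP; rewrite ?scaler0.
case: s => // c t; rewrite -scalerA; congr (_ *: _).
exact: ins_scale.
Qed.

(** The inserted [h] falls either among the arguments of [g], which is impossible for [n = 0], or
    behind them; in the second case its sign comes from passing the [n] arguments of [g]. *)
Lemma ins_front n p g h F s : mlin F -> 
  ins p h (front n g F) s =
  (if n is n'.+1 then front (n' + p) (ins p h g) F s else 0)
    + (-1) ^+ (p.+1 * n) *: shifted n g p h F s.
Proof.
elim: n g F s => [|n IHn] g F s FL.
  rewrite muln0 scale1r add0r /shifted /= take0 drop0.
  by apply: eq_ins => w; rewrite /front /= take0 drop0.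
case: s => [|c t] /=.
  rewrite /front /= /shifted /= scaler0 !addr0 {IHn}; case: p => [|p] //=; rewrite ?addnS // addn0.
  by case: n => [|n] //=; rewrite scaler0 addr0.
rewrite (@eq_ins p h _ (front n (g \o cons c) F)) => [|w]; last by rewrite /front.
rewrite IHn // /shifted /= ltnS mulnS exprD.
set A := (if n is n'.+1 then _ else _).
set B := (if (n <= size t)%N then _ else _).
suff -> : front (n + p) (ins p h g) F (c :: t) = front p h (front n.+1 g F) (c :: t)
    + (-1) ^+ p.+1 *: A by rewrite scalerDr scalerA addrA.
rewrite {}/A; case np : (n + p)%N => [|m].
  have [n0 p0] : n = 0%N /\ p = 0%N by lia.
  by rewrite n0 p0 /front /= ?take0 ?drop0 scaler0 !addr0.
rewrite /front /= ltnS; have [lemt|ltmt] := leqP m (size t); last first.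
  have -> : (if n is n'.+1 then if (n' + p <= size t)%N
      then F (ins p h (g \o cons c) (take (n' + p) t) :: drop (n' + p) t) else 0
      else 0) = 0.
    by case: n np {IHn B} => // n [np]; rewrite np leqNgt ltmt.
  rewrite scaler0 addr0; case: ifP => // lep.
  rewrite /front (_ : (n < _)%N = false) //.
  by move: lep ltmt np; rewrite size_drop /=; lia.
have lep : (p <= (size t).+1)%N by lia.
rewrite lep (_ : (n < _)%N); last by move: lep lemt np; rewrite size_drop /=; lia.
have wE : c :: take m t = take (n + p) (c :: t) by rewrite np.
have -> : front p h g (c :: take m t) =
    g (h (take p (c :: t)) :: take n (drop p (c :: t))).
  rewrite /front (_ : (p <= _)%N); last by rewrite /= size_takel //; lia.
  by rewrite wE take_takel ?leq_addl // take_drop.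
have -> : drop n (drop p (c :: t)) = drop m t by rewrite drop_drop np.
have FE a b r : F (a + (-1) ^+ p.+1 *: b :: r) = F (a :: r) + (-1) ^+ p.+1 *: F (b :: r).
  by rewrite addrC (FL [::]) addrC.
rewrite FE; congr (_ + _ *: _); case: n np {IHn B wE} => [|n] np /=.
  by rewrite ins_small ?(mlin0 [::]) // size_takel // -np.
by case: np => ->; rewrite lemt.
Qed.

(** Recursive counterpart of [gbracket]; the two agree on sequences of the right length by
    [gbracket_brk]. *)
Definition brk n p g h u : L :=
  ins p h g u - (-1) ^+ (n.+1 * p.+1) *: ins n g h u.

Lemma eq_front n g h F s : (forall u, size u = n -> g u = h u) ->
  front n g F s = front n h F s.
Proof. by move=> gh; rewrite /front; case: ifP => // len; rewrite gh // size_takel. Qed.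

Lemma front_lincomb n g h F c s : mlin F ->
  front n (fun u => g u - c *: h u) F s = front n g F s - c *: front n h F s.
Proof.
move=> FL; rewrite /front; case: ifP => _; last by rewrite scaler0 subr0.
by rewrite addrC -scaleNr (FL [::]) scaleNr addrC.
Qed.

Lemma front0 n F s : mlin F -> front n (fun=> 0) F s = 0.
Proof. by move=> FL; rewrite /front (mlin0 [::]) // if_same. Qed.

Lemma ins0 n F s : mlin F -> ins n (fun=> 0) F s = 0.
Proof.
elim: s F => [|c t IHt] F FL /=; rewrite front0 // add0r // IHt ?scaler0 //.
exact: mlin_cons.
Qed.

Definition front_ins n p g h F s : L :=
  if n is n'.+1 then front (n' + p) (ins p h g) F s else 0.

(** If exactly one degree is 0, only one nesting exists, and the other term of [brk] vanishes
    because it is an insertion into too few arguments. *)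
Lemma front_commutator n p g h F s : mlin F ->
  front_ins n p g h F s - (-1) ^+ (n.+1 * p.+1) *: front_ins p n h g F s =
  if (n + p == 0)%N then 0 else front (n + p).-1 (brk n p g h) F s.
Proof.
move=> FL; have small m r (u v : seq L -> L) : (m < r)%N -> front m (ins r u v) F s = 0.
  by move=> ltmr; rewrite -(front0 m s FL); apply: eq_front => w sw; rewrite ins_small ?sw.
rewrite /front_ins /brk; case: n p => [|n] [|p] /=; rewrite ?addn0 ?add0n ?addnS ?addSn.
- by rewrite scaler0 subr0.
- by rewrite front_lincomb // (small p p.+1).
- by rewrite front_lincomb // (small n n.+1) // scaler0.
- by rewrite /= front_lincomb // [(p + n)%N]addnC.
Qed.

(** Insertions at disjoint places occur in both composites and cancel by the sign rule; the nested
    ones add up to the bracket. The induction passes over the first argument, [front_commutator]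
    handling what happens at the left end. *)
Theorem ins_commutator n p g h F s : mlin F -> 
  ins p h (ins n g F) s - (-1) ^+ (n.+1 * p.+1) *: ins n g (ins p h F) s =
  if (n + p == 0)%N then 0 else ins (n + p).-1 (brk n p g h) F s.
Proof.
elim: s F => [|c t IHt] F FL; rewrite (ins_ins n p) (ins_ins p n) !ins_front //;
  rewrite -/(front_ins n p g h F _) -/(front_ins p n h g F _).
  have := front_commutator n p g h [::] FL.
  rewrite /= !addr0 => <-; rewrite !sign_if !(oddM, oddS) /=;
  by case: (odd n); case: (odd p) => /=; lmodule k L.
have := IHt (F \o cons c) (mlin_cons c FL).
have := front_commutator n p g h (c :: t) FL.
have sq m : (-1) ^+ m.+2 = (-1) ^+ m :> k by rewrite !exprS !mulN1r opprK.
have -> : (if (n + p == 0)%N then 0 else ins (n + p).-1 (brk n p g h) F (c :: t)) =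
  (if (n + p == 0)%N then 0 else front (n + p).-1 (brk n p g h) F (c :: t))
   + ((-1) ^+ p.+1 * (-1) ^+ n.+1) *: (if (n + p == 0)%N then 0
     else ins (n + p).-1 (brk n p g h) (F \o cons c) t).
  case: ifP => [|np]; first by rewrite scaler0 addr0.
  by rewrite /= prednK ?lt0n ?np // -exprD addSn addnS sq addnC.
move=> <- <-; rewrite !sign_if !(oddM, oddS) /=;
by case: (odd n); case: (odd p) => /=; lmodule k L.
Qed.

End Insertion.

(** * The Hochschild differential as bracket with the multiplication *)

Section BracketCocycles.
Variables (k : fieldType) (L : algType k).
Implicit Types (f g h F G : seq L -> L) (s t u : seq L).

(** Extension by zero to the other lengths, which turns n-linearity into [mlin]. *)
Definition cut n f s : L := if size s == n then f s else 0.

Lemma cutE n f s : size s = n -> cut n f s = f s.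
Proof. by rewrite /cut => ->; rewrite eqxx. Qed.

Lemma cut_mlin n f : multilinear n f -> mlin (cut n f).
Proof.
move=> fL s t c u v; rewrite /cut !size_cat /= !addnS; case: eqP => [e|_].
  exact: fL.
by rewrite scaler0 addr0.
Qed.

Lemma mlin_multilinear n f : mlin f -> multilinear n f.
Proof. by move=> fL s t c u v _; apply: fL. Qed.

Lemma eq_multilinear n f g : (forall s, size s = n -> f s = g s) ->
  multilinear n f -> multilinear n g.
Proof.
move=> fg fL s t c u v e; rewrite -!fg ?fL // size_cat /= addnS; exact: e.
Qed.

Lemma circ_ins m n f g s : (size s).+1 = (m + n)%N -> circ m n f g s = ins n g f s.
Proof.
rewrite /circ; elim: m f s => [|m IHm] f s sz.
  by rewrite big_ord0 ins_small //; move: sz; lia.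
rewrite big_ord_recl muln0 expr0 mul1r take0 drop0 add0n.
case: s sz => [|c t] [sz] /=; rewrite /front.
  have [-> n0] : m = 0%N /\ n = 0%N by move: sz => /=; lia.
  by rewrite big_ord0 n0.
rewrite (_ : (n <= size (c :: t))%N) /=; last by rewrite sz; lia.
congr (_ + _); rewrite -IHm //= scaler_sumr; apply: eq_bigr => i _.
by rewrite -sign_scale mulrA -exprD -mulnS.
Qed.

Lemma gbracket_brk m n f g s : (size s).+1 = (m + n)%N ->
  gbracket m n f g s = brk m n f g s.
Proof.
by move=> sz; rewrite /gbracket !circ_ins // ?sign_scale // addnC.
Qed.

Lemma eq_circ m n f f' g g' s : (size s).+1 = (m + n)%N ->
  (forall u, size u = m -> f u = f' u) -> (forall u, size u = n -> g u = g' u) ->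
  circ m n f g s = circ m n f' g' s.
Proof.
move=> sz ff gg; apply: eq_bigr => i _; congr (_ * _).
have lei : (i + n <= size s)%N by move: (ltn_ord i); lia.
rewrite ff; first by rewrite gg // size_takel // size_drop; lia.
by rewrite size_cat size_takel /= ?size_drop; move: (ltn_ord i); lia.
Qed.

Lemma eq_gbracket m n f f' g g' s : (size s).+1 = (m + n)%N ->
  (forall u, size u = m -> f u = f' u) -> (forall u, size u = n -> g u = g' u) ->
  gbracket m n f g s = gbracket m n f' g' s.
Proof.
move=> sz ff gg; rewrite /gbracket (eq_circ sz ff gg); congr (_ - _ * _).
by apply: eq_circ; rewrite 1?addnC.
Qed.

Lemma gbracketC m n f g s :
  gbracket n m g f s = - ((-1) ^+ (m.+1 * n.+1) *: gbracket m n f g s).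
Proof.
rewrite /gbracket !sign_scale !sign_if !oddM /=.
by case: (odd m); case: (odd n) => /=; lmodule k L.
Qed.

Definition mu s : L := if s is [:: a; b] then a * b else 0.

Lemma mu_mlin : mlin mu.
Proof.
move=> [|a [|b [|d s]]] [|a' [|b' t]] c u v /=; rewrite ?scaler0 ?addr0 //.
  by rewrite mulrDl scalerAl.
by rewrite mulrDr scalerAr.
Qed.

Lemma circ_mu_l n f s : size s = n.+1 ->
  circ 2 n mu f s = f (take n s) * s`_n + (-1) ^+ n.+1 * (s`_0 * f (behead s)).
Proof.
move=> sz; rewrite /circ big_ord_recl big_ord1 muln0 expr0 mul1r take0 drop0 muln1.
rewrite (drop_nth 0) ?sz // drop_oversize ?sz //; congr (_ + _ * _).
case: s sz => // c t [sz] /=.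
by rewrite take0 drop0 /= take_oversize ?sz // drop_oversize ?sz ?add0n.
Qed.

Lemma circ_mu_r n f s : size s = n.+1 ->
  circ n 2 f mu s =
  - \sum_(i < n) (-1) ^+ i.+1 * f (take i s ++ s`_i * s`_i.+1 :: drop i.+2 s).
Proof.
move=> sz; rewrite /circ -sumrN; apply: eq_bigr => i _; have lti := ltn_ord i.
rewrite addn2 -mulNr !sign_if oddM /=; congr (_ * f (_ ++ _ :: _)).
  by case: odd; rewrite ?opprK.
rewrite (drop_nth 0 (n := i)) ?sz; last by lia.
by rewrite (drop_nth 0 (n := i.+1)) ?sz /= ?take0; last by lia.
Qed.

(** Inserting [f] into [mu] gives the two outer terms of the differential, inserting [mu] into [f]
    the inner ones. *)
Lemma hoch_d_brk n f s : size s = n.+1 ->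
  hoch_d n f s = (-1) ^+ n.+1 *: brk 2 n mu f s.
Proof.
move=> sz; rewrite /brk -(@circ_ins 2 n) ?sz // -(@circ_ins n 2) ?sz ?addn2 //.
rewrite circ_mu_l // circ_mu_r // /hoch_d !sign_scale !sign_if oddM /=.
by case: (odd n) => /=; lmodule k L.
Qed.

Lemma brk_mlin m n f g : mlin f -> mlin g -> mlin (brk m n f g).
Proof.
move=> fL gL s t c u v; rewrite /brk !(ins_mlin _ gL fL) !(ins_mlin _ fL gL).
by lmodule k L.
Qed.

Lemma gbracket_multilinear m n f g : multilinear m f -> multilinear n g ->
  multilinear (m + n).-1 (gbracket m n f g).
Proof.
move=> fL gL; case: (posnP (m + n)) => [|mn0].
  by case: m n fL gL => [|m] [|n] // _ _ _ s t c u v.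
apply: (@eq_multilinear _ (brk m n (cut m f) (cut n g))) => [s sz|].
  have sz1 : (size s).+1 = (m + n)%N by rewrite sz prednK.
  rewrite -gbracket_brk //; apply: eq_gbracket => // u su; exact: cutE.
by apply/mlin_multilinear/brk_mlin; exact: cut_mlin.
Qed.

(* Recovers a cochain from its insertion operator, see ins_unit. *)
Definition unit_cochain s : L := if s is [:: a] then a else 0.

Lemma unit_cochain_mlin : mlin unit_cochain.
Proof.
by move=> [|a [|b s]] [|a' t] c u v //=; rewrite ?scaler0 ?addr0.
Qed.

Lemma ins_unit n g s : size s = n -> ins n g unit_cochain s = g s.
Proof.
move=> <-; case: s => [|c t] /=; rewrite /front leqnn take_oversize //.
  by rewrite addr0.
by rewrite drop_oversize //= ins_small //= scaler0 addr0.
Qed.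

Lemma ins_eq0 n g F s : mlin F -> (forall u, size u = n -> g u = 0) -> ins n g F s = 0.
Proof. by move=> FL g0; rewrite (eq_insl (h := fun=> 0) _ _ g0) ins0. Qed.

(** The bracket of a cocycle with [mu] is zero, so its coderivation commutes up to sign with that of
    [mu]. *)
Lemma cocycle_ins n f F s : mlin f -> mlin F ->
    (forall u, size u = n.+1 -> hoch_d n f u = 0) ->
  ins n f (ins 2 mu F) s = (-1) ^+ n.+1 *: ins 2 mu (ins n f F) s.
Proof.
move=> fL FL f0; have := ins_commutator 2 n mu f s FL.
rewrite /= [ins _ (brk _ _ _ _) _ _]ins_eq0 // => [|u su]; last first.
  by apply: (scalerI (a := (-1) ^+ n.+1)); rewrite ?signr_eq0 // -hoch_d_brk // scaler0 f0.
by move=> /subr0_eq ->; rewrite !sign_if oddM.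
Qed.

Lemma cocycles_ins m n f g F s : mlin f -> mlin g -> mlin F ->
    (forall u, size u = m.+1 -> hoch_d m f u = 0) ->
    (forall u, size u = n.+1 -> hoch_d n g u = 0) ->
  ins n g (ins m f (ins 2 mu F)) s =
  (-1) ^+ (m + n) *: ins 2 mu (ins n g (ins m f F)) s.
Proof.
move=> fL gL FL f0 g0.
rewrite (ins_scale _ _ _ (fun t => cocycle_ins t fL FL f0)).
rewrite cocycle_ins //; last exact: ins_mlin.
by rewrite !sign_if !oddD /=; case: (odd m); case: (odd n) => /=; lmodule k L.
Qed.

Lemma eq_hoch_d n f g s : size s = n.+1 -> (forall u, size u = n -> f u = g u) ->
  hoch_d n f s = hoch_d n g s.
Proof.
move=> sz fg; rewrite !hoch_d_brk //; congr (_ *: _).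
by rewrite -!gbracket_brk ?sz //; apply: eq_gbracket; rewrite ?sz.
Qed.

(** Operators commuting up to sign with the coderivation of [mu] are closed under composition and
    hence under graded commutators. This replaces an expansion of the Jacobi identity; evaluation at
    [unit_cochain] leads back from operators to cochains. *)
Lemma gbracket_cocycle m n f g : hoch_cocycle m f -> hoch_cocycle n g ->
  hoch_cocycle (m + n).-1 (gbracket m n f g).
Proof.
move=> [fL fd] [gL gd]; split; first exact: gbracket_multilinear.
move=> s sz; case: (posnP (m + n)) => [mn0|mn0].
  have [m0 n0] : m = 0%N /\ n = 0%N by lia.
  subst m n.
  have g0 u : gbracket 0 0 f g u = 0 by rewrite /gbracket /circ !big_ord0 mulr0 subr0.
  by rewrite /hoch_d !g0 mulr0 mul0r mulr0 big_ord0 !addr0.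
have fL' := cut_mlin fL; have gL' := cut_mlin gL.
have fd' u : size u = m.+1 -> hoch_d m (cut m f) u = 0.
  by move=> su; rewrite -(fd u su); apply: eq_hoch_d => // w; exact: cutE.
have gd' u : size u = n.+1 -> hoch_d n (cut n g) u = 0.
  by move=> su; rewrite -(gd u su); apply: eq_hoch_d => // w; exact: cutE.
rewrite (@eq_hoch_d _ _ (brk m n (cut m f) (cut n g))) ?sz // => [|u su]; last first.
  have su1 : (size u).+1 = (m + n)%N by rewrite su prednK.
  rewrite -gbracket_brk //; apply: eq_gbracket => // w sw; exact/esym/cutE.
rewrite hoch_d_brk ?sz // -(@ins_unit (m + n).-1.+1 (brk 2 _ _ _)) ?sz //.
have := ins_commutator 2 (m + n).-1 mu (brk m n (cut m f) (cut n g)) s unit_cochain_mlin.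
rewrite /= => <-.
have comm F u : mlin F -> ins (m + n).-1 (brk m n (cut m f) (cut n g)) F u =
    - (-1) ^+ (m.+1 * n.+1) *: ins m (cut m f) (ins n (cut n g) F) u +
    ins n (cut n g) (ins m (cut m f) F) u.
  move=> FL; have := ins_commutator m n (cut m f) (cut n g) u FL.
  by rewrite eqn0Ngt mn0 /= => <-; rewrite addrC scaleNr.
rewrite comm; last exact: ins_mlin mu_mlin unit_cochain_mlin.
rewrite (ins_lincomb 2 mu s (fun u => comm _ u unit_cochain_mlin)).
rewrite !cocycles_ins //; try exact: unit_cochain_mlin.
have -> : (m + n).-1.+1 = (m + n)%N by rewrite prednK.
rewrite [(n + m)%N]addnC !sign_if !oddM.
by case: (odd (m + n)) => /=; lmodule k L.
Qed.

Lemma ins_lincombl n g h F c s : mlin F ->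
  ins n (fun u => c *: g u + h u) F s = c *: ins n g F s + ins n h F s.
Proof.
have frontE G t : mlin G -> front n (fun u => c *: g u + h u) G t =
    c *: front n g G t + front n h G t.
  move=> GL; rewrite /front; case: ifP => _; last by rewrite scaler0 addr0.
  exact: (GL [::]).
elim: s F => [|a t IHt] F FL /=; rewrite frontE //; first by lmodule k L.
by rewrite IHt; [lmodule k L|exact: mlin_cons].
Qed.

Lemma ins_scalel n g F c s : mlin F ->
  ins n (fun u => c *: g u) F s = c *: ins n g F s.
Proof.
move=> FL; rewrite -[RHS]addr0 -(ins0 n s FL) -ins_lincombl //.
by apply: eq_insl => u _; rewrite addr0.
Qed.

(** Since [hoch_d] is the bracket with [mu] up to sign, the coderivation of a coboundary is a graded
    commutator. *)
Lemma ins_hoch_d n h F s : mlin h -> mlin F ->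
  ins n.+1 (fun u => (-1) ^+ n.+1 *: brk 2 n mu h u) F s =
  (-1) ^+ n.+1 *: ins n h (ins 2 mu F) s - ins 2 mu (ins n h F) s.
Proof.
move=> hL FL; rewrite ins_scalel //; have := ins_commutator 2 n mu h s FL.
by rewrite /= => <-; rewrite !sign_if oddM /=; case: (odd n) => /=; lmodule k L.
Qed.

(** The cocycle [g] can be moved past [mu], so both sides reduce to four composites, with [mu]
    innermost or outermost and [g], [h] in either order. *)
Lemma gbracket_hoch_d m n g h s :
    multilinear m h -> hoch_cocycle n g -> size s = (m + n)%N ->
  gbracket m.+1 n (hoch_d m h) g s =
  if (m + n == 0)%N then 0
  else (-1) ^+ n.+1 *: hoch_d (m + n).-1 (gbracket m n h g) s.
Proof.
move=> hL [gL gd] sz.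
have hL' := cut_mlin hL; have gL' := cut_mlin gL.
have gd' u : size u = n.+1 -> hoch_d n (cut n g) u = 0.
  by move=> su; rewrite -(gd u su); apply: eq_hoch_d => // w; exact: cutE.
have sz1 : (size s).+1 = (m.+1 + n)%N by rewrite sz.
have UL := unit_cochain_mlin; have mL := mu_mlin.
pose D u := (-1) ^+ m.+1 *: brk 2 m mu (cut m h) u.
have -> : gbracket m.+1 n (hoch_d m h) g s = gbracket m.+1 n D (cut n g) s.
  apply: eq_gbracket => // u su; last exact/esym/cutE.
  rewrite /D -hoch_d_brk //; apply: eq_hoch_d => // w sw; exact/esym/cutE.
rewrite gbracket_brk // -(@ins_unit (m + n) (brk m.+1 _ _ _)) //.
have := ins_commutator m.+1 n D (cut n g) s UL.
rewrite addSn /= => <-.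
rewrite (ins_hoch_d m s hL' (ins_mlin n gL' UL)).
have gmu t F : mlin F -> ins 2 mu (ins n (cut n g) F) t =
    (-1) ^+ n.+1 *: ins n (cut n g) (ins 2 mu F) t.
  move=> FL; rewrite cocycle_ins // scalerA -exprD addnn -mul2n exprM sqrrN !expr1n.
  by rewrite scale1r.
rewrite (ins_scale _ _ s (fun t => gmu t _ UL)).
have hD t : ins m.+1 D unit_cochain t = - 1 *: ins 2 mu (ins m (cut m h) unit_cochain) t +
   (-1) ^+ m.+1 *: ins m (cut m h) (ins 2 mu unit_cochain) t.
  by rewrite /D ins_hoch_d // addrC scaleN1r.
rewrite (ins_lincomb _ _ s hD) (ins_scale _ _ s (fun t => erefl (_ *: _))).
rewrite (cocycle_ins s gL' (ins_mlin m hL' UL) gd').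
set P := ins n (cut n g) (ins m _ (ins 2 mu _)) s.
set Q := ins m _ (ins n _ (ins 2 mu _)) s.
set R := ins 2 mu (ins n _ (ins m _ _)) s.
set S := ins 2 mu (ins m _ (ins n _ _)) s.
case: posnP => mn0.
  have [m0 n0] : m = 0%N /\ n = 0%N by lia.
  subst m n.
  (* Two cochains of degree 0 cannot be nested, so their insertions anticommute; this makes the
     bracket vanish. *)
  have PQ : P = - Q.
    have := ins_commutator 0 0 (cut 0 h) (cut 0 g) s (ins_mlin 2 mL UL).
    by rewrite /= -/P -/Q scaleN1r opprK => /eqP; rewrite addr_eq0 => /eqP.
  have RS : R = - S.
    rewrite /R (@ins_lincomb _ _ 2 mu (ins 0 (cut 0 g) (ins 0 (cut 0 h) unit_cochain))
      (ins 0 (cut 0 h) (ins 0 (cut 0 g) unit_cochain)) (fun=> 0) (-1)).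
      by rewrite ins_zero addr0 scaleN1r.
    move=> t; have := ins_commutator 0 0 (cut 0 h) (cut 0 g) t UL.
    by rewrite /= !scaleN1r addr0 opprK => /eqP; rewrite addr_eq0 => /eqP.
  by rewrite PQ RS !sign_if /=; lmodule k L.
rewrite (@eq_hoch_d _ _ (brk m n (cut m h) (cut n g))) ?prednK // => [|u su]; last first.
  have su1 : (size u).+1 = (m + n)%N by rewrite su prednK.
  rewrite -gbracket_brk //; apply: eq_gbracket => // w sw; exact/esym/cutE.
rewrite hoch_d_brk ?prednK // -(@ins_unit (m + n) (brk 2 _ _ _)) //.
have comm F u : mlin F -> ins (m + n).-1 (brk m n (cut m h) (cut n g)) F u =
    - (-1) ^+ (m.+1 * n.+1) *: ins m (cut m h) (ins n (cut n g) F) u +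
    ins n (cut n g) (ins m (cut m h) F) u.
  move=> FL; have := ins_commutator m n (cut m h) (cut n g) u FL.
  by rewrite eqn0Ngt mn0 /= => <-; rewrite addrC scaleNr.
have := ins_commutator 2 (m + n).-1 mu (brk m n (cut m h) (cut n g)) s UL.
rewrite /= add1n prednK // => <-.
rewrite (comm _ _ (ins_mlin 2 mL UL)) (ins_lincomb 2 mu s (fun u => comm _ u UL)).
rewrite -/P -/Q -/R -/S !sign_if !(oddM, oddD, oddS) /=.
by case: (odd m); case: (odd n) => /=; lmodule k L.
Qed.

End BracketCocycles.

(** * Normalization of cocycles *)

Section Normalization.
Variables (k : fieldType) (L : algType k).
Implicit Types (f g h : seq L -> L) (s t u v : seq L).

(* The right action on cochains for which the left term of the differential is
   a commutator, so that a cocycle is a cochain commuting with L. *)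
Fixpoint ract f (b : L) s : L :=
  if s is c :: t then f (b * c :: t) - ract (f \o cons b) c t else f [::] * b.

Lemma hoch_d_ract n f b s : size s = n -> hoch_d n f (b :: s) = b * f s - ract f b s.
Proof.
rewrite /hoch_d /= -addrA => sz; congr (_ + _).
elim: n f b s sz => [|n IHn] f b [|c t] //= sz.
  by rewrite big_ord0 add0r mulN1r.
case: sz => sz; rewrite big_ord_recl /= expr1 mulN1r drop0 opprB -addrA addrC.
congr (_ - _); rewrite -[RHS]opprK -(IHn (f \o cons b)) // opprD -sumrN; congr (_ + _).
  by apply: eq_bigr => i _; rewrite /= exprS mulN1r mulNr.
by rewrite [in LHS]exprS mulN1r mulNr.
Qed.

Lemma eq_ract f g b s : (forall u, size u = size s -> f u = g u) ->
  ract f b s = ract g b s.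
Proof.
elim: s f g b => [|c t IHt] f g b fg /=; first by rewrite fg.
by rewrite fg //; congr (_ - _); apply: IHt => u su; apply: fg; rewrite /= su.
Qed.

Lemma ract_lincomb f g h c b s : (forall t, size t = size s -> f t = c *: g t + h t) ->
  ract f b s = c *: ract g b s + ract h b s.
Proof.
elim: s f g h b => [|a t IHt] f g h b fgh /=.
  by rewrite fgh // mulrDl scalerAl.
rewrite fgh // (IHt _ (g \o cons b) (h \o cons b)); first by lmodule k L.
by move=> u su; apply: fgh; rewrite /= su.
Qed.

Lemma ract0 f b s : (forall t, size t = size s -> f t = 0) -> ract f b s = 0.
Proof.
move=> f0; rewrite (@ract_lincomb f f f (-1)) => [|t st].
  by rewrite scaleN1r addNr.
by rewrite f0 // scaler0 addr0.
Qed.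

Lemma ract_mull f a b s : ract (fun u => a * f u) b s = a * ract f b s.
Proof.
elim: s f b => [|c t IHt] f b /=; first by rewrite mulrA.
by rewrite mulrBr -(IHt (f \o cons b)).
Qed.

Lemma ractA f a b s : ract (ract f a) b s = ract f (a * b) s.
Proof.
elim: s f a b => [|c t IHt] f a b /=; first by rewrite mulrA.
rewrite (@ract_lincomb (ract f a \o cons b) (ract (f \o cons a) b) (f \o cons (a * b)) (-1)) => [|u _].
  by rewrite IHt mulrA; lmodule k L.
by rewrite /= scaleN1r addrC.
Qed.

Lemma ract_linl f c b b' s : multilinear (size s) f ->
  ract f (c *: b + b') s = c *: ract f b s + ract f b' s.
Proof.
elim: s f b b' => [|a t IHt] f b b' fL /=.
  by rewrite mulrDr -scalerAr.
rewrite mulrDl -scalerAl (fL [::]) //.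
rewrite (@ract_lincomb (f \o cons (c *: b + b')) (f \o cons b) (f \o cons b') c) => [|u su].
  by lmodule k L.
by rewrite /= (fL [::]) //= su.
Qed.

Lemma hoch_d_lincomb n c f g s : size s = n.+1 ->
  hoch_d n (fun u => c *: f u + g u) s = c *: hoch_d n f s + hoch_d n g s.
Proof.
case: s => // b s [sz]; rewrite !hoch_d_ract //.
rewrite (@ract_lincomb (fun u => c *: f u + g u) f g c) //.
by rewrite mulrDr -scalerAr; lmodule k L.
Qed.

Lemma hoch_dB n f g s : size s = n.+1 ->
  hoch_d n (fun u => f u - g u) s = hoch_d n f s - hoch_d n g s.
Proof.
move=> sz; rewrite addrC -scaleN1r -hoch_d_lincomb //.
by apply: eq_hoch_d => // u _; rewrite scaleN1r addrC.
Qed.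

(** Only associativity of the right action, [ractA], and its compatibility with left multiplication,
    [ract_mull], enter. *)
Lemma hoch_dK n f s : size s = n.+2 -> hoch_d n.+1 (hoch_d n f) s = 0.
Proof.
case: s => // a [|b s] // [sz]; rewrite hoch_d_ract /= ?sz // !hoch_d_ract //.
rewrite (@ract_lincomb (hoch_d n f \o cons a) (ract f a) (fun u => a * f u) (-1)) => [|t st].
  by rewrite ractA ract_mull mulrBr !mulrA; lmodule k L.
by rewrite /= hoch_d_ract ?st // scaleN1r addrC.
Qed.

Lemma multilinearB n f g : multilinear n f -> multilinear n g ->
  multilinear n (fun u => f u - g u).
Proof. by move=> fL gL s t c u v sz; rewrite fL // gL //; lmodule k L. Qed.

Lemma hoch_d_multilinear n f : multilinear n f -> multilinear n.+1 (hoch_d n f).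
Proof.
move=> fL; have fL' := cut_mlin fL.
apply: (@eq_multilinear _ _ _ (fun s => (-1) ^+ n.+1 *: brk 2 n (@mu _ L) (cut n f) s)).
  by move=> s sz; rewrite -hoch_d_brk //; apply: eq_hoch_d => // u su; rewrite cutE.
apply: mlin_multilinear => s t c u v.
by rewrite (brk_mlin _ _ (@mu_mlin k L) fL'); lmodule k L.
Qed.

Definition normal_upto n j f :=
  forall s t, (size s + size t).+1 = n -> (size s < j)%N -> f (s ++ 1 :: t) = 0.

Definition insert1 j f s := f (take j s ++ 1 :: drop j s).

Lemma insert1_multilinear n j f : multilinear n.+1 f -> (j <= n)%N ->
  multilinear n (insert1 j f).
Proof.
move=> fL lej s t c u v sz; rewrite /insert1 !take_cat !drop_cat.
case: ltnP => [ltj|les].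
  have E w : take j s ++ 1 :: drop j s ++ w :: t = (take j s ++ 1 :: drop j s) ++ w :: t.
    by rewrite -catA.
  by rewrite !E; apply: fL; rewrite size_cat /= size_takel 1?ltnW // size_drop; lia.
have sz' : (size s + (size t).+1).+1 = n.+1 by rewrite -sz addnS.
case e : (j - size s)%N => [|i] /=.
  by rewrite cats0 -!(cat_rcons 1); apply: fL; rewrite size_rcons; move: sz; lia.
rewrite -!catA /=; apply: fL; rewrite size_cat /= addnS -[in RHS]sz -[in RHS](cat_take_drop i t).
by rewrite size_cat addnS.
Qed.

(** The acting element becomes the first letter, so that the identity below can be stated uniformly
    in the prefix [u], empty or not. *)
Definition ract_head f s := if s is b :: t then ract f b t else 0.

Lemma ract_head2 f b c s :
  ract_head f (b :: c :: s) = f (b * c :: s) - ract_head (f \o cons b) (c :: s).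
Proof. by []. Qed.

Lemma normal_upto_cons n j f b : normal_upto n.+1 j.+1 f -> normal_upto n j (f \o cons b).
Proof. by move=> fN s t sz lts; apply: (fN (b :: s)); rewrite //= addSn sz. Qed.

Lemma ract_head_insert1 j f b c s :
  ract_head (insert1 j.+1 f) (b :: c :: s) =
  insert1 j.+1 f (b * c :: s) - ract_head (insert1 j (f \o cons b)) (c :: s).
Proof. by []. Qed.

(** Products left of the units vanish by normalization; those right of them cancel between the two
    summands, which sit one slot apart; near the units one copy of the value at [u ++ 1 :: v]
    survives. For empty [u] the products with a left neighbour are missing in both summands, whence
    the correction by twice that value. *)
Lemma ract_insert1 u v f : normal_upto (size u + size v).+1 (size u) f ->
  ract_head f (u ++ 1 :: 1 :: v) + ract_head (insert1 (size u) f) (u ++ 1 :: v) =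
  - (-1) ^+ (size u) *: f (u ++ 1 :: v) + (if u is [::] then 2%:R *: f (1 :: v) else 0).
Proof.
elim: u f => [|b [|c u] IHu] f fN.
- rewrite [[::] ++ _]/= ract_head2 mulr1 /= (@eq_ract (insert1 0 f) (f \o cons 1)).
    by lmodule k L.
  by move=> w _; rewrite /insert1 take0 drop0.
- have := IHu (f \o cons b) (fun s t _ lts => ltac:(by [])).
  rewrite !cat_cons !cat0s [size [:: b]]/= [size [::]]/= (ract_head_insert1 0 f) (ract_head2 f) !mulr1.
  have -> : insert1 1 f (b :: v) = f [:: b, 1 & v] by rewrite /insert1 /= take0 drop0.
  set R := ract_head (f \o cons b) _; set I := ract_head _ _ => IH.
  have -> : I = (R + I) - R by lmodule k L.
  by rewrite IH [_ (1 :: v)]/=; lmodule k L.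
have f0 : f (b * c :: u ++ 1 :: 1 :: v) = 0.
  by apply: (fN (b * c :: u)) => //=; lia.
have i0 : insert1 (size u).+2 f (b * c :: u ++ 1 :: v) = 0.
  rewrite /insert1 /= take_cat drop_cat ltnNge leqnSn /= subSnn /= take0 drop0 -catA.
  exact: f0.
have := IHu (f \o cons b) (normal_upto_cons b fN).
rewrite !cat_cons [size (c :: u)]/= [size (b :: _)]/= (ract_head_insert1 _ f) (ract_head2 f) f0 i0.
set R := ract_head (f \o cons b) _; set I := ract_head _ _ => IH.
have -> : I = (R + I) - R by lmodule k L.
by rewrite IH !exprS; lmodule k L.
Qed.

Lemma ract_one f v : (forall t, (size t).+1 = size v -> f (1 :: t) = 0) ->
  ract f 1 v = f v.
Proof.
case: v => [|c v] f0 /=; first by rewrite mulr1.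
by rewrite mul1r ract0 ?subr0 // => t st; apply: f0; rewrite st.
Qed.

(** The products of the unit with its two neighbours cancel, or the right action by 1 takes the
    place of the second if [v] is empty. *)
Lemma ract_normal u v b h : normal_upto (size u + size v).+1 (size u).+2 h ->
  ract h b (u ++ 1 :: v) = 0.
Proof.
elim: u h b => [|c u IHu] h b hN /=.
  rewrite mulr1 ract_one /= ?subrr // => t st.
  by apply: (hN [:: b]) => //=; rewrite -st.
rewrite IHu ?subr0; last exact: normal_upto_cons.
by apply: (hN (b * c :: u)) => /=; lia.
Qed.

Lemma normal_hoch_d n j h : normal_upto n j h -> normal_upto n.+1 j (hoch_d n h).
Proof.
move=> hN [|b u] v sz ltj /=.
  rewrite hoch_d_ract; last by case: sz.
  rewrite mul1r ract_one ?subrr // => t st; apply: (hN [::]) => //=.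
  by case: sz => <-; rewrite add0n.
have suv : (size u + size v).+1 = n by case: sz.
rewrite hoch_d_ract ?size_cat /= ?addnS // hN ?mulr0 ?sub0r; [|by []|exact: ltnW].
rewrite ract_normal ?oppr0 // => s t st lts; apply: hN; first by rewrite st.
exact: leq_trans lts ltj.
Qed.

Lemma normal_insert1 n j f : normal_upto n.+1 j f -> normal_upto n j (insert1 j f).
Proof.
move=> fN s t sz lts; rewrite /insert1 take_cat drop_cat ltnNge (ltnW lts) /=.
case e : (j - size s)%N => [|i] /=; first by move: e lts; lia.
rewrite -catA; apply: (fN s) => //.
by rewrite size_cat /= addnS -size_cat cat_take_drop addnS sz.
Qed.

(** The cocycle condition at a doubled unit, [u ++ 1 :: 1 :: v], computes the coboundary of
    [insert1 j f] at [u ++ 1 :: v]. The earlier slots remain normalized by [normal_hoch_d]. *)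
Lemma normalize_step n j f : hoch_cocycle n.+1 f -> (j <= n)%N ->
  normal_upto n.+1 j f ->
  normal_upto n.+1 j.+1 (fun s => f s - (-1) ^+ j *: hoch_d n (insert1 j f) s).
Proof.
move=> [fL fd] lejn fN u v sz; rewrite ltnS leq_eqVlt => /orP[/eqP su|ltu]; last first.
  by rewrite fN // (normal_hoch_d (normal_insert1 fN)) ?scaler0 ?subr0.
have suv : (size u + size v)%N = n by case: sz.
suff -> : hoch_d n (insert1 j f) (u ++ 1 :: v) = (-1) ^+ j *: f (u ++ 1 :: v).
  by rewrite scalerA -expr2 sqrr_sign scale1r subrr.
have := fd (u ++ 1 :: 1 :: v); rewrite size_cat /= !addnS suv => /(_ erefl).
have := ract_insert1 (u := u) (v := v) (f := f); rewrite suv su => /(_ fN).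
case: u su sz suv => [|b u] su sz suv.
  rewrite !cat0s -su !hoch_d_ract ?mul1r ?add0n //= ?suv //.
  rewrite -/(ract f 1 (1 :: v)) => E /subr0_eq E'.
  have -> : insert1 0 f v = f (1 :: v) by rewrite /insert1 take0 drop0.
  set I := ract (insert1 _ _) _ _ in E *; set R := ract _ _ _ in E *.
  have -> : I = (R + I) - R by lmodule k L.
  by rewrite E E'; lmodule k L.
have suv' : size (u ++ 1 :: 1 :: v) = n.+1 by move: suv; rewrite size_cat /=; lia.
have suv2 : size (u ++ 1 :: v) = n by move: suv; rewrite size_cat /=; lia.
rewrite !cat_cons !hoch_d_ract // fN; [|by move: suv' ; rewrite size_cat /=; lia|by rewrite -su].
have -> : insert1 j f (u ++ 1 :: v) = 0.
  rewrite /insert1 -su take_cat drop_cat ltnNge leqnSn /= subSnn /= take0 drop0 -catA.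
  by apply: fN; [move: suv'; rewrite size_cat /=; lia|rewrite -su].
rewrite !mulr0 /ract_head addr0; set R := ract f b _; set I := ract _ b _ => E E'.
have R0 : R = 0 by move/eqP: E'; rewrite sub0r oppr_eq0 => /eqP.
have {E} I_eq : I = - (-1) ^+ j *: f (b :: u ++ 1 :: v) by rewrite -E R0 add0r.
by rewrite I_eq; lmodule k L.
Qed.

Lemma hoch_cocycleB n f h : hoch_cocycle n.+1 f -> multilinear n h ->
  hoch_cocycle n.+1 (fun s => f s - hoch_d n h s).
Proof.
move=> [fL fd] hL; have dL := hoch_d_multilinear hL.
split=> [|s sz]; first exact: multilinearB.
by rewrite hoch_dB // hoch_dK // fd // subr0.
Qed.

Theorem normalization n f : hoch_cocycle n.+1 f ->
  exists2 h, multilinear n h &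
    hoch_cocycle n.+1 (fun s => f s - hoch_d n h s) /\
    normal_upto n.+1 n.+1 (fun s => f s - hoch_d n h s).
Proof.
move=> fC; suff: forall j, (j <= n.+1)%N -> exists2 h, multilinear n h &
    normal_upto n.+1 j (fun s => f s - hoch_d n h s).
  move=> /(_ _ (leqnn _)) [h hL hN]; exists h => //; split=> //.
  exact: hoch_cocycleB.
elim=> [_|j IHj ltj]; first by exists (fun=> 0) => [s t c u v _|s t //]; rewrite scaler0 addr0.
have [h hL hN] := IHj (ltnW ltj); have fhC := hoch_cocycleB fC hL.
set fh := fun s => _ in hN fhC; have fhN := normalize_step fhC ltj hN.
exists (fun s => (-1) ^+ j *: insert1 j fh s + h s).
  have iL := insert1_multilinear fhC.1 ltj.
  by move=> s t c u v sz; rewrite hL // iL //; lmodule k L.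
move=> s t sz lts; rewrite -[RHS](fhN s t sz lts) /fh hoch_d_lincomb.
  by lmodule k L.
by rewrite size_cat /= addnS sz.
Qed.

End Normalization.

(** * Koszul cochains with coefficients in bimodules *)

(** A bimodule given by the four actions of the generators, so that iterated Hom bimodules can be
    written down without an algebra acting. Right actions compose in reverse: [rx (ry m)] is m times
    yx. *)
Record qbimod (k : fieldType) (q : k) := QBimod {
  qcarrier :> lmodType k;
  lx : qcarrier -> qcarrier;
  ly : qcarrier -> qcarrier;
  rx : qcarrier -> qcarrier;
  ry : qcarrier -> qcarrier;
  lx_linear : linear lx;
  ly_linear : linear ly;
  rx_linear : linear rx;
  ry_linear : linear ry;
  lx_lx : forall m, lx (lx m) = 0;
  ly_ly : forall m, ly (ly m) = 0;
  ly_lx : forall m, ly (lx m) = - q^-1 *: lx (ly m);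
  rx_rx : forall m, rx (rx m) = 0;
  ry_ry : forall m, ry (ry m) = 0;
  rx_ry : forall m, rx (ry m) = - q^-1 *: ry (rx m);
  rx_lx : forall m, rx (lx m) = lx (rx m);
  ry_lx : forall m, ry (lx m) = lx (ry m);
  rx_ly : forall m, rx (ly m) = ly (rx m);
  ry_ly : forall m, ry (ly m) = ly (ry m) }.

HB.instance Definition _ (k : fieldType) (q : k) (M : qbimod q) :=
  GRing.isLinear.Build k M M _ (@lx k q M) (@lx_linear k q M).
HB.instance Definition _ (k : fieldType) (q : k) (M : qbimod q) :=
  GRing.isLinear.Build k M M _ (@ly k q M) (@ly_linear k q M).
HB.instance Definition _ (k : fieldType) (q : k) (M : qbimod q) :=
  GRing.isLinear.Build k M M _ (@rx k q M) (@rx_linear k q M).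
HB.instance Definition _ (k : fieldType) (q : k) (M : qbimod q) :=
  GRing.isLinear.Build k M M _ (@ry k q M) (@ry_linear k q M).

Section HomBimodule.
Variables (k : fieldType) (q : k) (q_neq0 : q != 0) (M : qbimod q).
Let N : lmodType k := (M * M * M)%type.

Definition trip_lx (f : N) : N := (lx f.1.1, lx f.1.2, lx f.2).
Definition trip_ly (f : N) : N := (ly f.1.1, ly f.1.2, ly f.2).
Definition trip_rx (f : N) : N := (- rx f.1.1, f.2 - ry f.1.1, - ry (rx f.1.1)).
Definition trip_ry (f : N) : N :=
  (- q^-1 *: f.2 - rx f.1.2, - ry f.1.2, - ry (rx f.1.2)).

Lemma trip_eq (a b c a' b' c' : M) : a = a' -> b = b' -> c = c' ->
  (a, b, c) = (a', b', c') :> N.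
Proof. by move=> -> -> ->. Qed.

Ltac trip := 
  intros; repeat match goal with f : _ |- _ => revert f end; intros;
  rewrite /trip_lx /trip_ly /trip_rx /trip_ry /=;
  apply: trip_eq; rewrite /= ?(linearB, linearN, linearD, linearZ, linear0) /=
    ?(lx_lx, ly_ly, ly_lx, rx_rx, ry_ry, rx_ry, rx_lx, ry_lx, rx_ly, ry_ly)
    ?(linearB, linearN, linearD, linearZ, linear0) /=
    ?(rx_rx, ry_ry) ?(linearB, linearN, linearD, linearZ, linear0) /=.

Lemma trip_lx_linear : linear trip_lx. Proof. by move=> c u v; trip. Qed.
Lemma trip_ly_linear : linear trip_ly. Proof. by move=> c u v; trip. Qed.
Lemma trip_rx_linear : linear trip_rx.
Proof. by move=> c u v; trip; lmodule k M. Qed.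
Lemma trip_ry_linear : linear trip_ry.
Proof. by move=> c u v; trip; lmodule k M. Qed.
Lemma trip_lx_lx m : trip_lx (trip_lx m) = 0. Proof. by trip. Qed.
Lemma trip_ly_ly m : trip_ly (trip_ly m) = 0. Proof. by trip. Qed.
Lemma trip_ly_lx m : trip_ly (trip_lx m) = - q^-1 *: trip_lx (trip_ly m).
Proof. by trip. Qed.
Lemma trip_rx_rx m : trip_rx (trip_rx m) = 0. Proof. by trip; lmodule k M. Qed.
Lemma trip_ry_ry m : trip_ry (trip_ry m) = 0. Proof. by trip; lmodule k M. Qed.
Lemma trip_rx_ry m : trip_rx (trip_ry m) = - q^-1 *: trip_ry (trip_rx m).
Proof. by trip; lmodule k M. Qed.
Lemma trip_rx_lx m : trip_rx (trip_lx m) = trip_lx (trip_rx m). Proof. by trip. Qed.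
Lemma trip_ry_lx m : trip_ry (trip_lx m) = trip_lx (trip_ry m). Proof. by trip. Qed.
Lemma trip_rx_ly m : trip_rx (trip_ly m) = trip_ly (trip_rx m). Proof. by trip. Qed.
Lemma trip_ry_ly m : trip_ry (trip_ly m) = trip_ly (trip_ry m). Proof. by trip. Qed.

(* The bimodule Hom(L/k, M) of the dimension shift: f is given by its values at
   x, y and xy, with (u f)(v) = u f(v) and (f u)(v) = f(u v) - f(u) v. *)
Definition trip : qbimod q := QBimod trip_lx_linear trip_ly_linear trip_rx_linear
  trip_ry_linear trip_lx_lx trip_ly_ly trip_ly_lx trip_rx_rx trip_ry_ry trip_rx_ry
  trip_rx_lx trip_ry_lx trip_rx_ly trip_ry_ly.

End HomBimodule.

(** * The dimension shift on Koszul cohomology *)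

Section KoszulCochains.
Variables (k : fieldType) (q : k) (q_neq0 : q != 0).
Local Notation trip := (trip q_neq0).

Section Differential.
Variable M : qbimod q.
Implicit Types (phi theta : nat -> nat -> M).

Definition previ phi i j : M := if i is i'.+1 then phi i' j else 0.
Definition prevj phi i j : M := if j is j'.+1 then phi i j' else 0.

Definition kd phi i j : M :=
  lx (previ phi i j) + ((-1) ^+ (i + j) * q ^+ j) *: rx (previ phi i j)
  + q ^+ i *: ly (prevj phi i j) + (-1) ^+ (i + j) *: ry (prevj phi i j).

Lemma kdB phi psi i j :
  kd (fun a b => phi a b - psi a b) i j = kd phi i j - kd psi i j.
Proof.
by rewrite /kd; case: i j => [|i] [|j] /=;
  rewrite ?(linearB, linear0) /=; lmodule k M.
Qed.

Lemma kd0 i j : kd (fun _ _ => 0) i j = 0.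
Proof.
by rewrite /kd; case: i j => [|i] [|j] /=; rewrite !linear0 ?scaler0 ?addr0.
Qed.

Lemma kd_central m i j : lx m = rx m -> ly m = ry m -> (i + j = 1)%N ->
  kd (fun _ _ => m) i j = 0.
Proof.
move=> mx my; case: i j => [|[|i]] [|[|j]] // _; rewrite /kd /= !linear0 ?mx ?my; lmodule k M.
Qed.

Lemma kdK phi i j : kd (kd phi) i j = 0.
Proof.
case: i j => [|[|i]] [|[|j]]; rewrite /kd /= ?(linearD, linearZ, linear0) /=
  ?(lx_lx, ly_ly, ly_lx, rx_rx, ry_ry, rx_ry, rx_lx, ry_lx, rx_ly, ry_ly)
  ?(addnS, addSn, exprS, addn0); lmodule k M.
Qed.

Lemma eq_kd phi psi i j :
  (forall a b, (a + b).+1 = (i + j)%N -> phi a b = psi a b) -> kd phi i j = kd psi i j.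
Proof.
move=> e; rewrite /kd; congr (lx _ + _ *: rx _ + _ *: ly _ + _ *: ry _);
  by case: i j e => [|i] [|j] e //=; apply: e; rewrite ?addn0 ?addnS.
Qed.

End Differential.

Section Shift.
Variable M : qbimod q.
Implicit Types (Phi Psi : nat -> nat -> trip M).

(** Evaluates the coefficient at one more letter, appended on the right as in [word_sum_rcons]: an
    appended x is preceded by j letters y, which gives q^j. *)
Definition chi Phi i j : M := q ^+ j *: (previ Phi i j).1.1 + (prevj Phi i j).1.2.

Lemma chiB Phi Psi i j :
  chi (fun a b => Phi a b - Psi a b) i j = chi Phi i j - chi Psi i j.
Proof. by rewrite /chi; case: i j => [|i] [|j] /=; lmodule k M. Qed.

Lemma chi_kd Phi i j : chi (kd Phi) i j = kd (chi Phi) i j.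
Proof.
rewrite /chi /kd; case: i j => [|[|i]] [|[|j]];
  rewrite /= /trip_rx /trip_ry /trip_lx /trip_ly /= ?(linearD, linearZ, linear0) /=
  ?(rx_ry) ?(addnS, addSn, exprS, addn0, expr0); lmodule k M.
Qed.

Lemma kd_chi Phi m : (forall i j, (i + j = m)%N -> kd Phi i j = 0) ->
  forall i j, (i + j = m.+1)%N -> kd (chi Phi) i j = 0.
Proof.
move=> Phi_d i j eij; rewrite -chi_kd /chi.
have -> : previ (kd Phi) i j = 0.
  by case: i eij => //= i eij; apply: Phi_d; case: eij.
have -> : prevj (kd Phi) i j = 0.
  by case: j eij => //= j eij; apply: Phi_d; move: eij; rewrite addnS => -[].
by rewrite /= scaler0 addr0.
Qed.

(** The coordinate at x carries the whole lift, except for i = 0, where only an appended y can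
    contribute. *)
Lemma chi_lift (theta : nat -> nat -> M) m : exists Psi,
  forall i j, (i + j = m.+1)%N -> chi Psi i j = theta i j.
Proof.
exists (fun i j => (q ^- j *: theta i.+1 j, if i is 0 then theta 0 j.+1 else 0, 0)).
move=> [|i] [|j] // e; rewrite /chi /= ?scaler0 ?add0r // scalerA mulfV ?scale1r ?addr0 //.
  by rewrite expf_neq0.
by case: i e => [|i] e; rewrite ?addr0 // expf_neq0.
Qed.

(** On the kernel of [chi] the coordinate at y is determined by that at x, and the cocycle condition
    then determines the one at xy. A primitive therefore only has to match the coordinate at x. *)
Lemma kos_exact Phi m : (forall i j, (i + j = m.+1)%N -> kd Phi i j = 0) ->
    (forall i j, (i + j = m.+1)%N -> chi Phi i j = 0) ->
  exists Theta, forall i j, (i + j = m)%N -> Phi i j = kd Theta i j.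
Proof.
move=> Phi_d Phi_chi.
(* Right multiplication by y sends (0, 0, z) to (- q^-1 z, 0, 0); the factor inverts this and the
   sign in [kd]. *)
pose Theta i j : trip M := (0, 0, - q * (-1) ^+ m *: (Phi i j.+1).1.1).
exists Theta => i j eij.
have e1 : (i + j.+1 = m.+1)%N by rewrite addnS eij.
have e2 : (i.+1 + j = m.+1)%N by rewrite addSn eij.
have := Phi_chi i.+1 j e2; have := Phi_chi i j.+1 e1; have := Phi_d i j.+1 e1.
set P := Phi i j; set A := previ Phi i j.+1.
rewrite /kd {1 2}/chi /= -/A -/P e1 => /(congr1 (fun t => t.1.1)) /= dA Py Px.
have -> : previ Theta i j = (0 : M, 0 : M, - q * (-1) ^+ m *: A.1.1).
  by rewrite /A /Theta; case: (i) => //=; rewrite scaler0.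
(* For j = 0 the left side is zero by convention, and [Px] says that the coordinate of [P] at x
   vanishes too. *)
have -> : prevj Theta i j = (0 : M, 0 : M, - q * (-1) ^+ m *: P.1.1).
  move: Px; rewrite /P /Theta; case: (j) => //=; rewrite addr0 expr0 scale1r => ->.
  by rewrite scaler0.
have {}Py : P.1.2 = - (q ^+ j.+1 *: A.1.1).
  by apply/eqP; rewrite -addr_eq0 addrC Py.
have {dA} Pxy : P.2 = - q * (-1) ^+ m *: (lx A.1.1 + q ^+ i *: ly P.1.1).
  apply/eqP; rewrite -subr_eq0; apply/eqP.
  rewrite -[RHS](scaler0 _ (q * (-1) ^+ m)) -dA /= Py.
  rewrite [rx (- _)]linearN /= [rx (_ *: _)]linearZ /=.
  by rewrite !sign_if /=; case: (odd m) => /=; lmodule k M.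
have ext (u v : trip M) : u.1.1 = v.1.1 -> u.1.2 = v.1.2 -> u.2 = v.2 -> u = v.
  by case: u v => [[? ?] ?] [[? ?] ?] /= -> -> ->.
by apply: ext; rewrite ?Py ?Pxy eij /= ?linear0 ?[lx (_ *: _)]linearZ
  ?[ly (_ *: _)]linearZ /= ?exprS !sign_if; case: odd => /=; lmodule k M.
Qed.

(** Since [chi] is onto with exact kernel: after subtraction of the boundary of a lift of [theta],
    the cocycle lies in the kernel. *)
Lemma chi_injective Phi (theta : nat -> nat -> M) m :
    (forall i j, (i + j = m.+2)%N -> kd Phi i j = 0) ->
    (forall i j, (i + j = m.+2)%N -> chi Phi i j = kd theta i j) ->
  exists Theta, forall i j, (i + j = m.+1)%N -> Phi i j = kd Theta i j.
Proof.
move=> Phi_d Phi_chi; have [Psi chiPsi] := chi_lift theta m.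
have [|i j eij|Theta ThetaP] := @kos_exact (fun i j => Phi i j - kd Psi i j) m.+1.
- by move=> i j eij; rewrite kdB kdK subr0 Phi_d.
- rewrite chiB chi_kd Phi_chi // (@eq_kd _ (chi Psi) theta) ?subrr // => a b.
  by rewrite eij => -[]; exact: chiPsi.
exists (fun i j => Theta i j - (0 - Psi i j)) => i j eij.
rewrite kdB -ThetaP //.
have -> : kd (fun a b => 0 - Psi a b) i j = - kd Psi i j; last by lmodule k (trip M).
by rewrite (@kdB _ (fun _ _ => 0)) kd0 sub0r.
Qed.

(** The hypothesis on [chi] gives the coordinates at x and y, and centrality of [F] forces the one
    at xy. The triple is the map sending v to v theta - theta v. *)
Lemma kos_inner (F : trip M) (theta : M) :
    (forall i j, (i + j = 1)%N -> kd (fun _ _ => F) i j = 0) ->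
    (forall i j, (i + j = 1)%N -> chi (fun _ _ => F) i j = kd (fun _ _ => theta) i j) ->
  F = (lx theta - rx theta, ly theta - ry theta, lx (ly theta) - ry (rx theta)).
Proof.
move=> F_d F_chi; have := F_chi 1%N 0%N erefl; have := F_chi 0%N 1%N erefl.
have := F_d 0%N 1%N erefl; move=> /(congr1 (fun t => t.1.1)).
rewrite /chi /kd /= !linear0 !expr0 !expr1 => F3 F2 F1.
have {}F1 : F.1.1 = lx theta - rx theta.
  by rewrite -[LHS]addr0 -[F.1.1]scale1r F1; lmodule k M.
have {}F2 : F.1.2 = ly theta - ry theta.
  by rewrite -[LHS]add0r F2; lmodule k M.
rewrite [LHS]surjective_pairing [F.1]surjective_pairing.
rewrite F1 F2; congr (_, _, _); apply/eqP; rewrite -subr_eq0; apply/eqP.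
rewrite -[RHS](scaler0 M q) -F3 F1 F2 !(linearB, linearN) /= ly_lx rx_ry rx_ly.
by lmodule k M.
Qed.

End Shift.

Fixpoint homs (M : qbimod q) p : qbimod q := if p is p'.+1 then trip (homs M p') else M.

Fixpoint chis (M : qbimod q) p : (nat -> nat -> homs M p) -> nat -> nat -> M :=
  if p is p'.+1 then fun Phi => chis (chi Phi) else id.

Lemma chis_injective M p m (Phi : nat -> nat -> homs M p) (theta : nat -> nat -> M) :
    (forall i j, (i + j = m.+2)%N -> kd Phi i j = 0) ->
    (forall i j, (i + j = m.+1 + p)%N -> chis Phi i j = kd theta i j) ->
  exists Theta, forall i j, (i + j = m.+1)%N -> Phi i j = kd Theta i j.
Proof.
elim: p m Phi => [|p IHp] m Phi Phi_d Phi_chi.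
  by exists theta => i j eij; apply: Phi_chi; rewrite addn0.
have [||Theta ThetaP] := IHp m.+1 (chi Phi).
- exact: kd_chi.
- by move=> i j eij; apply: Phi_chi; rewrite addnS -addSn.
exact: chi_injective ThetaP.
Qed.

(** One application of [chi] turns the central element into a 1-cocycle, to which [chis_injective]
    applies; the degree 0 value of the resulting primitive is the inducing element. *)
Theorem central_inner (M : qbimod q) n (F : homs M n.+1) (theta : nat -> nat -> M) :
    lx F = rx F -> ly F = ry F ->
    (forall i j, (i + j = n.+1)%N -> chis (fun _ _ => F) i j = kd theta i j) ->
  exists G : homs M n, F = (lx G - rx G, ly G - ry G, lx (ly G) - ry (rx G)).
Proof.
move=> Fx Fy F_chi; have F_d := kd_central Fx Fy.
have [|i j eij|Theta ThetaP] := @chis_injective M n 0 (chi (fun _ _ => F)) theta.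
- exact: (@kd_chi _ (fun _ _ => F) 1 F_d).
- by apply: F_chi; rewrite eij.
exists (Theta 0%N 0%N); apply: kos_inner => // i j eij.
rewrite ThetaP //; apply: eq_kd => a b; rewrite eij => -[].
by case: a b => [|a] [|b].
Qed.

End KoszulCochains.

(** * Hochschild cochains as elements of iterated bimodules *)

Section Coordinates.
Variables (k : fieldType) (q : k) (L : algType k) (x y : L).
Hypothesis e : quantum_exterior q x y.
Let q_neq0 := qe_neq0 e.

Definition co1 a := (qe_coords e a).1.1.1.
Definition cox a := (qe_coords e a).1.1.2.
Definition coy a := (qe_coords e a).1.2.
Definition coxy a := (qe_coords e a).2.

Lemma qe_expand a : a = co1 a *: 1 + cox a *: x + coy a *: y + coxy a *: (x * y).
Proof. by rewrite -[LHS](qe_coordsK e). Qed.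

Lemma qe_coordsE a a1 ax ay axy : a = a1 *: 1 + ax *: x + ay *: y + axy *: (x * y) ->
  [/\ co1 a = a1, cox a = ax, coy a = ay & coxy a = axy].
Proof.
by rewrite -/(basis_comb x y (a1, ax, ay, axy)) /co1 /cox /coy /coxy => ->; rewrite qe_combK.
Qed.

Lemma qe_coords_lin c a b :
  [/\ co1 (c *: a + b) = c * co1 a + co1 b, cox (c *: a + b) = c * cox a + cox b,
      coy (c *: a + b) = c * coy a + coy b & coxy (c *: a + b) = c * coxy a + coxy b].
Proof. by apply: qe_coordsE; rewrite {1}[a]qe_expand {1}[b]qe_expand; lmodule k L. Qed.

Lemma qe_coords_1 : [/\ co1 1 = 1, cox 1 = 0, coy 1 = 0 & coxy 1 = 0].
Proof. by apply: qe_coordsE; lmodule k L. Qed.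

Lemma qe_coords_x : [/\ co1 x = 0, cox x = 1, coy x = 0 & coxy x = 0].
Proof. by apply: qe_coordsE; lmodule k L. Qed.

Lemma qe_coords_y : [/\ co1 y = 0, cox y = 0, coy y = 1 & coxy y = 0].
Proof. by apply: qe_coordsE; lmodule k L. Qed.

Lemma qe_coords_xy :
  [/\ co1 (x * y) = 0, cox (x * y) = 0, coy (x * y) = 0 & coxy (x * y) = 1].
Proof. by apply: qe_coordsE; lmodule k L. Qed.

Lemma qe_yx : y * x = - q^-1 *: (x * y).
Proof. exact: quantum_yx q_neq0 (qe_xy e). Qed.

Lemma qe_xxy : x * (x * y) = 0. Proof. by rewrite mulrA (qe_xx e) mul0r. Qed.
Lemma qe_yxy : y * (x * y) = 0.
Proof. by rewrite mulrA qe_yx -scalerAl -mulrA (qe_yy e) mulr0 scaler0. Qed.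
Lemma qe_xyx : x * y * x = 0.
Proof. by rewrite -mulrA qe_yx -scalerAr qe_xxy scaler0. Qed.
Lemma qe_xyy : x * y * y = 0. Proof. by rewrite -mulrA (qe_yy e) mulr0. Qed.

Lemma qe_coords_mulx a : [/\ co1 (x * a) = 0, cox (x * a) = co1 a, coy (x * a) = 0 &
  coxy (x * a) = coy a].
Proof.
apply: qe_coordsE; rewrite {1}[a]qe_expand !mulrDr -!scalerAr mulr1 (qe_xx e) qe_xxy.
by lmodule k L.
Qed.

Lemma qe_coords_muly a : [/\ co1 (y * a) = 0, cox (y * a) = 0, coy (y * a) = co1 a &
  coxy (y * a) = - q^-1 * cox a].
Proof.
apply: qe_coordsE; rewrite {1}[a]qe_expand !mulrDr -!scalerAr mulr1 (qe_yy e) qe_yxy qe_yx.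
by lmodule k L.
Qed.

Fact mulx_linear (a : L) : linear (fun m : L => a * m).
Proof. by move=> c u v; rewrite mulrDr scalerAr. Qed.
Fact xmul_linear (a : L) : linear (fun m : L => m * a).
Proof. by move=> c u v; rewrite mulrDl scalerAl. Qed.

Definition reg_bimod : qbimod q.
Proof.
refine (@QBimod k q L (fun m => x * m) (fun m => y * m) (fun m => m * x) (fun m => m * y)
  (mulx_linear x) (mulx_linear y) (xmul_linear x) (xmul_linear y) _ _ _ _ _ _ _ _ _ _) => m.
- by rewrite mulrA (qe_xx e) mul0r.
- by rewrite mulrA (qe_yy e) mul0r.
- by rewrite !mulrA qe_yx -scalerAl.
- by rewrite -mulrA (qe_xx e) mulr0.
- by rewrite -mulrA (qe_yy e) mulr0.
- by rewrite -!mulrA qe_yx -scalerAr.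
- by rewrite mulrA.
- by rewrite mulrA.
- by rewrite mulrA.
- by rewrite mulrA.
Defined.

Local Notation homs := (homs q_neq0 reg_bimod).

(** Reads an element of the iterated bimodule as a multilinear function. The coordinate at 1 is
    dropped, which makes the function normalized. *)
Fixpoint dec p : homs p -> seq L -> L :=
  match p return homs p -> seq L -> L with
  | 0 => fun m _ => m
  | p'.+1 => fun m s => if s is c :: t then
      cox c *: dec m.1.1 t + coy c *: dec m.1.2 t + coxy c *: dec m.2 t else 0
  end.

Fixpoint enc p (f : seq L -> L) : homs p :=
  match p return homs p with
  | 0 => f [::]
  | p'.+1 => (enc p' (f \o cons x), enc p' (f \o cons y), enc p' (f \o cons (x * y)))
  end.

Lemma dec_lincomb p c (m m' : homs p) s : dec (c *: m + m') s = c *: dec m s + dec m' s.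
Proof.
elim: p m m' s => [|p IHp] m m' [|a s] //=; first by rewrite scaler0 addr0.
by rewrite !IHp; lmodule k L.
Qed.

Lemma dec0 p s : dec (0 : homs p) s = 0.
Proof. by have := dec_lincomb (-1) (0 : homs p) 0 s; rewrite scaler0 addr0 scaleN1r addNr. Qed.

Lemma decN p (m : homs p) s : dec (- m) s = - dec m s.
Proof. by rewrite -[- m]addr0 -scaleN1r dec_lincomb dec0 addr0 scaleN1r. Qed.

Lemma decB p (m m' : homs p) s : dec (m - m') s = dec m s - dec m' s.
Proof. by rewrite -[X in dec (X - _)]scale1r dec_lincomb decN scale1r. Qed.

Lemma decZ p c (m : homs p) s : dec (c *: m) s = c *: dec m s.
Proof. by rewrite -[c *: m]addr0 dec_lincomb dec0 addr0. Qed.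

Lemma dec_multilinear p (m : homs p) : multilinear p (dec m).
Proof.
elim: p m => [|p IHp] m [|a s] t c u v //= [sz].
  by have [_ -> -> ->] := qe_coords_lin c u v; lmodule k L.
by rewrite !IHp //; lmodule k L.
Qed.

Lemma dec_normal p (m : homs p) s t : (size s + size t).+1 = p -> dec m (s ++ 1 :: t) = 0.
Proof.
elim: p m s => [|p IHp] m [|a s] //= [sz].
  by have [_ -> -> ->] := qe_coords_1; lmodule k L.
by rewrite !IHp ?scaler0 ?addr0.
Qed.

Lemma dec_lx p (m : homs p) s : dec (lx m) s = x * dec m s.
Proof.
elim: p m s => [|p IHp] m [|a s] //=; first by rewrite mulr0.
by rewrite !IHp !mulrDr !scalerAr.
Qed.

Lemma dec_ly p (m : homs p) s : dec (ly m) s = y * dec m s.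
Proof.
elim: p m s => [|p IHp] m [|a s] //=; first by rewrite mulr0.
by rewrite !IHp !mulrDr !scalerAr.
Qed.

Lemma ract_expand f c s : multilinear (size s) f -> 
  ract f c s = co1 c *: ract f 1 s + cox c *: ract f x s + coy c *: ract f y s
    + coxy c *: ract (ract f x) y s.
Proof.
move=> fL; rewrite ractA.
have cE : c = co1 c *: 1 + (cox c *: x + (coy c *: y + (coxy c *: (x * y) + 0))).
  by rewrite {1}[c]qe_expand; lmodule k L.
have Z : ract f 0 s = 0.
  by have := ract_linl (-1) 0 0 fL; rewrite scaler0 addr0 scaleN1r addNr.
by rewrite {1}cE !ract_linl // Z; lmodule k L.
Qed.

(** Both sides are (f b)(c) = f(bc) - f(b) c, once the first argument c is expanded in 1, x, y,
    xy. *)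
Lemma dec_ract p (m : homs p) s : size s = p ->
  dec (rx m) s = ract (dec m) x s /\ dec (ry m) s = ract (dec m) y s.
Proof.
elim: p m s => [|p IHp] m s; first by move/size0nil ->.
case: s => // c s [sz].
have one (m' : homs p) : ract (dec m') 1 s = dec m' s.
  by apply: ract_one => t st; apply: (@dec_normal p m' [::] t); rewrite add0n st sz.
have two (m' : homs p) : ract (ract (dec m') x) y s = dec (ry (rx m')) s.
  by rewrite (IHp _ _ sz).2; apply/esym/eq_ract => u su; rewrite (IHp _ _ (etrans su sz)).1.
rewrite /=.
have [_ -> -> ->] := qe_coords_mulx c; have [_ -> -> ->] := qe_coords_muly c.
have [_ x1 x2 x3] := qe_coords_x; have [_ y1 y2 y3] := qe_coords_y.
rewrite (@eq_ract _ _ (dec m \o cons x) (dec m.1.1)) => [|t _]; last first.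
  by rewrite /= x1 x2 x3; lmodule k L.
rewrite (@eq_ract _ _ (dec m \o cons y) (dec m.1.2)) => [|t _]; last first.
  by rewrite /= y1 y2 y3; lmodule k L.
rewrite (@ract_expand (dec m.1.1) c) ?sz; last exact: dec_multilinear.
rewrite (@ract_expand (dec m.1.2) c) ?sz; last exact: dec_multilinear.
rewrite !one !two -!(IHp _ _ sz).1 -!(IHp _ _ sz).2.
split; rewrite /= ?decB ?decN ?decZ ?decB; lmodule k L.
Qed.

Lemma multilinear_cons n (f : seq L -> L) a : multilinear n.+1 f -> multilinear n (f \o cons a).
Proof. by move=> fL s t c u v sz; apply: (fL (a :: s)); rewrite /= addSn sz. Qed.

Lemma dec_enc p (f : seq L -> L) s : multilinear p f -> normal_upto p p f -> size s = p ->
  dec (enc p f) s = f s.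
Proof.
elim: p f s => [|p IHp] f s fL fN; first by move/size0nil ->.
case: s => // c t [sz] /=.
have fN' a : normal_upto p p (f \o cons a).
  by move=> u v suv ltu; apply: (fN (a :: u)); rewrite //= addSn suv.
rewrite !IHp //; try exact: multilinear_cons.
have f1 : f (1 :: t) = 0 by apply: (fN [::]) => //=; rewrite add0n sz.
have cE : c = cox c *: x + (coy c *: y + (coxy c *: (x * y) + co1 c *: 1)).
  by rewrite {1}[c]qe_expand; lmodule k L.
have lin a u v : f (a *: u + v :: t) = a *: f (u :: t) + f (v :: t).
  by apply: (fL [::]); rewrite add0n sz.
have f0 : f (0 :: t) = 0 by have := lin (-1) 0 0; rewrite scaler0 addr0 scaleN1r addNr.
rewrite [in RHS]cE !lin -[co1 c *: 1]addr0 lin f1 f0 /=; lmodule k L.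
Qed.

Lemma dec_inj p (m : homs p) : (forall s, size s = p -> dec m s = 0) -> m = 0.
Proof.
elim: p m => [|p IHp] m m0; first exact: (m0 [::]).
have [_ x1 x2 x3] := qe_coords_x; have [_ y1 y2 y3] := qe_coords_y.
have [_ z1 z2 z3] := qe_coords_xy.
rewrite [m]surjective_pairing [m.1]surjective_pairing.
rewrite (IHp m.1.1) => [|s sz]; last first.
  by rewrite -(m0 (x :: s)) /= ?sz // x1 x2 x3; lmodule k L.
rewrite (IHp m.1.2) => [|s sz]; last first.
  by rewrite -(m0 (y :: s)) /= ?sz // y1 y2 y3; lmodule k L.
rewrite (IHp m.2) => [//|s sz].
by rewrite -(m0 (x * y :: s)) /= ?sz // z1 z2 z3; lmodule k L.
Qed.

(** [chi] is the decomposition of a sum over words by the last letter. *)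
Lemma dec_chi p m (Phi : nat -> nat -> homs p.+1) (f : seq L -> L) :
    (forall i j s, (i + j = m)%N -> size s = p.+1 ->
       dec (Phi i j) s = word_sum q m j (fun w => f (map (letter x y) w ++ s))) ->
  forall i j s, (i + j = m.+1)%N -> size s = p ->
    dec (chi Phi i j) s = word_sum q m.+1 j (fun w => f (map (letter x y) w ++ s)).
Proof.
move=> Phi_f i j s eij sz; rewrite word_sum_rcons /chi dec_lincomb.
have [_ x1 x2 x3] := qe_coords_x; have [_ y1 y2 y3] := qe_coords_y.
have catE b w : map (letter x y) (rcons w b) ++ s = map (letter x y) w ++ (letter x y b :: s).
  by rewrite map_rcons cat_rcons.
congr (_ *: _ + _).
- case: i eij => [|i] eij.
    by rewrite /= dec0 word_sum_gt //; move: eij; rewrite add0n => ->.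
  transitivity (dec (Phi i j) (x :: s)).
    by rewrite /= x1 x2 x3; lmodule k L.
  rewrite Phi_f /= ?sz //; last by case: eij.
  by apply: eq_word_sum => w _; rewrite catE.
case: j eij => [|j] eij /=; first by rewrite dec0.
transitivity (dec (Phi i j) (y :: s)).
  by rewrite /= y1 y2 y3; lmodule k L.
rewrite Phi_f /= ?sz //; last by move: eij; rewrite addnS => -[].
by apply: eq_word_sum => w _; rewrite catE.
Qed.

Lemma chis_word_sum p m (Phi : nat -> nat -> homs p) (f : seq L -> L) :
    (forall i j s, (i + j = m)%N -> size s = p ->
       dec (Phi i j) s = word_sum q m j (fun w => f (map (letter x y) w ++ s))) ->
  forall i j, (i + j = m + p)%N -> chis Phi i j = iota_pull q x y f i j.
Proof.
elim: p m Phi => [|p IHp] m Phi Phi_f i j eij.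
  have := Phi_f i j [::]; rewrite eij addn0 => /(_ erefl erefl) /= ->.
  by rewrite /iota_pull eij addn0; apply: eq_bigr => w _; rewrite cats0.
rewrite /= (IHp m.+1) //; last by rewrite addSnnS.
exact: dec_chi.
Qed.

Lemma kos_dE (theta : nat -> nat -> L) i j :
  kos_d q x y theta i j = kd (M := reg_bimod) theta i j.
Proof.
rewrite /kos_d /kd; case: i j => [|i] [|j]; rewrite /= ?mulr0 ?mul0r -?scalerA
  -?sign_scale; rewrite ?sign_scale; lmodule k L.
Qed.

Lemma iota_pull_lincomb c (f g : seq L -> L) i j :
  iota_pull q x y (fun s => c *: f s + g s) i j =
  c *: iota_pull q x y f i j + iota_pull q x y g i j.
Proof.
rewrite /iota_pull scaler_sumr -big_split; apply: eq_bigr => w _ /=.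
by rewrite scalerDr !scalerA mulrC.
Qed.

Lemma eq_iota_pull (f g : seq L -> L) i j : (forall s, size s = (i + j)%N -> f s = g s) ->
  iota_pull q x y f i j = iota_pull q x y g i j.
Proof.
move=> fg; rewrite /iota_pull big_seq_cond [RHS]big_seq_cond.
by apply: eq_bigr => w /andP[/words_size sw _]; rewrite fg // size_map.
Qed.

Lemma iota_pullB (f g : seq L -> L) i j :
  iota_pull q x y (fun s => f s - g s) i j = iota_pull q x y f i j - iota_pull q x y g i j.
Proof.
rewrite [RHS]addrC -scaleN1r -iota_pull_lincomb; apply: eq_iota_pull => s _.
by rewrite scaleN1r addrC.
Qed.

Lemma dec_inner n (G : homs n) c t : size t = n ->
  dec ((lx G - rx G, ly G - ry G, lx (ly G) - ry (rx G)) : homs n.+1) (c :: t) =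
  c * dec G t - ract (dec G) c t.
Proof.
move=> sz; have dG := dec_ract G sz.
have one : ract (dec G) 1 t = dec G t.
  by apply: ract_one => u su; apply: (@dec_normal n G [::] u); rewrite add0n su sz.
have two : ract (ract (dec G) x) y t = dec (ry (rx G)) t.
  by rewrite (dec_ract _ sz).2; apply/esym/eq_ract => u su; rewrite (dec_ract _ (etrans su sz)).1.
rewrite ract_expand ?sz; last exact: dec_multilinear.
have -> : c * dec G t = co1 c *: dec G t + cox c *: (x * dec G t) + coy c *: (y * dec G t)
    + coxy c *: (x * (y * dec G t)).
  by rewrite {1}[c]qe_expand !mulrDl -!scalerAl mul1r mulrA.
by rewrite one two -dG.1 -dG.2 /= !decB !dec_lx !dec_ly; lmodule k L.
Qed.

Theorem iota_pull_injective n (f : seq L -> L) (theta : nat -> nat -> L) : hoch_cocycle n.+1 f ->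
    (forall i j, (i + j = n.+1)%N -> iota_pull q x y f i j = kos_d q x y theta i j) ->
  exists2 h, multilinear n h & forall s, size s = n.+1 -> f s = hoch_d n h s.
Proof.
move=> fC f_theta; have [h hL [[fL fd] fN]] := normalization fC.
set f' := fun s => _ in fL fd fN.
pose F : homs n.+1 := enc n.+1 f'.
have decF s : size s = n.+1 -> dec F s = f' s by exact: dec_enc.
have act (b : L) s : size s = n.+1 -> b * f' s = ract f' b s.
  by move=> sz; have := fd (b :: s); rewrite /= sz hoch_d_ract // => /(_ erefl) /subr0_eq.
(* Normalization subtracted the coboundary of [h], so the Koszul primitive changes by the
   restriction of [h]. *)
have [||i j eij|G FG] := @central_inner _ _ q_neq0 reg_bimod n F
    (fun i j => theta i j - iota_pull q x y h i j).
- apply/subr0_eq/dec_inj => s sz; rewrite decB dec_lx (dec_ract _ sz).1 decF // act //.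
  by rewrite (@eq_ract _ _ (dec F) f') ?subrr // => u su; rewrite decF // su.
- apply/subr0_eq/dec_inj => s sz; rewrite decB dec_ly (dec_ract _ sz).2 decF // act //.
  by rewrite (@eq_ract _ _ (dec F) f') ?subrr // => u su; rewrite decF // su.
- rewrite (chis_word_sum (m := 0) (f := f')) => [|a b s|//]; last first.
  case: a b => [|a] [|b] // _ sz; rewrite word_sum_nil /=; exact: decF.
  rewrite kdB -!kos_dE iota_pullB f_theta // (iota_chain (qe_xx e) (qe_yy e) (qe_xy e) hL) //.
exists (fun s => 1 *: dec G s + h s).
  move=> s t c u v sz; rewrite (dec_multilinear G) // hL //; lmodule k L.
move=> s sz; rewrite hoch_d_lincomb // scale1r; case: s sz => // c t [sz].
rewrite hoch_d_ract // -dec_inner // -FG decF ?subrK //=.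
by rewrite sz.
Qed.

End Coordinates.

(** * Independence of the bracket from the representing cocycles *)

Section WellDefined.
Variables (k : fieldType) (q : k) (L : algType k) (x y : L).
Hypothesis e : quantum_exterior q x y.
Implicit Types (f g h : seq L -> L) (phi psi theta : nat -> nat -> L).

Local Notation iota_pull := (iota_pull q x y).
Local Notation kos_d := (kos_d q x y).
Local Notation cohomologous := (kos_cohomologous q x y).

Lemma kos_dB phi psi i j : kos_d (fun a b => phi a b - psi a b) i j = kos_d phi i j - kos_d psi i j.
Proof. by rewrite !(kos_dE e) kdB. Qed.

Lemma kos_d0 i j : kos_d (fun _ _ => 0) i j = 0.
Proof. by rewrite (kos_dE e) kd0. Qed.

Lemma kos_dK phi i j : kos_d (kos_d phi) i j = 0.
Proof.
rewrite -(kdK (qe_neq0 e) (M := reg_bimod e) phi i j) (kos_dE e).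
by apply: (@eq_kd _ _ (reg_bimod e)) => a b _; exact: kos_dE.
Qed.

Lemma eq_kos_d phi psi i j :
  (forall a b, (a + b).+1 = (i + j)%N -> phi a b = psi a b) -> kos_d phi i j = kos_d psi i j.
Proof. by move=> pq; rewrite !(kos_dE e); exact: (@eq_kd _ _ (reg_bimod e)). Qed.

Lemma cohomologous_eq n phi psi : (forall i j, (i + j = n)%N -> phi i j = psi i j) ->
  cohomologous n phi psi.
Proof. by move=> pq; exists (fun _ _ => 0) => i j /pq ->; rewrite subrr kos_d0. Qed.

Lemma cohomologous_sym n phi psi : cohomologous n phi psi -> cohomologous n psi phi.
Proof.
move=> [th thP]; exists (fun i j => 0 - th i j) => i j eij.
by rewrite kos_dB kos_d0 -thP // sub0r opprB.
Qed.

Lemma cohomologous_trans n phi psi chi :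
  cohomologous n phi psi -> cohomologous n psi chi -> cohomologous n phi chi.
Proof.
move=> [t1 t1P] /cohomologous_sym [t2 t2P]; exists (fun i j => t1 i j - t2 i j) => i j eij.
by rewrite kos_dB -t1P // -t2P // opprB addrA subrK.
Qed.

Lemma gbracket_lincomb_l m n f f' g c s : (size s).+1 = (m + n)%N -> multilinear m f ->
    multilinear m f' -> multilinear n g ->
  gbracket m n (fun u => c *: f u + f' u) g s = c *: gbracket m n f g s + gbracket m n f' g s.
Proof.
move=> sz fL f'L gL.
have E f1 f2 : (forall u, size u = m -> f1 u = f2 u) ->
    gbracket m n f1 g s = brk m n f2 (cut n g) s.
  move=> f12; rewrite -gbracket_brk //; apply: eq_gbracket => // u su; exact/esym/cutE.
rewrite (E _ (fun u => c *: cut m f u + cut m f' u)) => [|u su]; last by rewrite !cutE.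
rewrite (E f (cut m f)) => [|u su]; last by rewrite cutE.
rewrite (E f' (cut m f')) => [|u su]; last by rewrite cutE.
rewrite /brk (@ins_lincomb _ _ n (cut n g) _ (cut m f) (cut m f') c) //.
by rewrite ins_lincombl; [lmodule k L|exact: cut_mlin].
Qed.

(** In positive degree the two representatives differ by a coboundary, by [iota_pull_injective], and
    [gbracket_hoch_d] applies. In degree 0 they coincide, there being no coboundaries. *)
Lemma cohomologous_gbracket m n f f' g phi :
    represents q x y m f phi -> represents q x y m f' phi -> hoch_cocycle n g ->
  cohomologous (m + n).-1 (iota_pull (gbracket m n f g)) (iota_pull (gbracket m n f' g)).
Proof.
move=> [fC _ [t tP]] [f'C _ [t' t'P]] gC.
case: m => [|m] in fC f'C tP t'P *.
  have ff u : size u = 0%N -> f u = f' u.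
    move/size0nil ->; have := tP 0%N 0%N erefl; have := t'P 0%N 0%N erefl.
    by rewrite /kos_d !iota_pull00 addr0 => /subr0_eq -> /subr0_eq ->.
  apply: cohomologous_eq => i j eij; apply: eq_iota_pull => s sz.
  case: n => [|n] in eij gC *; first by rewrite /gbracket /circ !big_ord0.
  by apply: eq_gbracket => //; rewrite sz eij.
have [||h hL fh] := @iota_pull_injective _ _ _ _ _ e m (fun s => f s - f' s)
    (fun i j => t i j - t' i j).
- split=> [|s sz]; first exact: multilinearB fC.1 f'C.1.
  by rewrite hoch_dB // fC.2 // f'C.2 // subrr.
- move=> i j eij; rewrite iota_pullB kos_dB -tP // -t'P //; lmodule k L.
have dL := hoch_d_multilinear hL.
have fE s : size s = (m + n)%N -> gbracket m.+1 n f g s = 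
    gbracket m.+1 n (hoch_d m h) g s + gbracket m.+1 n f' g s.
  move=> sz; have sz1 : (size s).+1 = (m.+1 + n)%N by rewrite sz.
  rewrite -[X in X + _]scale1r -(gbracket_lincomb_l _ sz1 dL f'C.1 gC.1).
  by apply: eq_gbracket => // u su; rewrite scale1r -fh // subrK.
have [mn0|mn0] := posnP (m + n).
  apply: cohomologous_eq => i j eij; apply: eq_iota_pull => s sz.
  have sz' : size s = (m + n)%N by rewrite sz eij.
  by rewrite fE // gbracket_hoch_d // mn0 add0r.
exists (fun i j => (-1) ^+ n.+1 *: iota_pull (gbracket m n h g) i j) => i j eij.
have eij' : (i + j = (m + n).-1.+1)%N by rewrite eij prednK.
rewrite (@eq_iota_pull _ q _ x y (gbracket m.+1 n f g) (fun s =>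
    (-1) ^+ n.+1 *: hoch_d (m + n).-1 (gbracket m n h g) s + gbracket m.+1 n f' g s)).
  rewrite iota_pull_lincomb addrK.
  rewrite (iota_chain (qe_xx e) (qe_yy e) (qe_xy e) (gbracket_multilinear hL gC.1)) //.
  rewrite !(kos_dE e) /kd.
  by case: (i) (j) => [|i'] [|j']; rewrite /= ?mulr0 ?mul0r -?scalerAr -?scalerAl; lmodule k L.
move=> s; rewrite eij => sz; rewrite fE // gbracket_hoch_d //.
by rewrite eqn0Ngt mn0.
Qed.

Lemma gbracketN_cohomologous m n f g phi :
  cohomologous (m + n).-1 (iota_pull (gbracket m n f g)) phi ->
  cohomologous (n + m).-1 (iota_pull (gbracket n m g f))
    (fun i j => - (-1) ^+ (m.+1 * n.+1) *: phi i j).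
Proof.
move=> [t tP]; exists (fun i j => - (-1) ^+ (m.+1 * n.+1) *: t i j) => i j.
rewrite [(n + m)%N]addnC => eij.
have -> : kos_d (fun i j => - (-1) ^+ (m.+1 * n.+1) *: t i j) i j =
    - (-1) ^+ (m.+1 * n.+1) *: kos_d t i j.
  rewrite !(kos_dE e) /kd.
  by case: (i) (j) => [|i'] [|j']; rewrite /= ?mulr0 ?mul0r -?scalerAr -?scalerAl; lmodule k L.
rewrite -tP //.
rewrite (@eq_iota_pull _ q _ x y (gbracket n m g f) (fun s =>
  - (-1) ^+ (m.+1 * n.+1) *: gbracket m n f g s + 0)) => [|s _].
  rewrite iota_pull_lincomb (_ : iota_pull (fun=> 0) i j = 0); first by lmodule k L.
  by rewrite /Defs.iota_pull big1 // => w _; rewrite scaler0.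
by rewrite gbracketC addr0 scaleNr.
Qed.

(** One pair of representatives suffices: the first argument is exchanged directly, the second after
    reversing the order twice by antisymmetry. *)
Theorem HHbracketI m n phi psi chi f g :
    represents q x y m f phi -> represents q x y n g psi ->
    cohomologous (m + n).-1 (iota_pull (gbracket m n f g)) chi ->
  HHbracket q x y m n phi psi chi.
Proof.
move=> fR gR fg; split; [by exists f|by exists g|move=> f' g' f'R g'R].
have [f'C _ _] := f'R; have [g'C _ _] := g'R; have [gC _ _] := gR.
have bC := gbracket_cocycle f'C g'C.
have fg' : cohomologous (m + n).-1 (iota_pull (gbracket m n f' g')) chi.
  apply: cohomologous_trans fg.
  apply: cohomologous_trans (cohomologous_gbracket f'R fR gC).
  have := gbracketN_cohomologous (cohomologous_gbracket g'R gR f'C).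
  move/cohomologous_trans; apply; apply: cohomologous_sym.
  exact: gbracketN_cohomologous (cohomologous_eq (fun i j _ => erefl)).
split=> // i j eij; have [t tP] := fg'.
have := iota_chain (qe_xx e) (qe_yy e) (qe_xy e) bC.1 eij.
rewrite (@eq_iota_pull _ q _ x y _ (fun=> 0)) => [|s]; last by rewrite eij; exact: bC.2.
rewrite (_ : iota_pull (fun=> 0) i j = 0) => [|]; last first.
  by rewrite /Defs.iota_pull big1 // => w _; rewrite scaler0.
rewrite (@eq_kos_d _ (fun i j => chi i j - (0 - kos_d t i j))) => [|a b]; last first.
  by rewrite eij => -[] /tP <-; rewrite sub0r opprK addrC subrK.
by rewrite !kos_dB kos_d0 kos_dK subrr subr0 => <-.
Qed.

Lemma HHbracketCI m n phi psi chi chi' f g :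
    represents q x y m f phi -> represents q x y n g psi ->
    cohomologous (m + n).-1 (iota_pull (gbracket m n f g)) chi ->
    (forall i j, chi' i j = - (-1) ^+ (m.+1 * n.+1) *: chi i j) ->
  HHbracket q x y n m psi phi chi'.
Proof.
move=> fR gR /gbracketN_cohomologous fg chiE; apply: HHbracketI gR fR _.
by apply: cohomologous_trans fg _; apply: cohomologous_eq => i j _; rewrite chiE.
Qed.

End WellDefined.

(** * Explicit cocycles *)

Section Representatives.
Variables (k : fieldType) (q : k) (L : algType k) (x y : L).
Hypothesis e : quantum_exterior q x y.
Let q_neq0 := qe_neq0 e.
Implicit Types (f g : seq L -> L) (al be : k).

Local Notation co1 := (co1 e).
Local Notation cox := (cox e).
Local Notation coy := (coy e).
Local Notation coxy := (coxy e).

Lemma qe_coords_mul a b : [/\ co1 (a * b) = co1 a * co1 b,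
  cox (a * b) = co1 a * cox b + cox a * co1 b,
  coy (a * b) = co1 a * coy b + coy a * co1 b &
  coxy (a * b) = co1 a * coxy b + coxy a * co1 b + cox a * coy b - q^-1 * (coy a * cox b)].
Proof.
apply: qe_coordsE; rewrite {1}[a](qe_expand e) {1}[b](qe_expand e).
rewrite !(mulrDl, mulrDr) -!scalerAl -!scalerAr !(mul1r, mulr1).
rewrite (qe_xx e) (qe_yy e) (qe_xxy e) (qe_yxy e) (qe_xyx e) (qe_xyy e) (qe_yx e).
rewrite mulrA (qe_xyx e) mul0r; lmodule k L.
Qed.

Definition aut al be b : L :=
  co1 b *: 1 + (al * cox b) *: x + (be * coy b) *: y + (al * be * coxy b) *: (x * y).

Definition twisted n al be f :=
  multilinear n f /\ forall b s, size s = n -> ract f b s = aut al be b * f s.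

(** Skew derivations dual to x and y. Their values at xy are forced by the rules [coef_x_mul] and
    [coef_y_mul] for the product of x and y. *)
Definition coef_x be b : L := cox b *: 1 + (be * coxy b) *: y.
Definition coef_y al b : L := coy b *: 1 - (q * al * coxy b) *: x.

Definition Xop be f s : L := if s is b :: t then coef_x be b * f t else 0.
Definition Yop al f s : L := if s is b :: t then coef_y al b * f t else 0.

Lemma XopE be f b t : Xop be f (b :: t) = coef_x be b * f t. Proof. by []. Qed.
Lemma YopE al f b t : Yop al f (b :: t) = coef_y al b * f t. Proof. by []. Qed.

(** A skew Leibniz rule. Its left side is the factor that [ract] produces on [Xop be f] when [f] is
    twisted by (al, be), and its right side shows the new twist. *)
Lemma coef_x_mul al be b c :
  coef_x be (b * c) - coef_x be b * aut al be c = aut (- al) (- q^-1 * be) b * coef_x be c.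
Proof.
rewrite /coef_x /aut; have [_ -> _ ->] := qe_coords_mul b c.
rewrite !(mulrDl, mulrDr) -!scalerAl -!scalerAr !(mul1r, mulr1).
rewrite (qe_yy e) (qe_yxy e) (qe_xyy e) (qe_yx e); lmodule k L.
Qed.

Lemma coef_y_mul al be b c :
  coef_y al (b * c) - coef_y al b * aut al be c = aut (- q * al) (- be) b * coef_y al c.
Proof.
rewrite /coef_y /aut; have [_ _ -> ->] := qe_coords_mul b c.
rewrite !(mulrDl, mulrDr, mulrBl, mulrBr, mulNr, mulrN) -!scalerAl -!scalerAr !(mul1r, mulr1).
rewrite (qe_xx e) (qe_xxy e) (qe_xyx e) (qe_yx e); lmodule k L.
Qed.

Lemma coef_x_lin be c u v : coef_x be (c *: u + v) = c *: coef_x be u + coef_x be v.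
Proof. by rewrite /coef_x; have [_ -> _ ->] := qe_coords_lin e c u v; lmodule k L. Qed.

Lemma coef_y_lin be c u v : coef_y be (c *: u + v) = c *: coef_y be u + coef_y be v.
Proof. by rewrite /coef_y; have [_ _ -> ->] := qe_coords_lin e c u v; lmodule k L. Qed.

Lemma Xop_twisted n al be f : twisted n al be f ->
  twisted n.+1 (- al) (- q^-1 * be) (Xop be f).
Proof.
move=> [fL ft]; split=> [[|a s] t c u v [sz] /=|b [|c s] // [sz] /=].
- by rewrite coef_x_lin mulrDl scalerAl.
- by rewrite fL // mulrDr scalerAr.
rewrite (@eq_ract _ _ (Xop be f \o cons b) (fun u => coef_x be b * f u)) //.
by rewrite ract_mull ft // !mulrA -mulrBl coef_x_mul.
Qed.

Lemma Yop_twisted n al be f : twisted n al be f ->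
  twisted n.+1 (- q * al) (- be) (Yop al f).
Proof.
move=> [fL ft]; split=> [[|a s] t c u v [sz] /=|b [|c s] // [sz] /=].
- by rewrite coef_y_lin mulrDl scalerAl.
- by rewrite fL // mulrDr scalerAr.
rewrite (@eq_ract _ _ (Yop al f \o cons b) (fun u => coef_y al b * f u)) //.
by rewrite ract_mull ft // !mulrA -mulrBl coef_y_mul.
Qed.

(** The parameters are the current twists from [mon_twisted]. The slots for x are outermost, so on
    words the support is x^i y^j. *)
Fixpoint mon i j : seq L -> L :=
  if i is i'.+1 then Xop ((- q^-1) ^+ i' * (-1) ^+ j) (mon i' j)
  else (fix ymon j := if j is j'.+1 then Yop ((- q) ^+ j') (ymon j') else fun=> 1) j.

Lemma mon0S j : mon 0 j.+1 = Yop ((- q) ^+ j) (mon 0 j). Proof. by case: j. Qed.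
Lemma monS i j : mon i.+1 j = Xop ((- q^-1) ^+ i * (-1) ^+ j) (mon i j). Proof. by []. Qed.

Lemma aut11 b : aut 1 1 b = b.
Proof. by rewrite /aut {5}[b](qe_expand e) !mul1r. Qed.

Lemma mon_twisted i j :
  twisted (i + j) ((-1) ^+ i * (- q) ^+ j) ((- q^-1) ^+ i * (-1) ^+ j) (mon i j).
Proof.
elim: i => [|i IHi]; last first.
  by rewrite monS addSn [(-1) ^+ i.+1]exprS [(- q^-1) ^+ _.+1]exprS -!mulrA mulN1r;
    apply: Xop_twisted.
rewrite !mul1r; elim: j => [|j IHj]; last by rewrite mon0S !exprS mulN1r; apply: Yop_twisted.
split=> [s t c u v //|b s /size0nil ->].
by rewrite /= mul1r aut11 mulr1.
Qed.

Definition rep_elt (c : elt) s : L := x ^+ c.1.1 * y ^+ c.1.2 * mon c.2.1 c.2.2 s.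

Lemma twist_comm al be (l : L) b : x * l = al *: (l * x) -> y * l = be *: (l * y) ->
  b * l = l * aut al be b.
Proof.
move=> lx ly; rewrite {1}[b](qe_expand e) /aut !(mulrDl, mulrDr) -!scalerAl -!scalerAr.
rewrite mul1r mulr1 -[x * y * l]mulrA lx ly -scalerAr mulrA lx -scalerAl mulrA; lmodule k L.
Qed.

(** The Koszul cocycle condition for x^a y^b times the dual of eps_{i,j}, read off at eps_{i+1,j}
    and eps_{i,j+1}. *)
Definition admissible (c : elt) :=
  [/\ x * (x ^+ c.1.1 * y ^+ c.1.2) =
        ((-1) ^+ c.2.1 * (- q) ^+ c.2.2) *: (x ^+ c.1.1 * y ^+ c.1.2 * x) &
      y * (x ^+ c.1.1 * y ^+ c.1.2) =
        ((- q^-1) ^+ c.2.1 * (-1) ^+ c.2.2) *: (x ^+ c.1.1 * y ^+ c.1.2 * y)].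

Lemma rep_cocycle c : admissible c -> hoch_cocycle (deg c) (rep_elt c).
Proof.
move=> [lx ly]; have [mL mt] := mon_twisted c.2.1 c.2.2.
split=> [s t a u v sz|[|b s] // [sz]]; first by rewrite /rep_elt mL // mulrDr scalerAr.
rewrite hoch_d_ract // /rep_elt ract_mull mt // [b * _]mulrA (twist_comm b lx ly).
by rewrite -!mulrA subrr.
Qed.

Definition monword i j := nseq i false ++ nseq j true.

Lemma coef_x_letter be b : coef_x be (letter x y b) = (~~ b)%:R.
Proof.
rewrite /coef_x; case: b => /=.
  by have [_ -> _ ->] := qe_coords_y e; rewrite mulr0 !scale0r addr0.
by have [_ -> _ ->] := qe_coords_x e; rewrite mulr0 scale0r addr0 scale1r.
Qed.

Lemma coef_y_letter be b : coef_y be (letter x y b) = b%:R.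
Proof.
rewrite /coef_y; case: b => /=.
  by have [_ _ -> ->] := qe_coords_y e; rewrite mulr0 scale0r subr0 scale1r.
by have [_ _ -> ->] := qe_coords_x e; rewrite mulr0 !scale0r subr0.
Qed.

Lemma mon_letters i j w : size w = (i + j)%N ->
  mon i j (map (letter x y) w) = (w == monword i j)%:R.
Proof.
elim: i w => [|i IHi] w.
  rewrite add0n; elim: j w => [|j IHj] w sz; first by rewrite (size0nil sz).
  by case: w sz => // b w [sz]; rewrite mon0S map_cons YopE coef_y_letter IHj //; case: b;
    rewrite ?mul1r ?mul0r.
by case: w => // b w [sz]; rewrite monS map_cons XopE coef_x_letter IHi //; case: b;
  rewrite ?mul1r ?mul0r.
Qed.

(** The word x^i y^j has no inversions, so its weight is 1. *)
Lemma word_sum_monword i j j' (l : L) :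
  word_sum q (i + j) j' (fun w => l * (w == monword i j)%:R) = if j' == j then l else 0.
Proof.
elim: i j' => [|i IHi] j'; last first.
  rewrite addSn word_sum_cons /= -[LHS]/(word_sum q (i + j) j'
    (fun w => l * (w == monword i j)%:R) + _) IHi.
  by case: j' => [|j']; rewrite ?word_sum0 ?scaler0 ?addr0 // => w _; rewrite mulr0.
rewrite add0n; elim: j j' => [|j IHj] j'.
  by rewrite word_sum_nil /= mulr1.
rewrite word_sum_cons word_sum0 => [|w _]; last by rewrite mulr0.
case: j' => [|j']; first by rewrite addr0.
rewrite add0r -[word_sum q j j' _]/(word_sum q j j' (fun w => l * (w == monword 0 j)%:R)) IHj.
by rewrite eqSS; case: eqP => [->|_]; rewrite ?subnn ?scale1r ?scaler0.
Qed.

Lemma iota_rep c i j : (i + j)%N = deg c -> iota_pull q x y (rep_elt c) i j = cochain_of x y c i j.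
Proof.
case: c => [[a b] [i' j']]; rewrite /deg /cochain_of /= => eij.
transitivity (word_sum q (i' + j') j (fun w => x ^+ a * y ^+ b * (w == monword i' j')%:R)).
  by rewrite -eij; apply: eq_word_sum => w sw; rewrite /rep_elt /= mon_letters // sw eij.
rewrite word_sum_monword xpair_eqE; case: eqP => [ej|nj]; last by rewrite andbF.
by move: eij; rewrite ej => /addIn ->; rewrite eqxx.
Qed.

Lemma rep_represents c : admissible c -> represents q x y (deg c) (rep_elt c) (cochain_of x y c).
Proof.
move=> adm; have rC := rep_cocycle adm; split=> // [i j eij|]; last first.
  by apply: (cohomologous_eq e) => i j; exact: iota_rep.
rewrite -(@eq_kos_d _ _ _ _ _ e (iota_pull q x y (rep_elt c))) => [|a b]; last first.
  by rewrite eij => -[]; exact: iota_rep.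
rewrite -(iota_chain (qe_xx e) (qe_yy e) (qe_xy e) rC.1 eij).
by rewrite /iota_pull big_seq_cond big1 // => w /andP[/words_size sw _]; rewrite rC.2 ?scaler0 // size_map sw.
Qed.

End Representatives.

(** * Brackets of the explicit cocycles *)

Section Brackets.
Variables (k : fieldType) (q : k) (L : algType k) (x y : L).
Hypothesis e : quantum_exterior q x y.
Let q_neq0 := qe_neq0 e.
Implicit Types (c d : elt) (w : seq bool) (t : seq (k * elt)).

Local Notation rep := (rep_elt e).
Local Notation mon := (mon e).
Local Notation letters := (map (letter x y)).
Local Notation bracket_is := (bracket_is q x y).
Local Notation admissible := (admissible q x y).
Local Notation comb_of := (comb_of x y).
Local Notation cochain_of := (cochain_of x y).
Local Notation gbr c d := (gbracket (deg c) (deg d) (rep c) (rep d)).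

Lemma bracket_isI c d t : admissible c -> admissible d ->
    kos_cohomologous q x y (deg c + deg d).-1 (iota_pull q x y (gbr c d)) (comb_of t) ->
  bracket_is c d t.
Proof. by move=> cA dA; apply: (HHbracketI e); apply: rep_represents. Qed.

Lemma bracket_isCI c d t t' : admissible c -> admissible d ->
    kos_cohomologous q x y (deg c + deg d).-1 (iota_pull q x y (gbr c d)) (comb_of t) ->
    (forall i j, comb_of t' i j = - (-1) ^+ ((deg c).+1 * (deg d).+1) *: comb_of t i j) ->
  bracket_is d c t'.
Proof. by move=> cA dA; apply: (HHbracketCI e); apply: rep_represents. Qed.

Lemma comb_of0 i j : comb_of [::] i j = 0. Proof. exact: big_nil. Qed.
Lemma comb_of_cons u c t i j : comb_of ((u, c) :: t) i j = u *: cochain_of c i j + comb_of t i j.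
Proof. exact: big_cons. Qed.

Lemma iota_pull_letters (f g : seq L -> L) i j :
  (forall w, size w = (i + j)%N -> f (letters w) = g (letters w)) ->
  iota_pull q x y f i j = iota_pull q x y g i j.
Proof. exact: eq_word_sum. Qed.

Lemma rep_letters c w : size w = deg c ->
  rep c (letters w) = x ^+ c.1.1 * y ^+ c.1.2 * (w == monword c.2.1 c.2.2)%:R.
Proof. by move=> sw; rewrite /rep mon_letters. Qed.

Lemma rep_multilinear c : multilinear (deg c) (rep c).
Proof.
have [mL _] := mon_twisted e c.2.1 c.2.2.
by move=> s t a u v sz; rewrite /rep mL // mulrDr scalerAr.
Qed.

Lemma coef_x1 be : coef_x e be 1 = 0.
Proof. by rewrite /coef_x; have [_ -> _ ->] := qe_coords_1 e; rewrite mulr0 !scale0r addr0. Qed.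

Lemma coef_y1 be : coef_y e be 1 = 0.
Proof. by rewrite /coef_y; have [_ _ -> ->] := qe_coords_1 e; rewrite mulr0 !scale0r subr0. Qed.

Lemma mon_normal i j (s t : seq L) : (size s + size t).+1 = (i + j)%N -> mon i j (s ++ 1 :: t) = 0.
Proof.
elim: i s => [|i IHi] s.
  rewrite add0n; elim: j s => [|j IHj] [|a s] // [sz]; rewrite mon0S [_ ++ _]/= YopE.
    by rewrite coef_y1 mul0r.
  by rewrite IHj ?mulr0.
by case: s => [|a s] [sz]; rewrite monS [_ ++ _]/= XopE ?coef_x1 ?mul0r // IHi ?mulr0.
Qed.

Lemma circ1l n (D f : seq L -> L) (s : seq L) : size s = n -> circ 1 n D f s = D [:: f s].
Proof.
by move=> sz; rewrite /circ big_ord1 muln0 mul1r take0 drop0 add0n take_oversize ?sz // drop_oversize ?sz.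
Qed.

Lemma circ1r n (D f : seq L -> L) (s : seq L) : size s = n ->
  circ n 1 f D s = \sum_(i < n) f (take i s ++ D [:: s`_i] :: drop i.+1 s).
Proof.
move=> sz; rewrite /circ; apply: eq_bigr => i _; have lti := ltn_ord i.
rewrite mulnC exprM sqrr_sign mul1r addn1 (drop_nth 0 (n := i)) ?sz //= take0 //.
Qed.

Lemma gbracket1l n (D f : seq L -> L) (s : seq L) : size s = n ->
  gbracket 1 n D f s = D [:: f s] - \sum_(i < n) f (take i s ++ D [:: s`_i] :: drop i.+1 s).
Proof.
by move=> sz; rewrite /gbracket circ1l // circ1r // [(2 * _)%N]mulnC exprM sqrr_sign mul1r.
Qed.

(* Brackets of positive degree classes with coefficients in k vanish on letters,
   since the inner cochain has scalar values there and the outer one is normalized. *)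
Lemma bracket_eps_eps i j i' j' t : admissible (eps i j) -> admissible (eps i' j') ->
    (0 < i + j)%N -> (0 < i' + j')%N -> (forall a b, comb_of t a b = 0) ->
  bracket_is (eps i j) (eps i' j') t.
Proof.
move=> cA dA; rewrite -/(deg (eps i j)) -/(deg (eps i' j')) => c0 d0 t0.
have circ0 c d w : c.1 = (0, 0)%N -> d.1 = (0, 0)%N -> (0 < deg d)%N ->
    (size w).+1 = (deg c + deg d)%N -> circ (deg c) (deg d) (rep c) (rep d) (letters w) = 0.
  case: c d => [_ [ci cj]] [_ [di dj]] /= -> -> dd sw.
  rewrite /circ big1 // => l _; have ltl := ltn_ord l.
  have sw' : size (take (deg (0, 0, (di, dj))%N) (drop l w)) = deg (0, 0, (di, dj))%N.
    by rewrite size_takel // size_drop; move: sw ltl; lia.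
  rewrite -!map_take -!map_drop -!map_take rep_letters // !mul1r.
  have sz : (size (letters (take l w)) + size (letters (drop (l + deg (0, 0, (di, dj))%N) w))).+1
      = deg (0, 0, (ci, cj))%N.
    by rewrite !size_map size_takel ?size_drop; move: sw ltl; lia.
  case: eqP => _; first by rewrite /rep mon_normal ?mulr0.
  by rewrite (multilinear0 (@rep_multilinear _)) ?mulr0.
apply: bracket_isI => //; apply: (cohomologous_eq e) => a b eab; rewrite t0.
rewrite (@iota_pull_letters _ (fun=> 0)) => [|w sw].
  by rewrite /iota_pull big1 // => w _; rewrite scaler0.
have sw' : (size w).+1 = (deg (eps i j) + deg (eps i' j'))%N.
  by rewrite sw eab prednK // ltn_addr.
by rewrite /gbracket !circ0 ?mulr0 ?subrr // addnC.
Qed.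

Lemma rep_lin1 c u a b : deg c = 1%N -> rep c [:: u *: a + b] = u *: rep c [:: a] + rep c [:: b].
Proof. by move=> c1; have := @rep_multilinear c [::] [::] u a b; rewrite c1; apply. Qed.

Lemma rep_lin1_0 c u a : deg c = 1%N -> rep c [:: u *: a] = u *: rep c [:: a].
Proof.
move=> c1; have r0 : rep c [:: 0] = 0.
  by have := rep_lin1 (-1) 0 0 c1; rewrite scaler0 addr0 scaleN1r addNr.
by rewrite -[u *: a]addr0 rep_lin1 // r0 addr0.
Qed.

(** The derivations x d/dx and y d/dy, with [sd] naming the letter as in [letter]. *)
Definition euler (sd : bool) : elt := if sd then yeps 0 1 else xeps 1 0.
Definition pdeg (sd : bool) (p : nat * nat) : nat := if sd then p.2 else p.1.

Lemma euler_admissible sd : admissible (euler sd).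
Proof.
case: sd; split; rewrite /= ?expr0 ?expr1 ?(mul1r, mulr1).
- by rewrite (qe_yx e) scalerA mulrN mulNr opprK divff // scale1r.
- by rewrite (qe_yy e) scaler0.
- by rewrite (qe_xx e) scaler0.
- by rewrite (qe_yx e).
Qed.

Lemma rep_xeps10 b : rep (xeps 1 0) [:: b] = cox e b *: x + coxy e b *: (x * y).
Proof.
rewrite /rep /= /coef_x !expr0 !expr1 !mulr1 mul1r mulrDr -!scalerAr mulr1.
by [].
Qed.

Lemma rep_yeps01 b : rep (yeps 0 1) [:: b] = coy e b *: y + coxy e b *: (x * y).
Proof.
rewrite /rep /= /coef_y !expr0 !expr1 !mulr1 mul1r mulrBr -!scalerAr mulr1 (qe_yx e).
lmodule k L.
Qed.

Lemma euler_letter sd b :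
  rep (euler sd) [:: letter x y b] = (b == sd)%:R *: letter x y b.
Proof.
have [_ x1 x2 x3] := qe_coords_x e; have [_ y1 y2 y3] := qe_coords_y e.
by case: sd; rewrite ?rep_xeps10 ?rep_yeps01; case: b => /=;
  rewrite ?x1 ?x2 ?x3 ?y1 ?y2 ?y3; lmodule k L.
Qed.

Lemma euler_monomial sd a b : (a <= 1)%N -> (b <= 1)%N ->
  rep (euler sd) [:: x ^+ a * y ^+ b] = (pdeg sd (a, b))%:R *: (x ^+ a * y ^+ b).
Proof.
have [_ x1 x2 x3] := qe_coords_x e; have [_ y1 y2 y3] := qe_coords_y e.
have [_ z1 z2 z3] := qe_coords_xy e; have [_ w1 w2 w3] := qe_coords_1 e.
by case: a b => [|[|//]] [|[|//]] _ _; rewrite ?(expr0, expr1, mul1r, mulr1); case: sd;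
  rewrite ?rep_xeps10 ?rep_yeps01 /pdeg ?x1 ?x2 ?x3 ?y1 ?y2 ?y3 ?z1 ?z2 ?z3 ?w1 ?w2 ?w3 /=;
  lmodule k L.
Qed.

Lemma count_monword sd i j : count_mem sd (monword i j) = pdeg sd (i, j).
Proof. by rewrite count_cat !count_nseq; case: sd; rewrite /= ?mul1n ?mul0n ?addn0. Qed.

Lemma multilinear_scale n (f : seq L -> L) (s t : seq L) u a : multilinear n f ->
  (size s + size t).+1 = n -> f (s ++ u *: a :: t) = u *: f (s ++ a :: t).
Proof. by move=> fL sz; rewrite -[u *: a]addr0 fL // (multilinear0 fL) // addr0. Qed.

Lemma euler_sum n (f : seq L -> L) sd w : multilinear n f -> size w = n ->
  \sum_(i < n) f (take i (letters w) ++ rep (euler sd) [:: (letters w)`_i]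
                    :: drop i.+1 (letters w)) = (count_mem sd w)%:R *: f (letters w).
Proof.
move=> fL sw.
have -> : (count_mem sd w)%:R = \sum_(i < n) (nth false w i == sd)%:R :> k.
  rewrite -sum1_count big_mkcond (big_nth false) big_mkord sw natr_sum.
  by apply: eq_bigr => i _ /=; case: eqP.
rewrite scaler_suml; apply: eq_bigr => i _; have lti : (i < size w)%N by rewrite sw.
rewrite (nth_map false) // euler_letter (multilinear_scale _ _ fL); last first.
  by rewrite size_takel ?size_drop size_map sw; move: lti; rewrite sw; lia.
by rewrite -(nth_map false 0 (letter x y)) // -drop_nth ?size_map // cat_take_drop.
Qed.

(** Applied to the value, the derivation counts its letter in x^a y^b; applied to the arguments, it
    counts the letter in the supporting word. *)
Lemma iota_euler sd c i j : (c.1.1 <= 1)%N -> (c.1.2 <= 1)%N -> (i + j)%N = deg c ->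
  iota_pull q x y (gbr (euler sd) c) i j =
  ((pdeg sd c.1)%:R - (pdeg sd c.2)%:R) *: cochain_of c i j.
Proof.
move=> ca cb eij; have D1 : deg (euler sd) = 1%N by case: (sd).
rewrite -(iota_rep e) // -word_sumZ.
apply: eq_word_sum => w sw; rewrite {}eij in sw.
rewrite /= D1 gbracket1l ?size_map // euler_sum //; last exact: rep_multilinear.
rewrite rep_letters //; case: eqP => [->|_]; last first.
  rewrite mulr0 -(scale0r 0) rep_lin1_0 // scale0r; lmodule k L.
rewrite mulr1 euler_monomial // count_monword; case: c {sw} ca cb => [[? ?] [? ?]] /= _ _.
lmodule k L.
Qed.

Lemma bracket_euler sd c t : admissible c -> (c.1.1 <= 1)%N -> (c.1.2 <= 1)%N ->
    (forall i j, comb_of t i j = ((pdeg sd c.1)%:R - (pdeg sd c.2)%:R) *: cochain_of c i j) ->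
  bracket_is (euler sd) c t.
Proof.
move=> cA ca cb tE; apply: bracket_isI (euler_admissible sd) cA _.
apply: (cohomologous_eq e) => i j eij; rewrite tE -iota_euler // eij.
by case: (sd).
Qed.

Lemma bracket_eulerC sd c t : admissible c -> (c.1.1 <= 1)%N -> (c.1.2 <= 1)%N ->
    (forall i j, comb_of t i j = ((pdeg sd c.2)%:R - (pdeg sd c.1)%:R) *: cochain_of c i j) ->
  bracket_is c (euler sd) t.
Proof.
move=> cA ca cb tE.
apply: (bracket_isCI (t := [:: ((pdeg sd c.1)%:R - (pdeg sd c.2)%:R, c)]) (euler_admissible sd) cA).
  apply: (cohomologous_eq e) => i j eij.
  by rewrite comb_of_cons comb_of0 addr0 -iota_euler // eij; case: (sd).
move=> i j; rewrite tE comb_of_cons comb_of0 (_ : deg (euler sd) = 1%N); last by case: (sd).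
by rewrite sign_if oddM /=; lmodule k L.
Qed.

End Brackets.

(** * Brackets with the socle element xy *)

Section SocleBrackets.
Variables (k : fieldType) (q : k) (L : algType k) (x y : L).
Hypothesis e : quantum_exterior q x y.
Let q_neq0 := qe_neq0 e.
Implicit Types (c d : elt) (w : seq bool) (t : seq (k * elt)).

Local Notation rep := (rep_elt e).
Local Notation mon := (mon e).
Local Notation letters := (map (letter x y)).
Local Notation bracket_is := (bracket_is q x y).
Local Notation admissible := (admissible q x y).
Local Notation comb_of := (comb_of x y).
Local Notation cochain_of := (cochain_of x y).
Local Notation gbr c d := (gbracket (deg c) (deg d) (rep c) (rep d)).

Lemma coef_xxy be : coef_x e be (x * y) = be *: y.
Proof.
by rewrite /coef_x; have [_ -> _ ->] := qe_coords_xy e; rewrite scale0r add0r mulr1.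
Qed.

Lemma coef_yxy al : coef_y e al (x * y) = (- (q * al)) *: x.
Proof.
by rewrite /coef_y; have [_ _ -> ->] := qe_coords_xy e; rewrite scale0r sub0r mulr1 scaleNr.
Qed.

(** Shape of the value of [mon i j] on i + j - 1 letters, s of them y, and one argument xy. If no y
    is missing, xy stands in for an x and contributes a multiple of y; if one is missing, it
    contributes a multiple of x. The scalars are left open, to be constrained by the cocycle
    condition. *)
Definition one_less j s : L := if s == j then y else if s.+1 == j then x else 0.

Lemma mon_xy i j u v : (size u + size v).+1 = (i + j)%N ->
  exists a, mon i j (letters u ++ x * y :: letters v) =
            a *: one_less j (count_mem true u + count_mem true v)%N.
Proof.
elim: i u => [|i IHi] u.
  rewrite add0n; elim: j u => [|j IHj] [|b u] // [sz]; rewrite mon0S.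
    rewrite cat0s YopE coef_yxy mon_letters //; case: eqP => [->|_]; last first.
      by exists 0; rewrite mulr0 scale0r.
    exists (- (q * (- q) ^+ j)); rewrite mulr1 /one_less count_monword /= add0n.
    by rewrite eqn_leq ltnn andbF eqxx.
  rewrite map_cons cat_cons YopE coef_y_letter; case: b; last first.
    by exists 0; rewrite mulr0n mul0r scale0r.
  by have [a ->] := IHj u sz; exists a; rewrite mulr1n mul1r /one_less [count_mem _ (_ :: u)]/= add1n addSn !eqSS.
case: u => [|b u] [sz]; rewrite monS.
  rewrite cat0s XopE coef_xxy mon_letters //; case: eqP => [->|_]; last first.
    by exists 0; rewrite mulr0 scale0r.
  by eexists; rewrite mulr1 /one_less count_monword /= add0n eqxx.
rewrite map_cons cat_cons XopE coef_x_letter; case: b; first by exists 0; rewrite mulr0n mul0r scale0r.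
by have [a ->] := IHi u sz; exists a; rewrite mulr1n mul1r.
Qed.

Lemma gbracket0l n (l f : seq L -> L) (s : seq L) :
  gbracket 0 n l f s =
  - ((-1) ^+ n.+1 *: \sum_(i < n) (-1) ^+ i *: f (take i s ++ l [::] :: drop i s)).
Proof.
rewrite /gbracket {1}/circ big_ord0 sub0r mul1n sign_scale; congr (- (_ *: _)).
by apply: eq_bigr => i _; rewrite mul1n sign_scale take0 addn0.
Qed.

Lemma iota_xy i j a b : (a + b).+1 = (i + j)%N ->
  exists u, iota_pull q x y (gbr xy0 (eps i j)) a b = u *: one_less j b.
Proof.
move=> eab; rewrite /iota_pull big_seq_cond; elim/big_ind: _ => [|? ? [u ->] [v ->]|w].
- by exists 0; rewrite scale0r.
- by exists (u + v); rewrite scalerDl.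
move=> /andP[/words_size sw /eqP cw]; rewrite gbracket0l.
suff [u ->] : exists u, \sum_(l < deg (eps i j)) (-1) ^+ l *: rep (eps i j)
    (take l (letters w) ++ rep xy0 [::] :: drop l (letters w)) = u *: one_less j b.
  by exists (- (q ^+ Defs.inv w * ((-1) ^+ (deg (eps i j)).+1 * u))); lmodule k L.
elim/big_ind: _ => [|? ? [u ->] [v ->]|l _].
- by exists 0; rewrite scale0r.
- by exists (u + v); rewrite scalerDl.
have ltl := ltn_ord l; rewrite {2}/deg /= in ltl.
have [|u E] := @mon_xy i j (take l w) (drop l w).
  by rewrite -size_cat cat_take_drop sw.
exists ((-1) ^+ l * u); rewrite /rep /= !expr0 !expr1 !mul1r mulr1 -map_take -map_drop.
by rewrite E scalerA -count_cat cat_take_drop cw.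
Qed.

Lemma kos_cocycle_gbr c d i j : admissible c -> admissible d ->
  (i + j)%N = (deg c + deg d).-1.+1 -> kos_d q x y (iota_pull q x y (gbr c d)) i j = 0.
Proof.
move=> /rep_cocycle cC /rep_cocycle dC eij; have [bL bd] := gbracket_cocycle (cC e) (dC e).
rewrite -(iota_chain (qe_xx e) (qe_yy e) (qe_xy e) bL eij) /iota_pull big_seq_cond big1 //.
by move=> w /andP[/words_size sw _]; rewrite bd ?scaler0 // size_map sw.
Qed.

Lemma xy_scale_eq0 u : u *: (x * y) = 0 -> u = 0.
Proof.
move=> u0; have [_ _ _ z] := qe_coords_xy e; have [_ _ _] := qe_coords_lin e u (x * y) 0.
have [_ _ _] := qe_coords_lin e (-1) 0 0; rewrite scaler0 addr0 mulN1r addNr => ->.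
by rewrite !addr0 u0 z mulr1 => <-; have [_ _ _] := qe_coords_lin e (-1) 0 0;
  rewrite scaler0 addr0 mulN1r addNr.
Qed.

Lemma xy_admissible : admissible xy0.
Proof.
by split; rewrite /= !expr0 !expr1 !mul1r scale1r ?(qe_xxy e) ?(qe_xyx e) ?(qe_yxy e) ?(qe_xyy e).
Qed.

Lemma kos_d_S0 (phi : nat -> nat -> L) i :
  kos_d q x y phi i.+1 0 = x * phi i 0%N + (-1) ^+ i.+1 *: (phi i 0%N * x).
Proof. by rewrite /kos_d addn0 expr0 scale1r addr0 sign_scale. Qed.

Lemma kos_d_0S (phi : nat -> nat -> L) j :
  kos_d q x y phi 0 j.+1 = y * phi 0%N j + (-1) ^+ j.+1 *: (phi 0%N j * y).
Proof. by rewrite /kos_d add0n expr0 scale1r add0r sign_scale. Qed.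

Lemma kos_d_SS (phi : nat -> nat -> L) i j :
  kos_d q x y phi i.+1 j.+1 = x * phi i j.+1 + ((-1) ^+ (i + j) * q ^+ j.+1) *: (phi i j.+1 * x)
    + q ^+ i.+1 *: (y * phi i.+1 j) + (-1) ^+ (i + j) *: (phi i.+1 j * y).
Proof.
rewrite /kos_d addSn addnS !sign_scale -addrA !scalerA.
have -> : (-1) ^+ (i + j).+2 = (-1) ^+ (i + j) :> k by rewrite !exprS !mulN1r opprK.
by rewrite -!addrA.
Qed.

(** At most one value is nonzero, u y at eps_{n,0} or u x at eps_{0,n}, and the cocycle condition
    reads u (1 - q^-1) xy = 0. *)
Lemma xy_pure_eps (n : nat) i j : q != 1 -> (-1) ^+ n.+1 = 1 :> k ->
    (i, j) \in [:: (n.+1, 0); (0, n.+1)]%N -> admissible (eps i j) ->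
  forall a b, (a + b)%N = n -> iota_pull q x y (gbr xy0 (eps i j)) a b = 0.
Proof.
move=> q1 sgn ij adm; have cocy := kos_cocycle_gbr xy_admissible adm.
have q1' : 1 - q^-1 != 0 by rewrite subr_eq0 eq_sym invr_eq1.
have d1 : deg (eps i j) = n.+1.
  by rewrite /deg /=; case/or3P: ij => // /eqP[-> ->]; rewrite ?addn0 ?add0n.
have shape a b : (a + b)%N = n ->
    exists u, iota_pull q x y (gbr xy0 (eps i j)) a b = u *: one_less j b.
  by move=> eab; apply: iota_xy; rewrite eab; exact: esym d1.
move: cocy shape; set phi := iota_pull _ _ _ _; rewrite d1 add0n /= => cocy shape.
have fin u : u * (1 - q^-1) = 0 -> u = 0.
  by move/eqP; rewrite mulf_eq0 (negbTE q1') orbF => /eqP.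
case/or3P: ij => // /eqP[ei ej] a b eab.
- have [u E] := shape a b eab; rewrite E /one_less ej.
  case: b eab E => [|b] eab E; last by rewrite scaler0.
  have an : a = n by rewrite -eab addn0.
  have := cocy n.+1 0%N (addn0 _); rewrite kos_d_S0 sgn scale1r -an E /one_less ej /=.
  rewrite -scalerAr -scalerAl (qe_yx e) => C.
  by rewrite (fin u) ?scale0r //; apply/xy_scale_eq0; rewrite -[RHS]C; lmodule k L.
have [u E] := shape a b eab; rewrite E /one_less ej.
have [bn|bn] := eqVneq b n; last first.
  rewrite (negbTE bn : (b.+1 == n.+1) = false) (_ : (b == n.+1) = false) ?scaler0 //.
  by apply/eqP; move: eab; lia.
have a0 : a = 0%N by move: eab bn; lia.
have := cocy 0%N n.+1 (add0n _); rewrite kos_d_0S sgn scale1r -bn -a0 E /one_less ej bn.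
rewrite (ltn_eqF (ltnSn n)) eqxx -scalerAr -scalerAl (qe_yx e) => C.
by rewrite (fin u) ?scale0r //; apply/xy_scale_eq0; rewrite -[RHS]C; lmodule k L.
Qed.

Lemma bracket_xy_pure_eps (n : nat) i j t : q != 1 -> (0 < n)%N -> (-1) ^+ n = 1 :> k ->
    (i, j) \in [:: (n, 0); (0, n)]%N -> admissible (eps i j) ->
    (forall a b, comb_of t a b = 0) ->
  bracket_is xy0 (eps i j) t /\ bracket_is (eps i j) xy0 t.
Proof.
case: n => // n q1 _ sgn ij adm t0.
have d1 : (deg xy0 + deg (eps i j)).-1 = n.
  by rewrite add0n /deg /=; case/or3P: ij => // /eqP[-> ->]; rewrite ?addn0 ?add0n.
have coh : kos_cohomologous q x y (deg xy0 + deg (eps i j)).-1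
    (iota_pull q x y (gbr xy0 (eps i j))) (comb_of t).
  apply: (cohomologous_eq e) => a b; rewrite d1 t0.
  exact: xy_pure_eps q1 sgn ij adm a b.
split; first exact: bracket_isI xy_admissible adm coh.
by apply: bracket_isCI xy_admissible adm coh _ => a b; rewrite !t0 scaler0.
Qed.

Lemma bracket_xy_mixed_eps (r : nat) t : q != 1 -> (0 < r)%N -> q ^+ r = 1 ->
    admissible (eps r r) -> (forall a b, comb_of t a b = 0) ->
  bracket_is xy0 (eps r r) t /\ bracket_is (eps r r) xy0 t.
Proof.
case: r => // r q1 _ qr adm t0.
have q1' : 1 - q^-1 != 0 by rewrite subr_eq0 eq_sym invr_eq1.
have cocy := kos_cocycle_gbr xy_admissible adm.
have dE : (deg xy0 + deg (eps r.+1 r.+1)).-1 = (r + r.+1)%N by [].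
have [u U] : exists u, iota_pull q x y (gbr xy0 (eps r.+1 r.+1)) r r.+1 = u *: y.
  by have [u] := @iota_xy r.+1 r.+1 r r.+1 erefl; rewrite /one_less eqxx; exists u.
have [v V] : exists v, iota_pull q x y (gbr xy0 (eps r.+1 r.+1)) r.+1 r = v *: x.
  have [|v] := @iota_xy r.+1 r.+1 r.+1 r; first by rewrite addnS.
  by rewrite /one_less eqxx (ltn_eqF (ltnSn r)); exists v.
have uv : u + v = 0.
  have := cocy r.+1 r.+1; rewrite dE addSn => /(_ erefl); rewrite kos_d_SS U V.
  rewrite addnn -mul2n exprM sqrrN !expr1n mul1r qr !scale1r.
  rewrite -!scalerAr -!scalerAl (qe_yx e) => C.
  have : (u + v) * (1 - q^-1) = 0 by apply/xy_scale_eq0; rewrite -[RHS]C; lmodule k L.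
  by move/eqP; rewrite mulf_eq0 (negbTE q1') orbF => /eqP.
have qr' : q ^+ r = q^-1 by apply: (mulfI q_neq0); rewrite -exprS qr divff.
have coh : kos_cohomologous q x y (deg xy0 + deg (eps r.+1 r.+1)).-1
    (iota_pull q x y (gbr xy0 (eps r.+1 r.+1))) (comb_of t).
  (* Here q^r = q^-1, so the dual of eps_{r,r} has differential (1 - q^-1) x at eps_{r+1,r} and the
     opposite multiple of y at eps_{r,r+1}. This matches the values v x and u y, as u = -v. *)
  pose th i j : L := if (i == r) && (j == r) then (v / (1 - q^-1)) *: 1 else 0.
  have thr : th r r = (v / (1 - q^-1)) *: 1 by rewrite /th eqxx.
  have th0 i j : (i + j)%N = r.*2 -> i != r -> th i j = 0.
    by rewrite /th => _ /negbTE ->.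
  exists th => i j; rewrite dE t0 subr0 => eij; rewrite (kos_dE e) /kd /=.
  have sgn : (-1) ^+ (i + j) = - 1 :> k by rewrite eij addnS exprS addnn -mul2n exprM sqrrN !expr1n mulr1.
  have vE : v = v / (1 - q^-1) * (1 - q^-1) by rewrite divfK.
  have [ei|ni] := eqVneq i r.
    have ej : j = r.+1 by move: eij; rewrite ei => /addnI.
    rewrite ei ej in sgn *; rewrite sgn U /= thr.
    have -> : previ (M := reg_bimod e) th r r.+1 = 0 by case: (r) th0 => //= r' th0; apply: th0; lia.
    rewrite !mulr0 !mul0r qr' -scalerAr -scalerAl mulr1 mul1r.
    have -> : u = - v by apply/eqP; rewrite -addr_eq0 uv.
    by rewrite {1}vE; lmodule k L.
  have [ej|nj] := eqVneq j r.
    have ei : i = r.+1 by move: eij; rewrite ej addnC => /addnI.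
    rewrite ei ej in sgn *; rewrite sgn V /= thr.
    have -> : prevj (M := reg_bimod e) th r.+1 r = 0 by case: (r) th0 => //= r' th0; apply: th0; lia.
    rewrite !mulr0 !mul0r qr' -scalerAr -scalerAl mulr1 mul1r.
    by rewrite {1}vE; lmodule k L.
  have -> : previ (M := reg_bimod e) th i j = 0.
    by case: i eij ni {sgn} => //= i eij ni; rewrite /th (negbTE nj) andbF.
  have -> : prevj (M := reg_bimod e) th i j = 0.
    by case: j eij nj {sgn} => //= j eij nj; rewrite /th (negbTE ni).
  rewrite !mulr0 !mul0r !scaler0 !addr0.
  have [|w ->] := @iota_xy r.+1 r.+1 i j; first by rewrite eij.
  rewrite /one_less eqSS (negbTE nj) (_ : (j == r.+1) = false) ?scaler0 //.
  by apply/eqP => ej; case/eqP: ni; move: eij; rewrite ej; lia.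
split; first exact: bracket_isI xy_admissible adm coh.
by apply: bracket_isCI xy_admissible adm coh _ => a b; rewrite !t0 scaler0.
Qed.

End SocleBrackets.

(** * Brackets computed on words of length at most two *)

Section LowDegree.
Variables (k : fieldType) (q : k) (L : algType k) (x y : L).
Hypothesis e : quantum_exterior q x y.
Implicit Types (c d : elt) (w : seq bool) (t : seq (k * elt)).

Local Notation rep := (rep_elt e).
Local Notation mon := (mon e).
Local Notation letters := (map (letter x y)).
Local Notation bracket_is := (bracket_is q x y).
Local Notation admissible := (admissible q x y).
Local Notation comb_of := (comb_of x y).
Local Notation cochain_of := (cochain_of x y).
Local Notation gbr c d := (gbracket (deg c) (deg d) (rep c) (rep d)).
Local Notation iota_pull := (iota_pull q x y).

Lemma euler_zero sd c : admissible c -> (c.1.1 <= 1)%N -> (c.1.2 <= 1)%N ->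
  pdeg sd c.1 = pdeg sd c.2 -> bracket_is (euler sd) c [::] /\ bracket_is c (euler sd) [::].
Proof.
move=> cA ca cb pr; split; [apply: (bracket_euler e) | apply: (bracket_eulerC e)] => // i j;
by rewrite comb_of0 pr subrr scale0r.
Qed.

Lemma euler_value sd c u : admissible c -> (c.1.1 <= 1)%N -> (c.1.2 <= 1)%N ->
  u = (pdeg sd c.1)%:R - (pdeg sd c.2)%:R -> bracket_is (euler sd) c [:: (u, c)].
Proof.
move=> cA ca cb ->; apply: (bracket_euler e) => // i j.
by rewrite comb_of_cons comb_of0 addr0.
Qed.

Lemma euler_valueC sd c u : admissible c -> (c.1.1 <= 1)%N -> (c.1.2 <= 1)%N ->
  u = (pdeg sd c.2)%:R - (pdeg sd c.1)%:R -> bracket_is c (euler sd) [:: (u, c)].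
Proof.
move=> cA ca cb ->; apply: (bracket_eulerC e) => // i j.
by rewrite comb_of_cons comb_of0 addr0.
Qed.

Lemma bracket_exact c d t : admissible c -> admissible d ->
    (forall i j, (i + j)%N = (deg c + deg d).-1 -> iota_pull (gbr c d) i j = comb_of t i j) ->
  bracket_is c d t.
Proof. by move=> cA dA E; apply: (bracket_isI (e := e)) => //; apply: (cohomologous_eq e). Qed.

Lemma bracket_zero c d : admissible c -> admissible d ->
    (forall i j, (i + j)%N = (deg c + deg d).-1 -> iota_pull (gbr c d) i j = 0) ->
  bracket_is c d [::] /\ bracket_is d c [::].
Proof.
move=> cA dA E; have coh : kos_cohomologous q x y (deg c + deg d).-1
    (iota_pull (gbr c d)) (comb_of [::]).
  by apply: (cohomologous_eq e) => i j /E ->; rewrite comb_of0.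
split; first exact: bracket_isI cA dA coh.
by apply: bracket_isCI cA dA coh _ => i j; rewrite !comb_of0 scaler0.
Qed.

Lemma iota_pull0 i j : iota_pull (fun=> 0) i j = 0.
Proof. by rewrite /Defs.iota_pull big1 // => w _; rewrite scaler0. Qed.

Lemma bracket_deg0 c d : admissible c -> admissible d -> deg c = 0%N -> deg d = 0%N ->
  bracket_is c d [::].
Proof.
move=> cA dA c0 d0; apply: bracket_exact => // i j _; rewrite comb_of0 c0 d0.
rewrite -(iota_pull0 i j); apply: eq_iota_pull => s _.
by rewrite /gbracket /circ !big_ord0 mulr0 subr0.
Qed.

Lemma iota_pull1 (f : seq L -> L) i j : (i + j)%N = 1%N -> iota_pull f i j = f [:: if i is 0 then y else x].
Proof.
by case: i j => [|[|i]] [|[|j]] // _; rewrite /Defs.iota_pull big_mkcond /= !big_cons big_nil /=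
  ?add0r ?addr0 scale1r.
Qed.

Lemma iota_pull2 (f : seq L -> L) i j : (i + j)%N = 2%N ->
  iota_pull f i j = match i with 0 => f [:: y; y] | 1 => f [:: x; y] + q *: f [:: y; x]
                               | _ => f [:: x; x] end.
Proof.
by case: i j => [|[|[|i]]] [|[|[|j]]] // _; rewrite /Defs.iota_pull big_mkcond /= !big_cons big_nil /=
  ?add0r ?addr0 ?scale1r.
Qed.

Lemma gbracket01 (l f : seq L -> L) : gbracket 0 1 l f [::] = - f [:: l [::]].
Proof. by rewrite gbracket0l big_ord1 /= expr0 !scale1r sqrrN expr1n scale1r. Qed.

Lemma gbracket02 (l f : seq L -> L) a : gbracket 0 2 l f [:: a] = f [:: l [::]; a] - f [:: a; l [::]].
Proof.
by rewrite gbracket0l big_ord_recl big_ord1 /= /bump /= !exprS expr0; lmodule k L.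
Qed.

Lemma gbracket11 (f g : seq L -> L) a : gbracket 1 1 f g [:: a] = f [:: g [:: a]] - g [:: f [:: a]].
Proof. by rewrite gbracket1l // big_ord1. Qed.

Lemma gbracket12 (f g : seq L -> L) a b :
  gbracket 1 2 f g [:: a; b] = f [:: g [:: a; b]] - g [:: f [:: a]; b] - g [:: a; f [:: b]].
Proof. by rewrite gbracket1l // big_ord_recl big_ord1 /= opprD addrA. Qed.

Lemma eps_admissible i j : (-1) ^+ i * (- q) ^+ j = 1 -> (- q^-1) ^+ i * (-1) ^+ j = 1 ->
  admissible (eps i j).
Proof. by move=> e1 e2; split; rewrite /= ?e1 ?e2 !expr0 !mul1r !mulr1 scale1r. Qed.

Definition letter0 (b : bool) : elt := if b then y0 else x0.

Lemma letter0_admissible b : q = -1 -> admissible (letter0 b).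
Proof.
move=> q1; have yx : y * x = x * y by rewrite (qe_yx e) q1 invrN1 opprK scale1r.
by case: b; split; rewrite /= !expr0 !expr1 ?(mul1r, mulr1) ?scale1r ?yx.
Qed.

Lemma rep_letter0 b : rep (letter0 b) [::] = letter x y b.
Proof. by case: b; rewrite /rep_elt /= !expr0 !expr1 ?(mul1r, mulr1). Qed.

Lemma rep_eps i j s : rep (eps i j) s = mon i j s.
Proof. by rewrite /rep_elt /= !expr0 !mul1r. Qed.

Lemma letter0_eps1 b i j : (i + j)%N = 1%N ->
  iota_pull (gbr (letter0 b) (eps i j)) 0 0 = - ([:: b] == monword i j)%:R.
Proof.
move=> eij; rewrite iota_pull00 (_ : deg (letter0 b) = 0%N); last by case: (b).
rewrite (_ : deg (eps i j) = 1%N) // gbracket01 rep_letter0 rep_eps.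
by rewrite -[[:: letter x y b]]/(letters [:: b]) mon_letters ?eij.
Qed.

(** On letters the bracket is the difference of the two orders of arguments of a cochain supported
    on a doubled letter, hence symmetric. *)
Lemma letter0_eps2 b sd : q = -1 ->
  let c := if sd then eps 0 2 else eps 2 0 in
  admissible c -> bracket_is (letter0 b) c [::] /\ bracket_is c (letter0 b) [::].
Proof.
move=> q1 c cA; apply: bracket_zero => // [|i j].
  exact: letter0_admissible.
have b0 : deg (letter0 b) = 0%N by case: (b).
have c2 : deg c = 2%N by rewrite /c; case: (sd).
rewrite b0 c2 => /= eij; rewrite iota_pull1 // gbracket02 rep_letter0.
have -> : (if i is 0 then y else x) = letter x y (i == 0%N) by case: (i).
rewrite /c; case: sd {c cA c2}; rewrite !rep_eps;
  rewrite -[[:: _; _]]/(letters [:: b; i == 0%N]) -[X in _ - mon _ _ X]/(letters [:: i == 0%N; b]);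
  by rewrite !mon_letters //; case: b {b0}; case: (i == 0%N); rewrite /= subrr.
Qed.

(** For q = 1 the derivations y d/dx and x d/dy; [sd] names the letter that is replaced. *)
Definition partial (sd : bool) : elt := if sd then xeps 0 1 else yeps 1 0.

Lemma rep_partial sd b :
  rep (partial sd) [:: b] = (if sd then coy e b else cox e b) *: letter x y (~~ sd).
Proof.
case: sd; rewrite /rep_elt /= ?(expr0, expr1, mul1r, mulr1).
  by rewrite /coef_y mulrBr -!scalerAr mulr1 (qe_xx e) scaler0 subr0.
by rewrite /coef_x mulrDr -!scalerAr mulr1 (qe_yy e) scaler0 addr0.
Qed.

Lemma rep_partial_letter sd b :
  rep (partial sd) [:: letter x y b] = (b == sd)%:R *: letter x y (~~ sd).
Proof.
have [_ x1 x2 _] := qe_coords_x e; have [_ y1 y2 _] := qe_coords_y e.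
by rewrite rep_partial; case: sd; case: b; rewrite /= ?x1 ?x2 ?y1 ?y2.
Qed.

Lemma rep_partial_scalar sd u : rep (partial sd) [:: u *: 1] = 0.
Proof.
have [_ x1 x2 _] := qe_coords_1 e; rewrite rep_lin1_0; last by case: (sd).
by rewrite rep_partial; case: sd; rewrite ?x1 ?x2 scale0r scaler0.
Qed.

Lemma partial_admissible sd : q = 1 -> admissible (partial sd).
Proof.
move=> q1; have yx : y * x = - (x * y) by rewrite (qe_yx e) q1 invr1 scaleN1r.
case: sd; split; rewrite /= ?(expr0, expr1, mul1r, mulr1) ?(qe_xx e) ?(qe_yy e) ?scaler0 //.
  by rewrite yx scaleN1r.
by rewrite yx scaleN1r opprK.
Qed.

Lemma partial_xy sd : q = 1 ->
  bracket_is xy0 (partial sd) [::] /\ bracket_is (partial sd) xy0 [::].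
Proof.
move=> q1; apply: bracket_zero (xy_admissible e) (partial_admissible sd q1) _ => i j.
have [_ z1 z2 _] := qe_coords_xy e.
rewrite (_ : deg (partial sd) = 1%N); last by case: (sd).
case: i j => [|//] [|//] _; rewrite iota_pull00 gbracket01 /rep_elt /= !expr1 !mulr1.
by rewrite -/(rep (partial sd) _) rep_partial; case: sd; rewrite ?z1 ?z2 scale0r oppr0.
Qed.

Lemma partial_self sd : q = 1 -> bracket_is (partial sd) (partial sd) [::].
Proof.
move=> q1; have D1 : deg (partial sd) = 1%N by case: (sd).
apply: bracket_exact; try exact: partial_admissible; move=> i j; rewrite comb_of0 D1 => eij.
by rewrite iota_pull1 // gbracket11 subrr.
Qed.

Lemma partial_partial : q = 1 ->
  bracket_is (yeps 1 0) (xeps 0 1) [:: (1, yeps 0 1); (- 1, xeps 1 0)].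
Proof.
move=> q1; apply: bracket_exact.
- exact: (partial_admissible false q1).
- exact: (partial_admissible true q1).
move=> i j eij; rewrite iota_pull1 // !comb_of_cons comb_of0 gbracket11.
have -> : (if i is 0 then y else x) = letter x y (i == 0%N) by case: (i).
rewrite -[yeps 1 0]/(partial false) -[xeps 0 1]/(partial true) !rep_partial_letter.
rewrite !rep_lin1_0 // (rep_partial_letter false false) (rep_partial_letter true true).
rewrite /Defs.cochain_of /= !(expr0, expr1, mul1r, mulr1).
by case: i j eij => [|[|//]] [|[|//]] // _; rewrite /=; lmodule k L.
Qed.

Lemma partial_eps sd i j a b : (i + j)%N = 2%N -> 
  gbracket 1 2 (rep (partial sd)) (rep (eps i j)) [:: letter x y a; letter x y b] =
  (- ((a == sd) && ([:: ~~ sd; b] == monword i j))%:R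
   - ((b == sd) && ([:: a; ~~ sd] == monword i j))%:R) *: 1.
Proof.
move=> eij; rewrite gbracket12 !rep_partial_letter.
have fE a' b' : rep (eps i j) [:: letter x y a'; letter x y b'] = ([:: a'; b'] == monword i j)%:R *: 1.
  rewrite rep_eps -[[:: letter x y _; _]]/(letters [:: a'; b']) mon_letters ?eij //.
  by rewrite scaler_nat.
have fL : multilinear 2 (rep (eps i j)) by rewrite -eij; exact: (@rep_multilinear _ _ _ _ _ e (eps i j)).
rewrite fE rep_partial_scalar.
rewrite (multilinear_scale (s := [::]) (t := [:: letter x y b]) _ _ fL) //=.
rewrite (multilinear_scale (s := [:: letter x y a]) (t := [::]) _ _ fL) //= !fE.
by case: (a == sd); case: (b == sd); rewrite /=; lmodule k L.
Qed.

Definition partial_coef (sd : bool) i j a b : k :=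
  - ((a == sd) && ([:: ~~ sd; b] == monword i j))%:R
  - ((b == sd) && ([:: a; ~~ sd] == monword i j))%:R.

(** The entry at eps_{1,1} collects the words xy and yx, which have equal weight for q = 1. *)
Lemma bracket_partial_eps sd i j t : q = 1 -> (i + j)%N = 2%N -> admissible (eps i j) ->
    let F := partial_coef sd i j in
    comb_of t 0 2 = F true true *: 1 ->
    comb_of t 1 1 = (F false true + F true false) *: 1 ->
    comb_of t 2 0 = F false false *: 1 ->
  bracket_is (partial sd) (eps i j) t.
Proof.
move=> q1 eij adm F t02 t11 t20; apply: bracket_exact => // [|a b]; first exact: partial_admissible.
have D1 : deg (partial sd) = 1%N by case: (sd).
have FE := partial_eps sd _ _ eij.
have Q (u : L) : q *: u = u by rewrite q1 scale1r.
rewrite D1 (_ : deg (eps i j) = 2%N) // => eab; rewrite iota_pull2 //.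
case: a b eab => [|[|[|//]]] [|[|[|//]]] // _; rewrite ?t02 ?t11 ?t20 ?Q.
- exact: FE true true.
- by rewrite (FE false true) (FE true false) /F /partial_coef; lmodule k L.
- exact: FE false false.
Qed.

Lemma comb_of_eps u i j a b : comb_of [:: (u, eps i j)] a b = (u * ((a, b) == (i, j))%:R) *: 1.
Proof.
rewrite comb_of_cons comb_of0 addr0 /Defs.cochain_of /= !expr0 mul1r.
by case: ((a, b) == _); rewrite ?mulr1 ?mulr0 ?scaler0 ?scale0r.
Qed.

Lemma partial_eps_table : q = 1 -> (forall i j, (i + j)%N = 2%N -> admissible (eps i j)) ->
  [/\ bracket_is (yeps 1 0) (eps 1 1) [:: (- 1, eps 2 0)],
      bracket_is (yeps 1 0) (eps 0 2) [:: (- 2%:R, eps 1 1)],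
      bracket_is (xeps 0 1) (eps 2 0) [:: (- 2%:R, eps 1 1)] &
      bracket_is (xeps 0 1) (eps 1 1) [:: (- 1, eps 0 2)]].
Proof.
move=> q1 adm; rewrite -[yeps 1 0]/(partial false) -[xeps 0 1]/(partial true).
by split; apply: bracket_partial_eps => //; try exact: adm;
  rewrite comb_of_eps /partial_coef /=; lmodule k L.
Qed.

Lemma partial_eps_zero : q = 1 -> (forall i j, (i + j)%N = 2%N -> admissible (eps i j)) ->
  [/\ bracket_is (yeps 1 0) (eps 2 0) [::], bracket_is (eps 2 0) (yeps 1 0) [::],
      bracket_is (xeps 0 1) (eps 0 2) [::] & bracket_is (eps 0 2) (xeps 0 1) [::]].
Proof.
move=> q1 adm.
have Z sd i j : (i + j)%N = 2%N -> (i, j) = (if sd then (0, 2) else (2, 0))%N ->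
    bracket_is (partial sd) (eps i j) [::] /\ bracket_is (eps i j) (partial sd) [::].
  move=> eij E; apply: bracket_zero (partial_admissible sd q1) (adm _ _ eij) _ => a b.
  have D1 : deg (partial sd) = 1%N by case: (sd).
  have FE := partial_eps sd _ _ eij.
  rewrite D1 (_ : deg (eps i j) = 2%N) // => eab; rewrite iota_pull2 //.
  case: a b eab => [|[|[|//]]] [|[|[|//]]] // _;
    rewrite ?(FE true true) ?(FE false true) ?(FE true false) ?(FE false false);
    by case: sd E {D1 FE} => -[-> ->] /=; rewrite ?subr0 ?oppr0 ?scale0r ?scaler0 ?addr0.
by have [? ?] := Z false 2%N 0%N erefl erefl; have [? ?] := Z true 0%N 2%N erefl erefl.
Qed.

Lemma xy_eps_table : q = 1 -> (forall i j, (i + j)%N = 2%N -> admissible (eps i j)) ->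
  [/\ bracket_is xy0 (eps 2 0) [:: (- 2%:R, yeps 1 0)],
      bracket_is xy0 (eps 1 1) [:: (- 1, yeps 0 1); (1, xeps 1 0)] &
      bracket_is xy0 (eps 0 2) [:: (2%:R, xeps 0 1)]].
Proof.
move=> q1 adm; have xyA := xy_admissible e.
have cx b : coef_x e b x = 1 by exact: (coef_x_letter e b false).
have cy b : coef_x e b y = 0 by exact: (coef_x_letter e b true).
have dx b : coef_y e b x = 0 by exact: (coef_y_letter e b false).
have dy b : coef_y e b y = 1 by exact: (coef_y_letter e b true).
have xyE : rep xy0 [::] = x * y by rewrite /rep_elt /= !expr1 mulr1.
by split; apply: bracket_exact => //; try exact: adm; move=> i j eij;
  rewrite iota_pull1 // gbracket02 xyE !rep_eps !comb_of_cons comb_of0 /Defs.cochain_of;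
  case: i j eij => [|[|//]] [|[|//]] // _;
  rewrite /= ?(coef_xxy e) ?(coef_yxy e) ?cx ?cy ?dx ?dy
    ?(expr0, expr1, mul0r, mul1r, mulr1, mulr0) ?q1 ?invr1 -?scalerAl ?(mul1r, mulr1); lmodule k L.
Qed.

End LowDegree.

(** * Assembly of the bracket tables *)

Section BracketTables.
Variables (k : fieldType) (q : k) (L : algType k) (x y : L).
Hypothesis e : quantum_exterior q x y.

Local Notation bracket_is := (bracket_is q x y).
Local Notation admissible := (admissible q x y).
Local Notation bracket_table := (bracket_table q x y).

Lemma eps_admissible_root i j : (-1) ^+ (i + j) = 1 :> k -> q ^+ i = 1 -> q ^+ j = 1 ->
  admissible (eps i j).
Proof.
move=> sgn qi qj; apply: (eps_admissible).
  by rewrite [(- q) ^+ j]exprNn mulrA -exprD sgn qj mulr1.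
by rewrite [(- q^-1) ^+ i]exprNn mulrAC -exprD sgn exprVn qi invr1 mulr1.
Qed.

Lemma xeps10_admissible : admissible (xeps 1 0). Proof. exact: euler_admissible e false. Qed.
Lemma yeps01_admissible : admissible (yeps 0 1). Proof. exact: euler_admissible e true. Qed.

Ltac enum := repeat match goal with
  | H : is_true (_ \in _ :: _) |- _ =>
    rewrite in_cons in H; case/orP: H => [/eqP H|H]
  | H : is_true (_ \in [::]) |- _ => by []
  end.

(** Closes the cases of pairs that occur in the table, where a non-membership hypothesis is
    absurd. *)
Ltac listed := match goal with
  | H : is_true (_ \notin _) |- _ => by move: H; rewrite /= !inE ?eqxx ?orbT
  end.

Lemma table_nonroot : bracket_table [:: xy0; xeps 1 0; yeps 0 1]
  [:: (xeps 1 0, xy0, [:: (1, xy0)]); (yeps 0 1, xy0, [:: (1, xy0)])].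
Proof.
have xyA := xy_admissible e; have xA := xeps10_admissible; have yA := yeps01_admissible.
split=> [a b c H|a b Ha Hb nab nba].
  by enum; case: H => -> -> ->;
    [apply: (euler_value e (sd := false)) | apply: (euler_value e (sd := true))];
    rewrite //= subr0.
have [? ?] := euler_zero e (sd := false) xA isT isT erefl.
have [? ?] := euler_zero e (sd := true) yA isT isT erefl.
have [? ?] := euler_zero e (sd := false) yA isT isT erefl.
by enum; subst a b; first [listed | assumption | exact: bracket_deg0].
Qed.

Lemma table_minus_one : q = -1 ->
  bracket_table [:: x0; y0; xeps 1 0; yeps 0 1; eps 2 0; eps 0 2]
    [:: (xeps 1 0, x0, [:: (1, x0)]);
        (yeps 0 1, y0, [:: (1, y0)]);
        (xeps 1 0, eps 2 0, [:: (- 2%:R, eps 2 0)]);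
        (yeps 0 1, eps 0 2, [:: (- 2%:R, eps 0 2)])].
Proof.
move=> q1; have xA := xeps10_admissible; have yA := yeps01_admissible.
have x0A := letter0_admissible e false q1; have y0A := letter0_admissible e true q1.
have A20 : admissible (eps 2 0) by apply: eps_admissible_root; rewrite ?q1 ?expr0 ?sqrrN ?expr1n.
have A02 : admissible (eps 0 2) by apply: eps_admissible_root; rewrite ?q1 ?expr0 ?sqrrN ?expr1n.
split=> [a b c H|a b Ha Hb nab nba].
  enum; case: H => -> -> ->.
  - by apply: (euler_value e (sd := false)) => //=; rewrite subr0.
  - by apply: (euler_value e (sd := true)) => //=; rewrite subr0.
  - by apply: (euler_value e (sd := false)) => //=; rewrite sub0r.
  - by apply: (euler_value e (sd := true)) => //=; rewrite sub0r.
have [? ?] := euler_zero e (sd := false) xA isT isT erefl.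
have [? ?] := euler_zero e (sd := true) yA isT isT erefl.
have [? ?] := euler_zero e (sd := false) yA isT isT erefl.
have [? ?] := euler_zero e (sd := false) y0A isT isT erefl.
have [? ?] := euler_zero e (sd := true) x0A isT isT erefl.
have [? ?] := euler_zero e (sd := false) A02 isT isT erefl.
have [? ?] := euler_zero e (sd := true) A20 isT isT erefl.
have [? ?] := letter0_eps2 e false (sd := false) q1 A20.
have [? ?] := letter0_eps2 e true (sd := false) q1 A20.
have [? ?] := letter0_eps2 e false (sd := true) q1 A02.
have [? ?] := letter0_eps2 e true (sd := true) q1 A02.
have c0 : forall a b, comb_of x y [::] a b = 0 by exact: comb_of0.
by enum; subst a b; first
  [listed | assumption | exact: (bracket_deg0 e) | exact: (bracket_eps_eps e)].
Qed.

(** The sign condition in [k] treats even r and characteristic 2 alike. *)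
Lemma table_root (r : nat) : q != 1 -> r.-primitive_root q -> (-1) ^+ r = 1 :> k ->
  bracket_table [:: xy0; xeps 1 0; yeps 0 1; eps r 0; eps 0 r]
    [:: (xeps 1 0, xy0, [:: (1, xy0)]);
        (yeps 0 1, xy0, [:: (1, xy0)]);
        (eps r 0, xeps 1 0, [:: (r%:R, eps r 0)]);
        (eps 0 r, yeps 0 1, [:: (r%:R, eps 0 r)])].
Proof.
move=> q1 qr sgn; have r0 := prim_order_gt0 qr; have qr1 := prim_expr_order qr.
have xyA := xy_admissible e; have xA := xeps10_admissible; have yA := yeps01_admissible.
have Ar0 : admissible (eps r 0) by apply: eps_admissible_root; rewrite ?addn0 ?expr0.
have A0r : admissible (eps 0 r) by apply: eps_admissible_root; rewrite ?add0n ?expr0.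
have c0 : forall a b, comb_of x y [::] a b = 0 by exact: comb_of0.
split=> [a b c H|a b Ha Hb nab nba].
  enum; case: H => -> -> ->.
  - by apply: (euler_value e (sd := false)) => //=; rewrite subr0.
  - by apply: (euler_value e (sd := true)) => //=; rewrite subr0.
  - by apply: (euler_valueC e (sd := false)) => //=; rewrite subr0.
  - by apply: (euler_valueC e (sd := true)) => //=; rewrite subr0.
have [? ?] := euler_zero e (sd := false) xA isT isT erefl.
have [? ?] := euler_zero e (sd := true) yA isT isT erefl.
have [? ?] := euler_zero e (sd := false) yA isT isT erefl.
have [? ?] := euler_zero e (sd := false) A0r isT isT erefl.
have [? ?] := euler_zero e (sd := true) Ar0 isT isT erefl.
have [|? ?] := bracket_xy_pure_eps e q1 r0 sgn _ Ar0 c0; first by rewrite !inE eqxx.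
have [|? ?] := bracket_xy_pure_eps e q1 r0 sgn _ A0r c0; first by rewrite !inE eqxx orbT.
by enum; subst a b; first
  [listed | assumption | exact: (bracket_deg0 e)
  | apply: (bracket_eps_eps e); rewrite ?addn0].
Qed.

(** Total degree 2r makes the sign in [eps_admissible_root] equal to 1 and admits the mixed class
    [eps r r], whose bracket with xy is removed by a coboundary. *)
Lemma table_odd_root (r : nat) : q != 1 -> r.-primitive_root q ->
  bracket_table [:: xy0; xeps 1 0; yeps 0 1; eps (2 * r)%N 0; eps r r; eps 0 (2 * r)%N]
    [:: (xeps 1 0, xy0, [:: (1, xy0)]);
        (yeps 0 1, xy0, [:: (1, xy0)]);
        (eps (2 * r)%N 0, xeps 1 0, [:: ((2 * r)%N%:R, eps (2 * r)%N 0)]);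
        (eps r r, xeps 1 0, [:: (r%:R, eps r r)]);
        (eps r r, yeps 0 1, [:: (r%:R, eps r r)]);
        (eps 0 (2 * r)%N, yeps 0 1, [:: ((2 * r)%N%:R, eps 0 (2 * r)%N)])].
Proof.
move=> q1 qr; have r0 := prim_order_gt0 qr; have qr1 := prim_expr_order qr.
have rr0 : (0 < 2 * r)%N by rewrite muln_gt0.
have sgn : (-1) ^+ (2 * r) = 1 :> k by rewrite exprM sqrrN !expr1n.
have qrr1 : q ^+ (2 * r) = 1 by rewrite mulnC exprM qr1 expr1n.
have xyA := xy_admissible e; have xA := xeps10_admissible; have yA := yeps01_admissible.
have Ar0 : admissible (eps (2 * r) 0) by apply: eps_admissible_root; rewrite ?addn0 ?expr0.
have A0r : admissible (eps 0 (2 * r)) by apply: eps_admissible_root; rewrite ?add0n ?expr0.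
have Arr : admissible (eps r r) by apply: eps_admissible_root; rewrite ?addnn -?mul2n.
have c0 : forall a b, comb_of x y [::] a b = 0 by exact: comb_of0.
split=> [a b c H|a b Ha Hb nab nba].
  enum; case: H => -> -> ->.
  - by apply: (euler_value e (sd := false)) => //=; rewrite subr0.
  - by apply: (euler_value e (sd := true)) => //=; rewrite subr0.
  - by apply: (euler_valueC e (sd := false)) => //=; rewrite subr0.
  - by apply: (euler_valueC e (sd := false)) => //=; rewrite subr0.
  - by apply: (euler_valueC e (sd := true)) => //=; rewrite subr0.
  - by apply: (euler_valueC e (sd := true)) => //=; rewrite subr0.
have [? ?] := euler_zero e (sd := false) xA isT isT erefl.
have [? ?] := euler_zero e (sd := true) yA isT isT erefl.
have [? ?] := euler_zero e (sd := false) yA isT isT erefl.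
have [? ?] := euler_zero e (sd := false) A0r isT isT erefl.
have [? ?] := euler_zero e (sd := true) Ar0 isT isT erefl.
have [|? ?] := bracket_xy_pure_eps e q1 rr0 sgn _ Ar0 c0; first by rewrite !inE eqxx.
have [|? ?] := bracket_xy_pure_eps e q1 rr0 sgn _ A0r c0; first by rewrite !inE eqxx orbT.
have [? ?] := bracket_xy_mixed_eps e q1 r0 qr1 Arr c0.
by enum; subst a b; first
  [listed | assumption | exact: (bracket_deg0 e)
  | apply: (bracket_eps_eps e); rewrite ?addn0 ?addn_gt0 ?r0].
Qed.

Lemma letter0_eps1_table b i j : q = -1 -> (i + j)%N = 1%N -> admissible (eps i j) ->
  if [:: b] == monword i j then bracket_is (letter0 b) (eps i j) [:: (- 1, one0)]
  else bracket_is (letter0 b) (eps i j) [::] /\ bracket_is (eps i j) (letter0 b) [::].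
Proof.
move=> q1 eij adm; have bA := letter0_admissible e b q1.
have d0 : (deg (letter0 b) + deg (eps i j)).-1 = 0%N by rewrite /deg /= eij; case: (b).
have val := letter0_eps1 e b eij.
case: ifP => bij; rewrite bij in val.
  apply: (bracket_exact (e := e) bA adm) => a c; rewrite d0; case: a c => [|//] [|//] _.
  rewrite val comb_of_cons comb_of0 /cochain_of /= !expr0 mul1r addr0 scaleN1r.
  by [].
apply: (bracket_zero (e := e) bA adm) => a c; rewrite d0; case: a c => [|//] [|//] _.
by rewrite val oppr0.
Qed.

Lemma table_char2 : 2%N \in [pchar k] -> q = 1 ->
  bracket_table [:: x0; y0; eps 1 0; eps 0 1]
    [:: (x0, eps 1 0, [:: (1, one0)]); (y0, eps 0 1, [:: (1, one0)])].
Proof.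
(* In characteristic 2 the value 1 of q is also -1, so the lemmas for the commutative case q = -1
   apply. *)
move=> ch2 q1; have N1 : - 1 = 1 :> k by exact: oppr_pchar2.
have qN1 : q = - 1 by rewrite N1.
have x0A := letter0_admissible e false qN1; have y0A := letter0_admissible e true qN1.
have A10 : admissible (eps 1 0) by apply: eps_admissible_root; rewrite ?q1 ?N1 ?expr1n.
have A01 : admissible (eps 0 1) by apply: eps_admissible_root; rewrite ?q1 ?N1 ?expr1n.
have c0 : forall a b, comb_of x y [::] a b = 0 by exact: comb_of0.
have := letter0_eps1_table false qN1 (erefl : (1 + 0 = 1)%N) A10.
have := letter0_eps1_table true qN1 (erefl : (0 + 1 = 1)%N) A01.
have := letter0_eps1_table false qN1 (erefl : (0 + 1 = 1)%N) A01.
have := letter0_eps1_table true qN1 (erefl : (1 + 0 = 1)%N) A10.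
rewrite /= N1 => -[? ?] [? ?] ? ?.
split=> [a b c H|a b Ha Hb nab nba]; first by enum; case: H => -> -> ->.
by enum; subst a b; first
  [listed | assumption | exact: (bracket_deg0 e) | exact: (bracket_eps_eps e)].
Qed.

Lemma table_exterior : q = 1 ->
  bracket_table [:: xy0; xeps 1 0; yeps 1 0; xeps 0 1; yeps 0 1;
              eps 2 0; eps 1 1; eps 0 2]
      [:: (xy0, xeps 1 0, [:: (- 1, xy0)]);
          (xy0, yeps 0 1, [:: (- 1, xy0)]);
          (xy0, eps 2 0, [:: (- 2%:R, yeps 1 0)]);
          (xy0, eps 1 1, [:: (- 1, yeps 0 1); (1, xeps 1 0)]);
          (xy0, eps 0 2, [:: (2%:R, xeps 0 1)]);
          (xeps 1 0, yeps 1 0, [:: (- 1, yeps 1 0)]);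
          (xeps 1 0, xeps 0 1, [:: (1, xeps 0 1)]);
          (yeps 1 0, xeps 0 1, [:: (1, yeps 0 1); (- 1, xeps 1 0)]);
          (yeps 1 0, yeps 0 1, [:: (- 1, yeps 1 0)]);
          (xeps 0 1, yeps 0 1, [:: (1, xeps 0 1)]);
          (xeps 1 0, eps 2 0, [:: (- 2%:R, eps 2 0)]);
          (xeps 1 0, eps 1 1, [:: (- 1, eps 1 1)]);
          (yeps 1 0, eps 1 1, [:: (- 1, eps 2 0)]);
          (yeps 1 0, eps 0 2, [:: (- 2%:R, eps 1 1)]);
          (xeps 0 1, eps 2 0, [:: (- 2%:R, eps 1 1)]);
          (xeps 0 1, eps 1 1, [:: (- 1, eps 0 2)]);
          (yeps 0 1, eps 1 1, [:: (- 1, eps 1 1)]);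
          (yeps 0 1, eps 0 2, [:: (- 2%:R, eps 0 2)])].
Proof.
move=> q1; have eA i j : (i + j)%N = 2%N -> admissible (eps i j).
  by move=> eij; apply: eps_admissible_root; rewrite ?eij ?q1 ?sqrrN ?expr1n.
have xyA := xy_admissible e; have xA := xeps10_admissible; have yA := yeps01_admissible.
have A20 := eA 2%N 0%N erefl; have A11 := eA 1%N 1%N erefl; have A02 := eA 0%N 2%N erefl.
have PA := partial_admissible e false q1; have PB := partial_admissible e true q1.
have [t1 t2 t3] := xy_eps_table e q1 eA.
have [t4 t5 t6 t7] := partial_eps_table e q1 eA.
have t8 := partial_partial e q1.
split=> [a b c H|a b Ha Hb nab nba].
  enum; case: H => -> -> ->; first [assumption
    | by apply: (euler_value e (sd := false)); rewrite //= ?subr0 ?sub0r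
    | by apply: (euler_value e (sd := true)); rewrite //= ?subr0 ?sub0r
    | by apply: (euler_valueC e (sd := false)); rewrite //= ?subr0 ?sub0r
    | by apply: (euler_valueC e (sd := true)); rewrite //= ?subr0 ?sub0r].
have c0 : forall a b, comb_of x y [::] a b = 0 by exact: comb_of0.
have [? ?] := euler_zero e (sd := false) xA isT isT erefl.
have [? ?] := euler_zero e (sd := true) yA isT isT erefl.
have [? ?] := euler_zero e (sd := false) yA isT isT erefl.
have [? ?] := euler_zero e (sd := false) A02 isT isT erefl.
have [? ?] := euler_zero e (sd := true) A20 isT isT erefl.
have [? ?] := partial_xy e false q1; have [? ?] := partial_xy e true q1.
have ? := partial_self e false q1; have ? := partial_self e true q1.
have [? ? ? ?] := partial_eps_zero e q1 eA.
by enum; subst a b; first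
  [listed | assumption | exact: (bracket_deg0 e) | exact: (bracket_eps_eps e)].
Qed.

End BracketTables.

Unset Implicit Arguments.

Theorem mainTheorem3 (k : fieldType) (q : k) (q_neq0 : q != 0)
    (L : algType k) (pi : {lrmorphism free_xy k -> L})
    (pi_pres : presents_Lambda q pi) :
  let table := bracket_table q (pi (gen_x k)) (pi (gen_y k)) in
  ((forall n : nat, (0 < n)%N -> q ^+ n != 1) ->
    table [:: xy0; xeps 1 0; yeps 0 1]
      [:: (xeps 1 0, xy0, [:: (1, xy0)]);
          (yeps 0 1, xy0, [:: (1, xy0)])])
  /\
  (2%N \notin [pchar k] -> q = -1 ->
    table [:: x0; y0; xeps 1 0; yeps 0 1; eps 2 0; eps 0 2]
      [:: (xeps 1 0, x0, [:: (1, x0)]);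
          (yeps 0 1, y0, [:: (1, y0)]);
          (xeps 1 0, eps 2 0, [:: (- 2%:R, eps 2 0)]);
          (yeps 0 1, eps 0 2, [:: (- 2%:R, eps 0 2)])])
  /\
  (forall r : nat,
    2%N \notin [pchar k] -> q != 1 -> r.-primitive_root q -> odd r ->
    table [:: xy0; xeps 1 0; yeps 0 1;
              eps (2 * r)%N 0; eps r r; eps 0 (2 * r)%N]
      [:: (xeps 1 0, xy0, [:: (1, xy0)]);
          (yeps 0 1, xy0, [:: (1, xy0)]);
          (eps (2 * r)%N 0, xeps 1 0, [:: ((2 * r)%N%:R, eps (2 * r)%N 0)]);
          (eps r r, xeps 1 0, [:: (r%:R, eps r r)]);
          (eps r r, yeps 0 1, [:: (r%:R, eps r r)]);
          (eps 0 (2 * r)%N, yeps 0 1, [:: ((2 * r)%N%:R, eps 0 (2 * r)%N)])])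
  /\
  (forall r : nat,
    q != 1 -> r.-primitive_root q ->
    (2%N \notin [pchar k] /\ ~~ odd r) \/ 2%N \in [pchar k] ->
    table [:: xy0; xeps 1 0; yeps 0 1; eps r 0; eps 0 r]
      [:: (xeps 1 0, xy0, [:: (1, xy0)]);
          (yeps 0 1, xy0, [:: (1, xy0)]);
          (eps r 0, xeps 1 0, [:: (r%:R, eps r 0)]);
          (eps 0 r, yeps 0 1, [:: (r%:R, eps 0 r)])])
  /\
  (2%N \in [pchar k] -> q = 1 ->
    table [:: x0; y0; eps 1 0; eps 0 1]
      [:: (x0, eps 1 0, [:: (1, one0)]);
          (y0, eps 0 1, [:: (1, one0)])])
  /\
  (2%N \notin [pchar k] -> q = 1 ->
    table [:: xy0; xeps 1 0; yeps 1 0; xeps 0 1; yeps 0 1;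
              eps 2 0; eps 1 1; eps 0 2]
      [:: (xy0, xeps 1 0, [:: (- 1, xy0)]);
          (xy0, yeps 0 1, [:: (- 1, xy0)]);
          (xy0, eps 2 0, [:: (- 2%:R, yeps 1 0)]);
          (xy0, eps 1 1, [:: (- 1, yeps 0 1); (1, xeps 1 0)]);
          (xy0, eps 0 2, [:: (2%:R, xeps 0 1)]);
          (xeps 1 0, yeps 1 0, [:: (- 1, yeps 1 0)]);
          (xeps 1 0, xeps 0 1, [:: (1, xeps 0 1)]);
          (yeps 1 0, xeps 0 1, [:: (1, yeps 0 1); (- 1, xeps 1 0)]);
          (yeps 1 0, yeps 0 1, [:: (- 1, yeps 1 0)]);
          (xeps 0 1, yeps 0 1, [:: (1, xeps 0 1)]);
          (xeps 1 0, eps 2 0, [:: (- 2%:R, eps 2 0)]);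
          (xeps 1 0, eps 1 1, [:: (- 1, eps 1 1)]);
          (yeps 1 0, eps 1 1, [:: (- 1, eps 2 0)]);
          (yeps 1 0, eps 0 2, [:: (- 2%:R, eps 1 1)]);
          (xeps 0 1, eps 2 0, [:: (- 2%:R, eps 1 1)]);
          (xeps 0 1, eps 1 1, [:: (- 1, eps 0 2)]);
          (yeps 0 1, eps 1 1, [:: (- 1, eps 1 1)]);
          (yeps 0 1, eps 0 2, [:: (- 2%:R, eps 0 2)])]).
Proof.
have e := presented_quantum_exterior q_neq0 pi_pres.
move=> table; split=> [_|]; first exact: table_nonroot e.
split=> [_ qN1|]; first exact: table_minus_one e qN1.
split=> [r _ q1 qr _|]; first exact (table_odd_root e q1 qr).
split=> [r q1 qr rP|].
  refine (table_root e q1 qr _); case: rP => [[_ r_even]|ch2].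
    by rewrite -signr_odd (negbTE r_even).
  by rewrite (oppr_pchar2 ch2) expr1n.
by split=> [ch2 q1|_ q1]; [exact (table_char2 e ch2 q1)|exact (table_exterior e q1)].
Qed.
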